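(* Let $\Gamma$ be a sofic group, let $n\ge 1$, and let $A \in M_n(\mathbb{Z}\Gamma)$. Let $\lambda(A)$ be the bounded operator on the Hilbert space $(\ell^2\Gamma)^{\oplus n}$ given by left convolution by $A$. Then: (i) All eigenvalues of $\lambda(A)$ are algebraic integers. (ii) If $\alpha\in\mathbb{C}$ is an eigenvalue of $\lambda(A)$, then all Galois conjugates of $\alpha$ are also eigenvalues of $\lambda(A)$, and the corresponding eigenspaces have the same von Neumann dimension.
   Context: $\Gamma$ is a discrete group. For $\sigma\in S_m$ let $\#_1\sigma$ denote the number of fixed points of $\sigma$. $\Gamma$ is called sofic if for every real $0<\epsilon<1$ and every finite subset $F\subseteq\Gamma$ there exist a natural number $m$ and a map $\phi\colon\Gamma\to S_m$ such that: (1) $\#_1\big(\phi(g)\phi(h)\phi(gh)^{-1}\big)\ge(1-\epsilon)m$ for all $g,h\in F$; (2) $\phi(e)=e$; (3) $\#_1\phi(g)\le\epsilon m$ for all $e\ne g\in F$. $\ell^2\Gamma$ is the Hilbert space with orthonormal basis $\Gamma$; $L\Gamma$ is the von Neumann algebra of bounded operators on $\ell^2\Gamma$ commuting with the right convolution action of $\Gamma$, with trace $\tau(T)=\langle T\delta_e,\delta_e\rangle$. An eigenvalue of $\lambda(A)$ is $\alpha\in\mathbb{C}$ with $\ker(\alpha\cdot\mathrm{id}-\lambda(A))\neq 0$ in $(\ell^2\Gamma)^{\oplus n}$. The von Neumann dimension $\dim_{L\Gamma}V$ of a closed right-$\Gamma$-invariant subspace $V\subseteq(\ell^2\Gamma)^{\oplus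 n}$ is $\sum_{i=1}^n\tau(P_{ii})$, where $P=(P_{ij})\in M_n(L\Gamma)$ is the orthogonal projection onto $V$. The Galois conjugates of an algebraic number are the complex roots of its minimal polynomial over $\mathbb{Q}$. *)

(* Defs.v *)
From HB Require Import structures.
From mathcomp Require Import all_boot all_order all_algebra all_fingroup.
From mathcomp Require Import finmap.
From mathcomp Require Import all_classical all_reals.
From mathcomp Require Import ereal esum.
From mathcomp Require Import complex ring lra.

Set Implicit Arguments.
Unset Strict Implicit.
Unset Printing Implicit Defensive.

Import Order.TTheory GRing.Theory Num.Theory.

Local Open Scope classical_set_scope.
Local Open Scope ring_scope.

Definition fixpoints m (s : 'S_m) : nat := #|[set i | s i == i]%SET|.

(* The product of ['S_m] composes permutations from left to right. As
   [s |-> s^-1] is an isomorphism onto ['S_m] with the opposite convention and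
   preserves [fixpoints], the notion does not depend on this convention. The
   degree [m] has to be positive: for [m = 0] all the conditions hold trivially. *)
Definition sofic (R : realType) (G : groupType) : Prop :=
  forall (eps : R) (F : {fset G}), 0 < eps < 1 ->
  exists (m : nat) (phi : G -> 'S_m),
    [/\ (0 < m)%N,
        forall g h, g \in F -> h \in F ->
          (1 - eps) * m%:R
            <= (fixpoints (phi g * phi h * (phi (g * h))^-1)%g)%:R,
        phi 1%g = 1%g
      & forall g, g \in F -> g != 1%g -> (fixpoints (phi g))%:R <= eps * m%:R].

Section ell2.
Variables (R : realType) (G : groupType).
Local Notation C := R[i].

Definition sqmod (z : C) : R := complex.Re z ^+ 2 + complex.Im z ^+ 2.

Definition l2pred : {pred G -> C} :=
  fun x => `[< (\esum_(g in [set: G]) (sqmod (x g))%:E < +oo)%E >].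

Lemma l2predP (x : G -> C) :
  reflect (\esum_(g in [set: G]) (sqmod (x g))%:E < +oo)%E (x \in l2pred).
Proof. exact: asboolP. Qed.

Lemma sqmod_ge0 z : 0 <= sqmod z.
Proof. by rewrite addr_ge0 ?sqr_ge0. Qed.

Lemma sqmod0 : sqmod 0 = 0.
Proof. by rewrite /sqmod /= !expr0n addr0. Qed.

Lemma sqmodM a b : sqmod (a * b) = sqmod a * sqmod b.
Proof. by case: a b => [a b] [c d]; rewrite /sqmod /=; ring. Qed.

Lemma sqmodD_le a b : sqmod (a + b) <= 2 * sqmod a + 2 * sqmod b.
Proof.
case: a b => [a b] [c d]; rewrite /sqmod /= -subr_ge0.
have -> : 2 * (a ^+ 2 + b ^+ 2) + 2 * (c ^+ 2 + d ^+ 2)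
    - ((a + c) ^+ 2 + (b + d) ^+ 2) = (a - c) ^+ 2 + (b - d) ^+ 2 by ring.
by rewrite addr_ge0 ?sqr_ge0.
Qed.

Lemma l2pred_submod_closed : submod_closed l2pred.
Proof.
split.
- apply/l2predP; rewrite esum1 ?ltry// => g _.
  by rewrite -[RHS]/0%:E -sqmod0.
- move=> a x y /l2predP xfin /l2predP yfin; apply/l2predP.
  pose b := 2 * sqmod a.
  have b0 : 0 <= b by rewrite mulr_ge0 ?sqmod_ge0.
  have esumZ (k : R) (z : G -> C) : 0 <= k ->
      (\esum_(g in [set: G]) (sqmod (z g))%:E < +oo)%E ->
      (\esum_(g in [set: G]) (k * sqmod (z g))%:E < +oo)%E.
    move=> k0 zfin.
    have zfin' : \esum_(g in [set: G]) (sqmod (z g))%:E \is a fin_num.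
      by rewrite ge0_fin_numE// esum_ge0// => g _; rewrite lee_fin sqmod_ge0.
    apply: (@le_lt_trans _ _ (k%:E * \esum_(g in [set: G]) (sqmod (z g))%:E)%E).
      apply: ub_ereal_sup => _ [F [Ffin _] <-].
      under eq_fsbigr do rewrite EFinM.
      rewrite -ge0_mule_fsumr; last by move=> g; rewrite lee_fin sqmod_ge0.
      by rewrite lee_wpmul2l// ?lee_fin//; apply: ereal_sup_ubound; exists F.
    by rewrite -(fineK zfin') -EFinM ltry.
  apply: (@le_lt_trans _ _ (\esum_(g in [set: G]) (b * sqmod (x g))%:E
      + \esum_(g in [set: G]) (2 * sqmod (y g))%:E)%E); last first.
    by rewrite lte_add_pinfty//; apply: esumZ.
  rewrite -esumD; first last.
  - by move=> g _; rewrite lee_fin mulr_ge0 ?sqmod_ge0.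
  - by move=> g _; rewrite lee_fin mulr_ge0 ?sqmod_ge0.
  apply: le_esum => g _; rewrite -EFinD lee_fin.
  by rewrite (le_trans (sqmodD_le _ _))// lerD2r /b -mulrA -sqmodM.
Qed.

HB.instance Definition _ :=
  GRing.isSubmodClosed.Build _ _ l2pred l2pred_submod_closed.

Record ell2 := Ell2 { ell2_fun :> G -> C; _ : ell2_fun \in l2pred }.

HB.instance Definition _ := [isSub for ell2_fun].
HB.instance Definition _ := [Choice of ell2 by <:].
HB.instance Definition _ := [SubChoice_isSubLmodule of ell2 by <:].

Lemma delta_subproof (a : G) : (fun g => (g == a)%:R : C) \in l2pred.
Proof.
apply/l2predP; rewrite (esumID [set a]); last first.
  by move=> g _; rewrite lee_fin sqmod_ge0.
rewrite setTI setTI esum_set1 ?lee_fin ?sqmod_ge0// esum1 ?adde0 ?ltry// => g /=.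
by move=> /eqP/negPf->; rewrite sqmod0.
Qed.

Definition delta (a : G) : ell2 := Ell2 (delta_subproof a).

Lemma ltranslate_subproof (h : G) (x : ell2) :
  (fun g => x (h^-1 * g)%g) \in l2pred.
Proof.
have /l2predP xfin := valP x; apply/l2predP; move: xfin.
rewrite (@reindex_esum _ _ _ setT setT (fun g => h^-1 * g)%g)//.
split => // [g g' _ _ /mulgI//|g _].
by exists (h * g)%g => //; rewrite mulKg.
Qed.

(* The function [delta h * x], i.e. [x] translated on the left by [h]. *)
Definition ltranslate (h : G) (x : ell2) : ell2 :=
  Ell2 (ltranslate_subproof h x).

(* Sum of an absolutely summable family of real, resp. complex, numbers. *)
Definition rsum (f : G -> R) : R :=
  fine (\esum_(g in [set: G]) (Num.max (f g) 0)%:E)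
  - fine (\esum_(g in [set: G]) (Num.max (- f g) 0)%:E).

Definition csum (f : G -> C) : C :=
  Complex (rsum (fun g => complex.Re (f g))) (rsum (fun g => complex.Im (f g))).

Definition inner (x y : ell2) : C := csum (fun g => x g * (y g)^*).

Definition trace (T : ell2 -> ell2) : C := inner (T (delta 1%g)) (delta 1%g).

End ell2.

Arguments delta {R G} a.

(* The underlying set of the integral group ring: finitely supported functions. *)
Definition group_ring (G : groupType) := {fsfun G -> int with 0}.

Section ell2n.
Variables (R : realType) (G : groupType) (n : nat).
Local Notation C := R[i].
Local Notation H := (ell2 R G).
Local Notation Hn := ('I_n -> H).

Definition conv (a : group_ring G) (x : H) : H :=
  \sum_(h <- finsupp a) (a h)%:~R *: ltranslate h x.

Lemma convE a x g :
  conv a x g = \sum_(h <- finsupp a) (a h)%:~R * x (h^-1 * g)%g.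
Proof.
rewrite /conv; elim/big_ind2: _ => //= y1 z1 y2 z2 <- <-; exact: erefl.
Qed.

Definition lambda (A : 'M[group_ring G]_n) (x : Hn) : Hn :=
  fun i => \sum_j conv (A i j) (x j).

Definition eigenker (A : 'M[group_ring G]_n) (alpha : C) : set Hn :=
  [set x | alpha *: x - lambda A x = 0].

Definition is_eigenvalue (A : 'M[group_ring G]_n) (alpha : C) : Prop :=
  exists2 x, eigenker A alpha x & x != 0.

Definition innern (x y : Hn) : C := \sum_i inner (x i) (y i).

Definition is_orthoproj (V : set Hn) (P : Hn -> Hn) : Prop :=
  forall x, V (P x) /\ (forall v, V v -> innern (x - P x) v = 0).

(* An arbitrary value unless [V] is a closed subspace, in which case the
   orthogonal projection exists and is unique. *)
Definition orthoproj (V : set Hn) : Hn -> Hn :=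
  xget (fun=> 0 : Hn) [set P : Hn -> Hn | is_orthoproj V P].

Definition op_entry (T : Hn -> Hn) (i j : 'I_n) (x : H) : H :=
  T (fun k => if k == j then x else 0) i.

Definition vn_dim (V : set Hn) : C :=
  \sum_i trace (op_entry (orthoproj V) i i).

End ell2n.

Definition is_minpoly (K : fieldType) (alpha : K) (p : {poly rat}) : Prop :=
  [/\ p \is monic, root (map_poly ratr p) alpha
    & forall q : {poly rat}, root (map_poly ratr q) alpha -> p %| q].

Definition galois_conjugate (K : fieldType) (alpha beta : K) : Prop :=
  exists2 p, is_minpoly alpha p & root (map_poly ratr p) beta.

(* Main.v *)
From HB Require Import structures.
From mathcomp Require Import all_boot all_order all_algebra all_fingroup.
From mathcomp Require Import finmap.
From mathcomp Require Import all_classical all_reals.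
From mathcomp Require Import ereal esum.
From mathcomp Require Import separable complex zify ring lra.
Require Import Defs.

(** Write [dim f] for the von Neumann dimension of the kernel of [f(A)], for a
    complex polynomial [f]; here [A] is short for its convolution operator. A number
    [a] is an eigenvalue if and only if [dim ('X - a)] is positive ([ker_dim_gt0]).
    The theorem compares the dimensions with the kernels of the integer matrices
    [A_psi] in which an almost action [psi] of the group on [m] points replaces the
    action of the group on itself. Four facts carry the proof.

    - The trace property makes [dim] additive on products of coprime polynomials,
      as complementary idempotents have traces adding up ([poly_dimM]).

    - [dim f] is the infimum of [||1 - f(A)^* Y||_2 ^ 2] over finitely supported [Y].
      Such norms are computed by the finite models, up to a small error
      ([approximates_sqfrob]). As [||1 - M^* Z||_2 ^ 2 >= dim (ker M)] for matrices,
      [dim (ker f(A_psi)) / m] is asymptotically at most [dim f] ([null_le]).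

    - If [q] has integer coefficients, then the product of the nonzero eigenvalues of
      [q(A_psi)^* q(A_psi)] is a nonzero integer, so that few of them are close to
      [0] ([card_small_eig]). Taking for [Y] a truncated Neumann series then gives
      the converse inequality: [dim q] is asymptotically at most
      [dim (ker q(A_psi)) / m] ([poly_dim_le_int]).

    - Minors of [a - A_psi] are rational polynomials in [a], so conjugate numbers [a]
      have kernels of the same dimension in the finite models ([null_conj]).

    Let [a] be an algebraic eigenvalue with conjugates [a_1, ..., a_k]. The kernels
    of the [a_i - A_psi] have a common dimension [d_psi]. Asymptotically [d_psi / m]
    is at most each [dim ('X - a_i)], and [k * d_psi / m] is at least the dimension
    for the minimal polynomial, which is the sum of the [dim ('X - a_i)]. Hence these
    are all equal ([poly_dim_conj]). As the kernel of [a - A_psi] is nonzero for some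
    [psi], [a] is a root of a monic integer polynomial ([integral_of_minpoly]).

    It remains to exclude a transcendental eigenvalue [a], with
    [delta = dim ('X - a) > 0]. For an integer polynomial [Q] choose by the box
    principle an integer polynomial [r] such that [r(a)] is smaller than a prescribed
    negative power of the height of [r] ([small_integer_poly]).
    On the kernel of [Q * ('X - a)], of dimension [dim Q + delta], the operator
    [(Q * r)(A)] is tiny; but by integrality the tiny singular values of
    [(Q * r)(A_psi)] mostly vanish, so that [dim (Q * r) >= dim Q + delta / 2]
    ([transcendental_step]). Iterating this contradicts [dim <= n]. *)

Set Implicit Arguments.
Unset Strict Implicit.
Unset Printing Implicit Defensive.

Import Order.TTheory GRing.Theory Num.Theory.

Local Open Scope classical_set_scope.
Local Open Scope ring_scope.

(** * Unconditional sums *)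

Section UnconditionalSums.
Variables (R : realType) (I : choiceType).
Local Notation C := R[i].
Implicit Types (f g : I -> C) (F : {fset I}).

(** Convergence of the net of finite partial sums: unlike the sums of positive
    and negative parts, it is visibly linear, conjugation invariant and
    insensitive to reindexing. *)
Definition hsum f (s : C) := forall e : R, 0 < e ->
  exists F0, forall F, (F0 `<=` F)%fset -> `|\sum_(i <- F) f i - s| <= e%:C%C.

Lemma hsum_ext f g s : f =1 g -> hsum f s -> hsum g s.
Proof.
by move=> fg fs e /fs[F0 F0P]; exists F0 => F /F0P; under eq_bigr do rewrite fg.
Qed.

Lemma hsumD f g s t : hsum f s -> hsum g t -> hsum (fun i => f i + g i) (s + t).
Proof.
move=> fs gt e e0; have e20 : 0 < e / 2 by rewrite divr_gt0.
have [F1 H1] := fs _ e20; have [F2 H2] := gt _ e20.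
exists (F1 `|` F2)%fset => F sF.
rewrite big_split/= opprD addrACA (le_trans (ler_normD _ _))//.
rewrite [e]splitr rmorphD lerD ?H1 ?H2//; apply: fsubset_trans sF.
  exact: fsubsetUl.
exact: fsubsetUr.
Qed.

Lemma hsumZ (a : C) f s : hsum f s -> hsum (fun i => a * f i) (a * s).
Proof.
move=> fs e e0.
have a1 : 0 < complex.Re `|a| + 1.
  by rewrite ltr_wpDl// -ler0c RRe_real ?normr_real.
have [F0 H0] := fs (e / (complex.Re `|a| + 1)) (divr_gt0 e0 a1).
exists F0 => F /H0 le1; rewrite -mulr_sumr -mulrBr normrM.
apply: le_trans (ler_wpM2l (normr_ge0 _) le1) _.
rewrite -[X in X * _](RRe_real (normr_real a)) -rmorphM lecR /= mulrCA ger_pMr//.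
by rewrite ler_pdivrMr// mul1r lerDl.
Qed.

Lemma hsum_conj f s : hsum f s -> hsum (fun i => (f i)^*) s^*.
Proof.
move=> fs e /fs[F0 F0P]; exists F0 => F /F0P.
by rewrite -rmorph_sum -rmorphB norm_conjC.
Qed.

Lemma eq_of_small (s t : C) :
  (forall e : R, 0 < e -> `|s - t| <= e%:C%C) -> s = t.
Proof.
move=> st; apply/eqP; rewrite -subr_eq0 -normr_le0 -(RRe_real (normr_real (s - t))).
rewrite lecR; apply/ler_addgt0Pr => e /st; rewrite add0r.
by rewrite -(RRe_real (normr_real (s - t))) lecR.
Qed.

Lemma hsum_unique f s t : hsum f s -> hsum f t -> s = t.
Proof.
move=> fs ft; apply: eq_of_small => e e0.
have e20 : 0 < e / 2 by rewrite divr_gt0.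
have [F1 H1] := fs _ e20; have [F2 H2] := ft _ e20.
rewrite [e]splitr rmorphD.
have -> : s - t = (\sum_(i <- (F1 `|` F2)%fset) f i - t)
                 - (\sum_(i <- (F1 `|` F2)%fset) f i - s) by ring.
by rewrite (le_trans (ler_normB _ _))// lerD ?H1 ?H2 ?fsubsetUl ?fsubsetUr.
Qed.

Lemma hsum_fin f (F0 : {fset I}) : (forall i, i \notin F0 -> f i = 0) ->
  hsum f (\sum_(i <- F0) f i).
Proof.
move=> f0 e e0; exists F0 => F sF.
suff -> : \sum_(i <- F) f i = \sum_(i <- F0) f i.
  by rewrite subrr normr0 ler0c ltW.
rewrite (big_fsetID _ (mem F0))/= [X in _ + X]big1_fset ?addr0; last first.
  by move=> i; rewrite !inE => /andP[_ /f0].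
apply: eq_fbigl => i; rewrite !inE /= andbC.
by case: (boolP (i \in F0)) => //= /(fsubsetP sF).
Qed.

Lemma hsum_ge0 f s : (forall i, 0 <= f i) -> hsum f s -> 
  forall F, \sum_(i <- F) f i <= s.
Proof.
move=> f0 fs F.
have sr : s \is Num.real.
  rewrite CrealE; apply/eqP; apply: hsum_unique (hsum_conj fs) _.
  by apply: hsum_ext fs => i; apply/esym/CrealP/ger0_real.
rewrite -subr_le0; set D := _ - s.
have Dr : D \is Num.real by rewrite rpredB// ger0_real// sumr_ge0.
rewrite -[D]RRe_real// lecR; apply/ler_addgt0Pr => e e0; rewrite add0r.
have [F1 H1] := fs _ e0.
rewrite -lecR RRe_real//; apply: le_trans (H1 (F `|` F1)%fset (fsubsetUr _ _)).
apply: (@le_trans _ _ (\sum_(i <- (F `|` F1)%fset) f i - s)); last first.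
  by apply: real_ler_norm; rewrite rpredB// ger0_real// sumr_ge0.
rewrite /D lerD2r [X in _ <= X](big_fsetID _ (mem F))/=.
rewrite (_ : [fset x in _ | _]%fset = F); first by rewrite lerDl sumr_ge0.
by apply/fsetP => i; rewrite !inE /= andb_idl// => ->.
Qed.

End UnconditionalSums.

Lemma hsum_bij (R : realType) (I J : choiceType) (h : I -> J) (h' : J -> I)
  (f : J -> R[i]) s : cancel h h' -> cancel h' h ->
  hsum f s -> hsum (f \o h) s.
Proof.
move=> hK h'K fs e /fs[F0 F0P]; exists (h' @` F0)%fset => F sF.
have := F0P (h @` F)%fset; rewrite big_imfset/=; last by move=> ? ? _ _ /(can_inj hK).
apply; apply/fsubsetP => j jF; apply/imfsetP; exists (h' j); last by rewrite h'K.
by apply: (fsubsetP sF); apply/imfsetP; exists j.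
Qed.

(** * Square-summable functions *)

Section SquareSummable.
Variables (R : realType) (G : groupType).
Local Notation C := R[i].
Local Notation H := (ell2 R G).

Lemma esum_fsetE (u : G -> R) (F : {fset G}) :
  (\sum_(g \in [set` F]) (u g)%:E = (\sum_(g <- F) u g)%:E)%E.
Proof. by rewrite fsbig_finite// set_fsetK sumEFin. Qed.

Lemma esum_ltP (u : G -> R) :
  ((\esum_(g in [set: G]) (u g)%:E < +oo)%E <->
   exists B, forall F : {fset G}, \sum_(g <- F) u g <= B).
Proof.
split=> [ufin|[B uB]].
  exists (fine (\esum_(g in [set: G]) (u g)%:E)) => F.
  have le_esum : ((\sum_(g <- F) u g)%:E <= \esum_(g in [set: G]) (u g)%:E)%E.
    by rewrite -esum_fsetE; apply: ereal_sup_ubound; exists [set` F].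
  rewrite -lee_fin fineK// fin_numElt ufin andbT.
  by apply: lt_le_trans le_esum; rewrite ltNyr.
apply: (@le_lt_trans _ _ B%:E); last exact: ltry.
apply: ub_ereal_sup => _ [A [Afin _] <-].
by rewrite fsbig_finite// sumEFin lee_fin.
Qed.

Lemma esum_approx (u : G -> R) (B : R) : (forall g, 0 <= u g) ->
    (forall F : {fset G}, \sum_(g <- F) u g <= B) ->
  forall e : R, 0 < e -> exists F0 : {fset G}, forall F, (F0 `<=` F)%fset ->
    `|\sum_(g <- F) u g - fine (\esum_(g in [set: G]) (u g)%:E)| <= e.
Proof.
move=> u0 uB e e0; set s := esum _ _.
have sfin : s \is a fin_num.
  rewrite ge0_fin_numE; last by apply: esum_ge0 => g _; rewrite lee_fin.
  by apply/esum_ltP; exists B.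
have [_ [A [Afin _] <-]] := ub_ereal_sup_adherent e0 sfin.
rewrite fsbig_finite// sumEFin -[ereal_sup _]/s -(fineK sfin) => ltA.
exists (fset_set A) => F sF.
have leF : \sum_(g <- F) u g <= fine s.
  rewrite -lee_fin fineK// -esum_fsetE.
  by apply: ereal_sup_ubound; exists [set` F].
rewrite ler_distl (le_trans leF) ?lerDl ?(ltW e0)// andbT.
move: ltA; rewrite -EFinB lte_fin => /ltW/le_trans; apply.
rewrite [leRHS](big_fsetID _ (mem (fset_set A)))/= -[leLHS]addr0 lerD ?sumr_ge0//.
rewrite le_eqVlt; apply/orP; left; apply/eqP; apply: eq_fbigl => g.
by rewrite !inE /= andbC; case: (boolP (g \in _)) => //= /(fsubsetP sF) ->.
Qed.

Lemma rsumP (f : G -> R) (B : R) :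
    (forall F : {fset G}, \sum_(g <- F) `|f g| <= B) ->
  forall e : R, 0 < e -> exists F0 : {fset G}, forall F, (F0 `<=` F)%fset ->
    `|\sum_(g <- F) f g - rsum f| <= e.
Proof.
move=> fB e e0; have e20 : 0 < e / 2 by rewrite divr_gt0.
have maxB (s : R) (F : {fset G}) : `|s| = 1 -> \sum_(g <- F) Num.max (s * f g) 0 <= B.
  move=> s1; apply: le_trans (fB F); apply: ler_sum => g _.
  by rewrite ge_max normr_ge0 andbT (le_trans (ler_norm _))// normrM s1 mul1r.
have [||F1 H1] := @esum_approx (fun g => Num.max (f g) 0) B _ _ _ e20.
- by move=> g; rewrite le_max lexx orbT.
- by move=> F; have := maxB 1 F (normr1 _); under eq_bigr do rewrite mul1r.
have [||F2 H2] := @esum_approx (fun g => Num.max (- f g) 0) B _ _ _ e20.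
- by move=> g; rewrite le_max lexx orbT.
- by move=> F; have := maxB (-1) F (normrN1 _); under eq_bigr do rewrite mulN1r.
exists (F1 `|` F2)%fset => F sF.
have {}H1 := H1 F (fsubset_trans (fsubsetUl _ _) sF).
have {}H2 := H2 F (fsubset_trans (fsubsetUr _ _) sF).
have -> : \sum_(g <- F) f g =
    \sum_(g <- F) Num.max (f g) 0 - \sum_(g <- F) Num.max (- f g) 0.
  rewrite -sumrB; apply: eq_bigr => g _.
  by rewrite /Num.max oppr_lt0; case: (ltgtP (f g) 0) => [_|_|->];
    rewrite ?sub0r ?opprK ?subr0 ?oppr0 ?addr0.
rewrite /rsum; set a := \sum_(g <- F) _ in H1 *; set b := \sum_(g <- F) _ in H2 *.
set s := fine _ in H1 *; set t := fine _ in H2 *.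
have -> : a - b - (s - t) = (a - s) - (b - t) by ring.
by rewrite [e]splitr (le_trans (ler_normB _ _))// lerD.
Qed.

(** Absolute summability is what makes the difference of the sums of the
    positive and negative parts the limit of the finite partial sums. *)
Lemma csumP (f : G -> C) (B : R) :
  (forall F : {fset G}, \sum_(g <- F) `|f g| <= B%:C%C) -> hsum f (csum f).
Proof.
move=> fB e e0; have e20 : 0 < e / 2 by rewrite divr_gt0.
have part (p : C -> R) : (forall z, `|p z|%:C%C <= `|z|) ->
    forall F : {fset G}, \sum_(g <- F) `|p (f g)| <= B.
  move=> pz F; rewrite -lecR (le_trans _ (fB F))// rmorph_sum/=.
  by apply: ler_sum => g _.
have [F1 H1] := rsumP (part (@complex.Re R) (@normc_ge_Re R)) e20.
have ImN (z : C) : `|complex.Im z|%:C%C <= `|z|.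
  by case: z => a b; rewrite normc_def lecR /= -sqrtr_sqr ler_wsqrtr// lerDr sqr_ge0.
have [F2 H2] := rsumP (part (@complex.Im R) ImN) e20.
exists (F1 `|` F2)%fset => F sF.
have {}H1 := H1 F (fsubset_trans (fsubsetUl _ _) sF).
have {}H2 := H2 F (fsubset_trans (fsubsetUr _ _) sF).
have normRI (z : C) : `|z| <= (`|complex.Re z| + `|complex.Im z|)%:C%C.
  case: z => a b; rewrite normc_def lecR /= -[leRHS]ger0_norm ?addr_ge0//.
  rewrite -sqrtr_sqr ler_wsqrtr// sqrrD !real_normK ?num_real//.
  by rewrite lerD2r lerDl mulrn_wge0// mulr_ge0.
apply: le_trans (normRI _) _; rewrite lecR [e]splitr.
have ReD : {morph @complex.Re R : a b / a + b >-> a + b} by case=> ? ? [].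
have ImD : {morph @complex.Im R : a b / a + b >-> a + b} by case=> ? ? [].
have -> : complex.Re (\sum_(g <- F) f g - csum f) =
    \sum_(g <- F) complex.Re (f g) - rsum (fun g => complex.Re (f g)).
  by rewrite ReD (big_morph _ ReD (erefl _)).
have -> : complex.Im (\sum_(g <- F) f g - csum f) =
    \sum_(g <- F) complex.Im (f g) - rsum (fun g => complex.Im (f g)).
  by rewrite ImD (big_morph _ ImD (erefl _)).
by rewrite lerD.
Qed.

Lemma sqmodE (z : C) : (sqmod z)%:C%C = `|z| ^+ 2.
Proof. exact: add_Re2_Im2. Qed.

Lemma ell2P (x : G -> C) : reflect
  (exists B, forall F : {fset G}, \sum_(g <- F) sqmod (x g) <= B) (x \in @l2pred R G).
Proof. by apply: (iffP (l2predP x)) => /esum_ltP. Qed.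

(** The products are dominated by [`|x g| ^+ 2 + `|y g| ^+ 2]. *)
Lemma inner_hsum (x y : H) : hsum (fun g => x g * (y g)^*) (inner x y).
Proof.
have /ell2P[B xB] := valP x; have /ell2P[B' yB] := valP y.
apply: (@csumP _ (B + B')) => F; apply: (@le_trans _ _
    (\sum_(g <- F) ((sqmod (x g))%:C%C + (sqmod (y g))%:C%C))).
  apply: ler_sum => g _; rewrite normrM norm_conjC !sqmodE.
  have [a b] := (normr_ge0 (x g), normr_ge0 (y g)).
  have : 0 <= (`|x g| - `|y g|) ^+ 2.
    by rewrite real_exprn_even_ge0// rpredB// ?normr_real.
  rewrite sqrrB addrAC subr_ge0; apply: le_trans.
  by rewrite mulr2n lerDl mulr_ge0.
by rewrite big_split/= -!rmorph_sum -rmorphD lecR lerD.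
Qed.

End SquareSummable.

(** * The inner product *)

Section InnerProduct.
Variables (R : realType) (G : groupType) (n : nat).
Local Notation C := R[i].
Local Notation H := (ell2 R G).
Local Notation Hn := ('I_n -> H).
Implicit Types (x y z : Hn) (a : C).

Lemma ell2_ext (u v : H) : (forall g, u g = v g) -> u = v.
Proof. by move=> uv; apply/val_inj/funext. Qed.

Lemma Hn_ext x y : (forall i g, x i g = y i g) -> x = y.
Proof. by move=> xy; apply/funext => i; apply: ell2_ext. Qed.

Lemma innerC (u v : H) : inner v u = (inner u v)^*.
Proof.
apply: (hsum_unique (inner_hsum _ _)).
by apply: hsum_ext (hsum_conj (inner_hsum _ _)) => g; rewrite rmorphM/= conjCK mulrC.
Qed.

Lemma innerDl (u v w : H) : inner (u + v) w = inner u w + inner v w.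
Proof.
apply: (hsum_unique (inner_hsum _ _)).
by apply: hsum_ext (hsumD (inner_hsum _ _) (inner_hsum _ _)) => g; rewrite -mulrDl.
Qed.

Lemma innerZl a (u v : H) : inner (a *: u) v = a * inner u v.
Proof.
apply: (hsum_unique (inner_hsum _ _)).
by apply: hsum_ext (hsumZ a (inner_hsum _ _)) => g; rewrite mulrA.
Qed.

Lemma innernC x y : innern y x = (innern x y)^*.
Proof. by rewrite rmorph_sum; apply: eq_bigr => i _; apply: innerC. Qed.

Lemma innernDl x y z : innern (x + y) z = innern x z + innern y z.
Proof. by rewrite -big_split; apply: eq_bigr => i _; apply: innerDl. Qed.

Lemma innernZl a x y : innern (a *: x) y = a * innern x y.
Proof. by rewrite mulr_sumr; apply: eq_bigr => i _; apply: innerZl. Qed.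

Lemma innernNl x y : innern (- x) y = - innern x y.
Proof. by rewrite -scaleN1r innernZl mulN1r. Qed.

Lemma innernBl x y z : innern (x - y) z = innern x z - innern y z.
Proof. by rewrite innernDl innernNl. Qed.

Lemma innern0l y : innern 0 y = 0.
Proof. by rewrite -(scale0r (0 : Hn)) innernZl mul0r. Qed.

Lemma innernDr x y z : innern z (x + y) = innern z x + innern z y.
Proof. by rewrite innernC innernDl rmorphD/= -!innernC. Qed.

Lemma innernZr a x y : innern x (a *: y) = a^* * innern x y.
Proof. by rewrite innernC innernZl rmorphM/= -innernC. Qed.

Lemma innernNr x y : innern x (- y) = - innern x y.
Proof. by rewrite innernC innernNl rmorphN/= -innernC. Qed.

Lemma innernBr x y z : innern z (x - y) = innern z x - innern z y.
Proof. by rewrite innernDr innernNr. Qed.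

Lemma innern0r x : innern x 0 = 0.
Proof. by rewrite innernC innern0l rmorph0. Qed.

Definition sqnorm x : R := complex.Re (innern x x).

Lemma sqnorm_partial x (F : {fset G}) :
  (\sum_i \sum_(g <- F) sqmod (x i g))%:C%C <= innern x x.
Proof.
rewrite rmorph_sum ler_sum// => i _; rewrite rmorph_sum/=.
under eq_bigr do rewrite sqmodE normCK.
by apply: hsum_ge0 (inner_hsum _ _) _ => g; rewrite -normCK exprn_ge0.
Qed.

Lemma sqnormE x : innern x x = (sqnorm x)%:C%C.
Proof.
rewrite /sqnorm RRe_real// ger0_real//.
apply: le_trans (sqnorm_partial x fset0); rewrite ler0c sumr_ge0// => i _.
by rewrite big_seq_fset0.
Qed.

Lemma le_sqnorm x (F : {fset G}) :
  \sum_i \sum_(g <- F) sqmod (x i g) <= sqnorm x.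
Proof. by rewrite -lecR -sqnormE sqnorm_partial. Qed.

Lemma sqnorm_ge0 x : 0 <= sqnorm x.
Proof.
apply: le_trans (le_sqnorm x fset0); rewrite sumr_ge0// => i _.
by rewrite big_seq_fset0.
Qed.

Lemma sqmod_le_sqnorm x i g : sqmod (x i g) <= sqnorm x.
Proof.
apply: le_trans (le_sqnorm x [fset g]%fset).
rewrite (bigD1 i)//= big_seq_fset1 lerDl sumr_ge0// => j _.
by rewrite sumr_ge0// => ? _; apply: sqmod_ge0.
Qed.

Lemma sqmod_eq0 (z : C) : (sqmod z == 0) = (z == 0).
Proof.
by rewrite -(inj_eq (@complexI R)) sqmodE rmorph0 sqrf_eq0 normr_eq0.
Qed.

Lemma sqnorm_eq0 x : sqnorm x = 0 -> x = 0.
Proof.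
move=> x0; apply: Hn_ext => i g; apply/eqP; rewrite -sqmod_eq0 eq_le sqmod_ge0.
by rewrite -x0 sqmod_le_sqnorm.
Qed.

(** Finite partial sums compute the norm, so that a vector obtained as a
    pointwise limit can be estimated. *)
Lemma sqnorm_le x B :
  (forall F : {fset G}, \sum_i \sum_(g <- F) sqmod (x i g) <= B) -> sqnorm x <= B.
Proof.
move=> xB; apply/ler_addgt0Pr => e e0.
have en0 : 0 < e / n.+1%:R by rewrite divr_gt0.
have /choice[F FP] i := inner_hsum (x i) (x i) en0.
pose F0 := (\bigcup_(i <- enum 'I_n) F i)%fset.
have ReD : {morph @complex.Re R : a b / a + b >-> a + b} by case=> ? ? [].
have sumRe (I : Type) (r : seq I) (f : I -> C) :
  complex.Re (\sum_(k <- r) f k) = \sum_(k <- r) complex.Re (f k).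
  by rewrite (big_morph _ ReD (erefl _)).
apply: le_trans (_ : \sum_i (\sum_(g <- F0) sqmod (x i g) + e / n.+1%:R) <= _).
  rewrite /sqnorm sumRe ler_sum// => i _; rewrite addrC -lerBlDr.
  apply: le_trans (ler_norm _) _; rewrite distrC -lecR.
  have := FP i F0 (bigfcup_sup _ (mem_enum _ _) isT); apply: le_trans.
  apply: le_trans (normc_ge_Re _); rewrite lecR.
  have -> : complex.Re (\sum_(g <- F0) x i g * (x i g)^* - inner (x i) (x i)) =
    \sum_(g <- F0) sqmod (x i g) - complex.Re (inner (x i) (x i)).
    rewrite ReD sumRe; congr (_ + _).
    by apply: eq_bigr => g _; rewrite -normCK -sqmodE.
  by [].
rewrite big_split/= lerD// sumr_const card_ord -[leLHS]mulr_natr -mulrA.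
by rewrite ger_pMr// mulrC ler_pdivrMr// mul1r ler_nat.
Qed.

Lemma sqnormZ a x : sqnorm (a *: x) = sqmod a * sqnorm x.
Proof.
apply: (@complexI R); rewrite -sqnormE innernZl innernZr mulrA -normCK -sqmodE.
by rewrite sqnormE -rmorphM.
Qed.

Lemma parallelogram x y :
  sqnorm (x + y) + sqnorm (x - y) = 2 * sqnorm x + 2 * sqnorm y.
Proof.
apply: (@complexI R); rewrite !rmorphD !rmorphM/= rmorph_nat -!sqnormE.
by rewrite innernBl !innernBr innernDl !innernDr; ring.
Qed.

(** The minimum of [sqnorm (x - t *: y)] over [t] is [sqnorm x - sqmod (innern
    x y) / sqnorm y], which is at least [d]. With [d = 0] this is the
    Cauchy-Schwarz inequality; with [d] the squared distance to a subspace it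
    shows that near minimizers are nearly orthogonal to the subspace. *)
Lemma near_minimizer_orth x y d : (forall t : C, d <= sqnorm (x - t *: y)) ->
  sqmod (innern x y) <= (sqnorm x - d) * sqnorm y.
Proof.
have [y0 _|yn0] := eqVneq (sqnorm y) 0.
  by rewrite y0 mulr0 (sqnorm_eq0 y0) innern0r sqmod0.
have yp : 0 < sqnorm y by rewrite lt_def yn0 sqnorm_ge0.
set N := sqnorm y in yn0 yp *; set c := innern x y.
move=> /(_ (c / N%:C%C)) le_d; rewrite -ler_pdivrMr// lerBrDr -lerBrDl.
apply: le_trans le_d _; rewrite le_eqVlt; apply/orP; left; apply/eqP.
apply: (@complexI R); rewrite -sqnormE innernBl !innernBr !innernZl !innernZr.
rewrite (innernC x y) !sqnormE -/c -/N.
have -> : (sqnorm x - sqmod c / N)%:C%C = (sqnorm x)%:C%C - c * c^* / N%:C%C.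
  by rewrite rmorphB/= rmorphM/= fmorphV/= sqmodE normCK.
have -> : (c / N%:C%C)^* = c^* / N%:C%C.
  rewrite rmorphM/= fmorphV/=; congr (_ / _).
  exact: conjc_real.
by field; rewrite -(inj_eq (@complexI R)) in yn0.
Qed.

Lemma CauchySchwarz x y : sqmod (innern x y) <= sqnorm x * sqnorm y.
Proof.
rewrite -[X in X * _]subr0; apply: near_minimizer_orth => t.
exact: sqnorm_ge0.
Qed.

End InnerProduct.

(** * Completeness *)

Section Completeness.
Variables (R : realType).

Lemma le_of_harmonic (a b c : R) :
  (forall k : nat, a <= c + b / k.+1%:R) -> a <= c.
Proof.
move=> ab; apply/ler_addgt0Pr => e e0; have [b0|b0] := ltP 0 b; last first.
  by apply: le_trans (ab 0) _; rewrite lerD2l divr1 (le_trans b0)// ltW.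
have := ab (Num.bound (b / e)) => /le_trans; apply.
rewrite lerD2l ler_pdivrMr// mulrC -ler_pdivrMr//.
have := archi_boundP (ltW (divr_gt0 b0 e0)) => /ltW/le_trans; apply.
by rewrite ler_nat.
Qed.

(** The supremum of the lower bounds [a k - e k] is within [e k] of every [a k],
    so no convergence of sequences is needed to pass to the limit. *)
Lemma nested_limit (a e : nat -> R) :
  (forall k l, `|a k - a l| <= e k + e l) -> exists z, forall k, `|a k - z| <= e k.
Proof.
move=> ae; pose S := [set a k - e k | k in [set: nat]].
have ubS l : ubound S (a l + e l).
  move=> _ [k _ <-]; have := ae k l; rewrite ler_distl => /andP[_].
  by rewrite lerBlDr -addrA (addrC (e l)).
exists (sup S) => k; rewrite distrC ler_distl; apply/andP; split.
  by apply: ub_le_sup; [exists (a 0 + e 0); apply: ubS | exists k].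
by apply: ge_sup; [exists (a k - e k); exists k | apply: ubS].
Qed.

End Completeness.

Section Projection.
Variables (R : realType) (G : groupType) (n : nat).
Local Notation C := R[i].
Local Notation H := (ell2 R G).
Local Notation Hn := ('I_n -> H).

(** Coordinatewise limits with an explicit rate; the norm estimate for a
    finite set of coordinates passes to the limit, and [sqnorm_le] removes the
    finiteness. *)
Lemma ell2n_complete (u : nat -> Hn) :
  (forall k l, sqnorm (u k - u l) <= 2 / k.+1%:R + 2 / l.+1%:R) ->
  exists z : Hn, forall k, sqnorm (u k - z) <= 4 / k.+1%:R.
Proof.
move=> uC.
(* Chosen so that [2 / k.+1 + 2 / l.+1 <= (e k + e l) ^+ 2]. *)
pose e (k : nat) : R := Num.sqrt (2 / k.+1%:R).
have q0 (k : nat) : 0 <= 2 / k.+1%:R :> R by rewrite divr_ge0.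
have e0 k : 0 <= e k by rewrite sqrtr_ge0.
have eE k : e k ^+ 2 = 2 / k.+1%:R by rewrite sqr_sqrtr.
have lim (p : C -> R) : {morph p : a b / a - b} -> (forall c, p c ^+ 2 <= sqmod c) ->
    forall i g, exists z, forall k, `|p (u k i g) - z| <= e k.
  move=> pB pc i g; apply: nested_limit => k l; rewrite -pB.
  rewrite -[leRHS]ger0_norm ?addr_ge0// -ler_sqr ?nnegrE ?normr_ge0//.
  rewrite !real_normK ?num_real// (le_trans (pc _))//.
  apply: (le_trans (sqmod_le_sqnorm (u k - u l) i g)).
  rewrite (le_trans (uC _ _))// sqrrD !eE addrAC lerDl.
  by rewrite mulrn_wge0// mulr_ge0.
have [|c|zr zrP] := choice (fun p : 'I_n * G => lim (@complex.Re R) _ _ p.1 p.2).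
- by case=> ? ? [].
- by rewrite /sqmod lerDl sqr_ge0.
have [|c|zi ziP] := choice (fun p : 'I_n * G => lim (@complex.Im R) _ _ p.1 p.2).
- by case=> ? ? [].
- by rewrite /sqmod lerDr sqr_ge0.
pose z i g := Complex (zr (i, g)) (zi (i, g)).
have zP k i g : sqmod (u k i g - z i g) <= 4 / k.+1%:R.
  have := lerD (lerXn2r 2 _ _ (zrP (i, g) k)) (lerXn2r 2 _ _ (ziP (i, g) k)).
  rewrite !nnegrE !normr_ge0 !real_normK ?num_real// e0 !eE => /(_ isT isT isT isT).
  rewrite /z /sqmod; case: (u k i g) => a b /= /le_trans; apply.
  by rewrite -mulrDl -natrD.
have sumP k (F : {fset G}) :
    \sum_i \sum_(g <- F) sqmod (u k i g - z i g) <= 4 / k.+1%:R.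
  (* Compare [z] with [u l] and let [l] tend to infinity. *)
  apply: (@le_of_harmonic _ _ (4 + (\sum_(i < n) \sum_(g <- F) 8))) => l.
  rewrite [X in _ <= _ + X]mulrDl addrA.
  apply: (@le_trans _ _ (2 * (\sum_i \sum_(g <- F) sqmod ((u k - u l) i g))
       + \sum_(i < n) \sum_(g <- F) 8 / l.+1%:R)).
    rewrite mulr_sumr -big_split/= ler_sum// => i _.
    rewrite mulr_sumr -big_split/= ler_sum// => g _.
    rewrite [X in sqmod X](_ : _ = (u k - u l) i g + (u l i g - z i g)); last first.
      by rewrite addrA; congr (_ - _); apply/esym/subrK.
    apply: le_trans (sqmodD_le _ _) _; rewrite lerD2l.
    rewrite (_ : 8 / _ = 2 * (4 / l.+1%:R)); last by rewrite mulrA -natrM.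
    by rewrite ler_pM2l.
  rewrite lerD//.
    apply: le_trans (ler_wpM2l _ (le_trans (le_sqnorm _ _) (uC _ _))) _ => //.
    by rewrite mulrDr !mulrA -natrM.
  by rewrite mulr_suml ler_sum// => i _; rewrite mulr_suml.
have zl2 i : z i \in @l2pred R G.
  apply/ell2P; exists (2 * sqnorm (u 0) + 2 * (4 / 1)) => F.
  apply: (@le_trans _ _ (\sum_(j < n) \sum_(g <- F) sqmod (z j g))).
    rewrite (bigD1 i)//= lerDl sumr_ge0// => j _.
    by rewrite sumr_ge0// => g _; apply: sqmod_ge0.
  apply: le_trans (lerD (ler_wpM2l _ (le_sqnorm _ F)) (ler_wpM2l _ (sumP 0 F))) => //.
  rewrite !mulr_sumr -big_split/= ler_sum// => j _.
  rewrite !mulr_sumr -big_split/= ler_sum// => g _.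
  rewrite [X in sqmod X](_ : _ = u 0 j g + - (u 0 j g - z j g)); last by ring.
  by rewrite (le_trans (sqmodD_le _ _))// lerD2l /sqmod; case: (_ - _) => a b /=;
    rewrite !sqrrN.
by exists (fun i => Ell2 (zl2 i)) => k; apply: sqnorm_le => F; apply: sumP.
Qed.

(** Minimize the distance from [x] to [W]: by the parallelogram law a minimizing
    sequence of [x - w], with [w] in [W], is Cauchy. *)
Lemma orthogonal_decomposition (W : set Hn) (x : Hn) : W 0 ->
    (forall w v (t : C), W w -> W v -> W (w + t *: v)) ->
  exists z, (forall w, W w -> innern z w = 0) /\
            (forall e : R, 0 < e -> exists2 w, W w & sqnorm (x - w - z) <= e).
Proof.
move=> W0 WD; pose S := [set sqnorm (x - w) | w in W]; pose d := inf S.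
have Sinf : has_inf S.
  split; first by exists (sqnorm (x - 0)), 0.
  by exists 0 => _ [w _ <-]; apply: sqnorm_ge0.
have dP w : W w -> d <= sqnorm (x - w).
  by move=> Ww; apply: ge_inf; [case: Sinf | exists w].
have /choice[w wP] (k : nat) :
    exists w, W w /\ sqnorm (x - w) <= d + 1 / k.+1%:R.
  have [|_ [w Ww <-] /ltW le_w] := @inf_adherent _ S (1 / k.+1%:R) _ Sinf.
    by rewrite divr_gt0.
  by exists w.
pose u k := x - w k.
have [k l|z zP] := @ell2n_complete u.
  (* The mean of [w k] and [w l] is again in [W]. *)
  have := parallelogram (u k) (u l).
  have [[Wk dk] [Wl basis_vec]] := (wP k, wP l).
  have := dP _ (WD _ _ (1/2) W0 (WD _ _ 1 Wk Wl)).
  have -> : x - (0 + (1 / 2) *: (w k + 1 *: w l)) = (1 / 2 : C) *: (u k + u l).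
    apply: Hn_ext => i g; rewrite /u.
    have -> : ((1 / 2 : C) *: (x - w k + (x - w l))) i g =
      1 / 2 * (x i g - w k i g + (x i g - w l i g)) by [].
    have -> : (x - (0 + (1 / 2) *: (w k + 1 *: w l))) i g =
      x i g - (0 + 1 / 2 * (w k i g + 1 * w l i g)) by [].
    by field.
  have -> : sqnorm ((1 / 2 : C) *: (u k + u l)) = sqnorm (u k + u l) / 4.
    rewrite sqnormZ mulrC; congr (_ * _); apply: (@complexI R).
    rewrite sqmodE fmorphV/= rmorph_nat normrM normr1 mul1r normfV normr_nat.
    by field.
  rewrite -/(u k) in dk; rewrite -/(u l) in basis_vec.
  set a := _ / k.+1%:R in dk *; set b := _ / l.+1%:R in basis_vec *.
  have -> : 2 / k.+1%:R = 2 * a by rewrite mulrA mulr1.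
  have -> : 2 / l.+1%:R = 2 * b by rewrite mulrA mulr1.
  by move: dk basis_vec; lra.
exists z; split => [v Wv|e e0]; last first.
  have := zP (Num.bound (4 / e)); set K := Num.bound _ => le_K.
  exists (w K); first by case: (wP K).
  apply: le_trans le_K _; rewrite ler_pdivrMr// mulrC -ler_pdivrMr//.
  have /archi_boundP/ltW/le_trans -> // : 0 <= 4 / e by rewrite divr_ge0// ltW.
  by rewrite ler_nat.
apply/eqP; rewrite -sqmod_eq0 eq_le sqmod_ge0 andbT.
apply: (@le_of_harmonic _ _ (10 * sqnorm v)) => k; rewrite add0r.
have [Wk dk] := wP k.
have le1 : sqmod (innern (u k) v) <= 1 / k.+1%:R * sqnorm v.
  apply: le_trans (near_minimizer_orth (d := d) _) _ => [t|].
    by rewrite /u -addrA -opprD; apply: dP; apply: WD.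
  by rewrite ler_wpM2r ?sqnorm_ge0// lerBlDl.
have le2 : sqmod (innern (u k - z) v) <= 4 / k.+1%:R * sqnorm v.
  by rewrite (le_trans (CauchySchwarz _ _))// ler_wpM2r ?sqnorm_ge0.
rewrite [z](_ : _ = u k - (u k - z)); last by rewrite opprB addrC subrK.
rewrite innernBl (le_trans (sqmodD_le _ _))//.
have -> : sqmod (- innern (u k - z) v) = sqmod (innern (u k - z) v).
  by case: (innern _ _) => a b; rewrite /sqmod /= !sqrrN.
apply: le_trans (lerD (ler_wpM2l _ le1) (ler_wpM2l _ le2)) _ => //.
by rewrite le_eqVlt; apply/orP; left; apply/eqP; field; rewrite nat1r pnatr_eq0.
Qed.

End Projection.

(** * Operators, trace and kernels *)

Section Operators.
Variables (R : realType) (G : groupType) (n : nat).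
Local Notation C := R[i].
Local Notation H := (ell2 R G).
Local Notation Hn := ('I_n -> H).
Implicit Types (x y z : Hn) (a : C) (S T : Hn -> Hn).

Definition basis_vec (j : 'I_n) (h : G) : Hn := fun k => if k == j then delta h else 0.

Lemma basis_vecE j h i g : basis_vec j h i g = ((i == j) && (g == h))%:R.
Proof. by rewrite /basis_vec; case: (i == j). Qed.

Lemma inner_delta (u : H) h : inner u (delta h) = u h.
Proof.
apply: (hsum_unique (inner_hsum _ _)).
have -> : u h = \sum_(g <- [fset h]%fset) u g * (delta h g)^*.
  by rewrite big_seq_fset1 /= eqxx rmorph1 mulr1.
by apply: hsum_fin => g; rewrite inE /= => /negPf ->; rewrite rmorph0 mulr0.
Qed.

Lemma innern_basis x j h : innern x (basis_vec j h) = x j h.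
Proof.
rewrite /innern (bigD1 j)//= /basis_vec eqxx inner_delta big1 ?addr0// => i /negPf ->.
by rewrite innerC -(scale0r (0 : H)) innerZl mul0r rmorph0.
Qed.

Lemma innern_eq0 x : (forall j h, innern x (basis_vec j h) = 0) -> x = 0.
Proof. by move=> x0; apply: Hn_ext => j h; rewrite -innern_basis x0. Qed.

Lemma rtranslate_subproof (h : G) (u : H) :
  (fun g => u (g * h^-1)%g) \in @l2pred R G.
Proof.
have /l2predP ufin := valP u; apply/l2predP; move: ufin.
rewrite (@reindex_esum _ _ _ setT setT (fun g => g * h^-1)%g)//.
split => // [g g' _ _ /mulIg//|g _].
by exists (g * h)%g => //; rewrite mulgK.
Qed.

Definition rtranslate (h : G) (x : Hn) : Hn :=
  fun i => Ell2 (rtranslate_subproof h (x i)).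

Lemma basis_rtranslate j h : basis_vec j h = rtranslate h (basis_vec j 1%g).
Proof.
by apply: Hn_ext => i g; rewrite basis_vecE /= basis_vecE divg_eq1.
Qed.

Lemma innern_rtranslate h x y :
  innern (rtranslate h x) y = innern x (rtranslate h^-1 y).
Proof.
apply: eq_bigr => i _; apply: (hsum_unique (inner_hsum _ _)).
have := hsum_bij (mulgVK h) (mulgK h) (inner_hsum (x i) (rtranslate h^-1 y i)).
by apply: hsum_ext => g /=; rewrite invgK mulgVK.
Qed.

Definition adjoint T T' := forall x y, innern (T x) y = innern x (T' y).
Definition equivariant T := forall h x, T (rtranslate h x) = rtranslate h (T x).

Lemma adjointC T T' : adjoint T T' -> adjoint T' T.
Proof. by move=> TT' x y; rewrite innernC -TT' -innernC. Qed.

Lemma adjoint_linear T T' : adjoint T T' ->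
  forall a x y, T (a *: x + y) = a *: T x + T y.
Proof.
move=> TT' a x y; apply/eqP; rewrite -subr_eq0; apply/eqP/innern_eq0 => j h.
by rewrite innernBl innernDl innernZl !TT' innernDl innernZl subrr.
Qed.

Lemma adjoint0 T T' : adjoint T T' -> T 0 = 0.
Proof.
by move=> TT'; apply: innern_eq0 => j h; rewrite TT' innern0l.
Qed.

Lemma adjoint_comp S S' T T' : adjoint S S' -> adjoint T T' ->
  adjoint (S \o T) (T' \o S').
Proof. by move=> SS' TT' x y /=; rewrite SS' TT'. Qed.

Lemma equivariant_comp S T : equivariant S -> equivariant T -> equivariant (S \o T).
Proof. by move=> eS eT h x /=; rewrite eT eS. Qed.

Definition op_trace T : C := \sum_i T (basis_vec i 1%g) i 1%g.

Lemma vn_dim_trace (V : set Hn) : vn_dim V = op_trace (orthoproj V).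
Proof. by apply: eq_bigr => i _; apply: inner_delta. Qed.

Lemma adjoint_entry S S' : adjoint S S' -> equivariant S -> forall i j g,
  (S' (basis_vec i 1%g) j g)^* = S (basis_vec j 1%g) i g^-1%g.
Proof.
move=> SS' eS i j g; rewrite -innern_basis -innernC -SS' innern_basis basis_rtranslate eS /=.
by rewrite mul1g.
Qed.

(** Both sides are the sum over [g] and over the pairs of coordinates of the
    entries of [T] at [g] times those of [S] at the inverse of [g]. *)
Lemma op_traceC S S' T T' : adjoint S S' -> adjoint T T' ->
  equivariant S -> equivariant T -> op_trace (S \o T) = op_trace (T \o S).
Proof.
move=> SS' TT' eS eT; rewrite /op_trace.
have comp U U' V : adjoint U U' ->
    \sum_i (U \o V) (basis_vec i 1%g) i 1%g =
    \sum_i \sum_j inner (V (basis_vec i 1%g) j) (U' (basis_vec i 1%g) j).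
  by move=> UU'; apply: eq_bigr => i _; rewrite -innern_basis UU'.
rewrite (comp _ _ _ SS') (comp _ _ _ TT') exchange_big/=.
apply: eq_bigr => i _; apply: eq_bigr => j _; apply: (hsum_unique (inner_hsum _ _)).
have := hsum_bij (@invgK G) (@invgK G) (inner_hsum (S (basis_vec i 1%g) j) (T' (basis_vec i 1%g) j)).
apply: hsum_ext => g /=.
by rewrite (adjoint_entry TT' eT) (adjoint_entry SS' eS) invgK mulrC.
Qed.

Definition op_ker T : set Hn := [set x | T x = 0].

Section Projections.
Variables (V : set Hn) (P : Hn -> Hn).
Hypothesis PV : is_orthoproj V P.
Hypothesis VD : forall a x y, V x -> V y -> V (a *: x + y).

Lemma orthoproj_unique x z : V z -> (forall v, V v -> innern (x - z) v = 0) ->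
  P x = z.
Proof.
move=> Vz xz; have [VPx xP] := PV x.
have VN : V (P x - z) by rewrite addrC -scaleN1r; apply: VD.
apply/eqP; rewrite -subr_eq0; apply/eqP/sqnorm_eq0/(@complexI R).
rewrite -sqnormE {1}[P x - z](_ : _ = (x - z) - (x - P x)).
  by rewrite innernBl xz// xP// subrr.
by rewrite opprB [RHS]addrC addrA subrK.
Qed.

Lemma orthoproj_id x : V x -> P x = x.
Proof. by move=> Vx; apply: orthoproj_unique => // v _; rewrite subrr innern0l. Qed.

Lemma orthoproj_adj : adjoint P P.
Proof.
move=> x y; have [VPx xP] := PV x; have [VPy yP] := PV y.
have /eqP := xP _ VPy; rewrite innernBl subr_eq0 => /eqP ->.
have /eqP := yP _ VPx; rewrite innernBl subr_eq0 => /eqP yPx.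
by rewrite innernC yPx -innernC.
Qed.

Lemma orthoproj_equivariant : (forall h x, V x -> V (rtranslate h x)) ->
  equivariant P.
Proof.
move=> Vrt h x; have [VPx xP] := PV x; apply: orthoproj_unique; first exact: Vrt.
move=> v Vv; rewrite [_ - _](_ : _ = rtranslate h (x - P x)).
  by rewrite innern_rtranslate xP//; apply: Vrt.
by apply: Hn_ext.
Qed.

Lemma sqnorm_orthoproj x : innern (P x) x = (sqnorm (P x))%:C%C.
Proof. by have [VPx _] := PV x; rewrite -sqnormE -orthoproj_adj (orthoproj_id VPx). Qed.

(** Since [P \o S = S] and [S \o P = P], the trace property gives the equality:
    the trace of an idempotent only depends on its range. *)
Lemma trace_idempotent S S' : (forall h x, V x -> V (rtranslate h x)) ->
    adjoint S S' -> equivariant S -> (forall x, V (S x)) ->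
    (forall x, V x -> S x = x) -> op_trace S = op_trace P.
Proof.
move=> Vrt SS' eS SV Sid.
have -> : S = P \o S by apply/funext => x /=; rewrite (orthoproj_id (SV x)).
rewrite (op_traceC orthoproj_adj SS' (orthoproj_equivariant Vrt) eS).
by congr op_trace; apply/funext => x /=; have [VPx _] := PV x; rewrite Sid.
Qed.

End Projections.

Definition finitely_supported x :=
  exists F : {fset G}, forall i g, g \notin F -> x i g = 0.

Lemma finitely_supported_basis j h : finitely_supported (basis_vec j h).
Proof.
by exists [fset h]%fset => i g; rewrite inE basis_vecE => /negPf ->; rewrite andbF.
Qed.

Section Kernel.
Variables (T T' : Hn -> Hn).
Hypothesis TT' : adjoint T T'.

Lemma op_kerD a x y : op_ker T x -> op_ker T y -> op_ker T (a *: x + y).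
Proof.
by rewrite /op_ker/= (adjoint_linear TT') => -> ->; rewrite scaler0 addr0.
Qed.

(** The orthogonal complement of the range of [T'] on finitely supported vectors
    is the kernel of [T]. *)
Lemma op_ker_decomposition x : exists z, [/\ op_ker T z,
   forall v, op_ker T v -> innern (x - z) v = 0
   & forall e : R, 0 < e ->
      exists2 y, finitely_supported y & sqnorm (x - T' y - z) <= e].
Proof.
have T'T := adjointC TT'.
have [||z [zW zx]] := @orthogonal_decomposition _ _ _
    [set T' y | y in finitely_supported] x.
- exists 0; last exact: adjoint0 T'T.
  by exists fset0.
- move=> _ _ t [y [F yF] <-] [y' [F' yF'] <-]; exists (t *: y' + y); last first.
    by rewrite (adjoint_linear T'T) addrC.
  exists (F `|` F')%fset => i g; rewrite inE negb_or => /andP[gF gF'].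
  by rewrite -[LHS]/(t * y' i g + y i g) yF// yF'// mulr0 addr0.
have zapprox e : 0 < e ->
    exists2 y, finitely_supported y & sqnorm (x - T' y - z) <= e.
  by move=> /zx[_ [y fy <-] le_e]; exists y.
exists z; split => // [|v kv].
  apply: innern_eq0 => j h; rewrite TT' zW//.
  by exists (basis_vec j h) => //; apply: finitely_supported_basis.
apply/eqP; rewrite -sqmod_eq0 eq_le sqmod_ge0 andbT; apply/ler_addgt0Pr => e e0.
have v1 : 0 < sqnorm v + 1 by rewrite ltr_wpDl// sqnorm_ge0.
have [y _ le_e] := zapprox _ (divr_gt0 e0 v1); rewrite add0r.
have -> : innern (x - z) v = innern (x - T' y - z) v.
  by rewrite !innernBl T'T kv innern0r subr0.
apply: le_trans (CauchySchwarz _ _) _.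
apply: le_trans (ler_wpM2r (sqnorm_ge0 _) le_e) _.
by rewrite mulrAC -mulrA ger_pMr// ler_pdivrMr// mul1r lerDl.
Qed.

Lemma orthoproj_ker : is_orthoproj (op_ker T) (orthoproj (op_ker T)).
Proof.
apply: (xgetPex (fun=> 0 : Hn)).
have /choice[P PP] := op_ker_decomposition.
by exists P => x; case: (PP x).
Qed.

Local Notation P := (orthoproj (op_ker T)).

(** [P x] is orthogonal to the range of [T'], hence has inner product [sqnorm
    (P x)] with [x - T' y]. *)
Lemma sqnorm_orthoproj_ker_le x y : sqnorm (P x) <= sqnorm (x - T' y).
Proof.
have PV := orthoproj_ker.
have [VPx _] := PV x.
have : innern (P x) (x - T' y) = (sqnorm (P x))%:C%C.
  by rewrite innernBr (sqnorm_orthoproj PV op_kerD) -TT' VPx innern0l subr0.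
have := CauchySchwarz (P x) (x - T' y) => + E; rewrite {}E.
have := sqnorm_ge0 (P x); rewrite le_eqVlt => /predU1P[<- _|p0].
  exact: sqnorm_ge0.
by rewrite /sqmod /= expr0n addr0 expr2 ler_pM2l.
Qed.

Lemma sqnorm_orthoproj_ker_approx x (e : R) : 0 < e ->
  exists2 y, finitely_supported y & sqnorm (x - T' y) <= sqnorm (P x) + e.
Proof.
move=> e0; have [z [kz zx zapprox]] := op_ker_decomposition x.
have -> : P x = z by apply: (orthoproj_unique orthoproj_ker op_kerD).
have [y fy le_e] := zapprox _ e0; exists y => //.
have -> : sqnorm (x - T' y) = sqnorm z + sqnorm (x - T' y - z).
  apply: (@complexI R); rewrite rmorphD/= -!sqnormE.
  set w := x - T' y - z.
  have wz : innern w z = 0.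
    rewrite /w addrAC innernBl zx// (adjointC TT') kz innern0r subr0//.
  have -> : x - T' y = z + w by rewrite /w [RHS]addrC subrK.
  move: w wz => w wz.
  by rewrite innernDl !innernDr (innernC w z) wz rmorph0 addr0 add0r.
by rewrite lerD2l.
Qed.

(** The squared norms of the projections of the coordinate vectors at the
    unit: by the two preceding lemmas it is the infimum of the sums of the
    [sqnorm (basis - T' y)] over finitely supported vectors [y], a description
    that only involves finite data when [T'] is a convolution operator. *)
Definition ker_dim : R := \sum_j sqnorm (P (basis_vec j 1%g)).

Lemma op_trace_ker : op_trace P = ker_dim%:C%C.
Proof.
rewrite rmorph_sum; apply: eq_bigr => j _; rewrite -innern_basis.
exact: (sqnorm_orthoproj orthoproj_ker op_kerD).
Qed.

Lemma vn_dim_ker : vn_dim (op_ker T) = ker_dim%:C%C.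
Proof. by rewrite vn_dim_trace op_trace_ker. Qed.

Lemma ker_dim_ge0 : 0 <= ker_dim.
Proof. by rewrite sumr_ge0// => j _; apply: sqnorm_ge0. Qed.

Hypothesis eT : equivariant T.

Lemma op_ker_rtranslate h x : op_ker T x -> op_ker T (rtranslate h x).
Proof. by rewrite /op_ker /= eT => ->; apply: Hn_ext. Qed.

(** A vector orthogonal to all right translates of the projections of the
    coordinate vectors is orthogonal to the kernel. *)
Lemma ker_dim_gt0 : (exists2 x, op_ker T x & x != 0) <-> 0 < ker_dim.
Proof.
have PV := orthoproj_ker.
split=> [[x kx x0]|d0].
  rewrite lt_def ker_dim_ge0 andbT; apply: contra x0 => /eqP d0.
  have {}d0 j : P (basis_vec j 1%g) = 0.
    apply/sqnorm_eq0/eqP; move/eqP: d0; rewrite psumr_eq0.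
      by move=> /allP/(_ j (mem_index_enum _)).
    by move=> i _; apply: sqnorm_ge0.
  apply/eqP/innern_eq0 => j h; rewrite -(orthoproj_id PV op_kerD kx).
  rewrite (orthoproj_adj PV) basis_rtranslate.
  rewrite (orthoproj_equivariant PV op_kerD op_ker_rtranslate) d0.
  by rewrite (_ : rtranslate h 0 = 0) ?innern0r//; apply: Hn_ext.
apply: contrapT => nex; suff d00 : ker_dim = 0 by rewrite d00 ltxx in d0.
apply: big1 => j _; have [kP _] := PV (basis_vec j 1%g).
have [->|nz] := eqVneq (P (basis_vec j 1%g)) 0; first by rewrite /sqnorm innern0l.
by case: nex; exists (P (basis_vec j 1%g)).
Qed.

End Kernel.

End Operators.

Arguments basis_vec {R G n} j h.

(** * Polynomials in an operator *)

Section PolynomialOperators.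
Variables (R : realType) (G : groupType) (n : nat).
Local Notation C := R[i].
Local Notation H := (ell2 R G).
Local Notation Hn := ('I_n -> H).
Implicit Types (x y : Hn) (a : C) (f g : {poly C}) (A : Hn -> Hn).

Definition poly_op A f x : Hn := \sum_(i < size f) f`_i *: iter i A x.

Lemma poly_op_wide A N f x : (size f <= N)%N ->
  poly_op A f x = \sum_(i < N) f`_i *: iter i A x.
Proof.
move=> fN; rewrite /poly_op (big_ord_widen N (fun i => f`_i *: iter i A x) fN).
rewrite big_mkcond; apply: eq_bigr => i _.
by case: ltnP => // /(nth_default 0) ->; rewrite scale0r.
Qed.

Lemma poly_opD A f g x : poly_op A (f + g) x = poly_op A f x + poly_op A g x.
Proof.
have := size_polyD f g; set N := maxn _ _ => fgN.
rewrite (poly_op_wide _ _ fgN) (@poly_op_wide _ N f) ?leq_maxl//.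
rewrite (@poly_op_wide _ N g) ?leq_maxr// -big_split.
by apply: eq_bigr => i _; rewrite coefD scalerDl.
Qed.

Lemma poly_opZ A a f x : poly_op A (a *: f) x = a *: poly_op A f x.
Proof.
rewrite (poly_op_wide _ _ (size_scale_leq _ _)) scaler_sumr.
by apply: eq_bigr => i _; rewrite coefZ scalerA.
Qed.

Lemma poly_opC A a x : poly_op A a%:P x = a *: x.
Proof. by rewrite (poly_op_wide _ _ (size_polyC_leq1 _)) big_ord1 coefC. Qed.

Lemma poly_op1 A x : poly_op A 1 x = x.
Proof. by rewrite poly_opC scale1r. Qed.

Lemma poly_opMX A f x : poly_op A (f * 'X) x = poly_op A f (A x).
Proof.
rewrite (@poly_op_wide _ (size f).+1); last first.
  by rewrite (leq_trans (size_polyMleq _ _))// size_polyX addn2.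
rewrite big_ord_recl coefMX/= scale0r add0r.
by apply: eq_bigr => i _; rewrite coefMX/= -iterS iterSr.
Qed.

Lemma poly_opX A x : poly_op A 'X x = A x.
Proof. by rewrite -['X]mul1r poly_opMX poly_op1. Qed.

Lemma poly_opB A f g x : poly_op A (f - g) x = poly_op A f x - poly_op A g x.
Proof. by rewrite poly_opD -scaleN1r poly_opZ scaleN1r. Qed.

Section Adjointable.
Variables (A A' : Hn -> Hn).
Hypothesis AA' : adjoint A A'.

Lemma iter_adjoint i : adjoint (iter i A) (iter i A').
Proof. by elim: i => // i IH x y; rewrite iterS AA' IH -iterSr. Qed.

Lemma poly_op_adjoint f : adjoint (poly_op A f) (poly_op A' (map_poly Num.conj f)).
Proof.
move=> x y; rewrite /poly_op size_map_poly.
have sumL (r : seq 'I_(size f)) (F : 'I_(size f) -> Hn) z :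
    innern (\sum_(i <- r) F i) z = \sum_(i <- r) innern (F i) z.
  elim: r => [|i r IH]; first by rewrite !big_nil innern0l.
  by rewrite !big_cons innernDl IH.
rewrite sumL [RHS]innernC sumL rmorph_sum; apply: eq_bigr => i _.
rewrite innernZl coef_map innernZl rmorphM/= conjCK -innernC.
by rewrite iter_adjoint.
Qed.

Lemma poly_op_commute f x : A (poly_op A f x) = poly_op A f (A x).
Proof.
apply/eqP; rewrite -subr_eq0; apply/eqP/innern_eq0 => j h.
by rewrite -poly_opMX mulrC innernBl AA' !poly_op_adjoint rmorphM/= map_polyX
  mulrC poly_opMX subrr.
Qed.

Lemma poly_opM f g x : poly_op A (f * g) x = poly_op A f (poly_op A g x).
Proof.
elim/poly_ind: f g x => [|f c IH] g x.
  by rewrite mul0r -[0](scale0r (0 : {poly C})) !poly_opZ !scale0r.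
rewrite mulrDl !poly_opD mul_polyC poly_opZ poly_opC; congr (_ + _).
by rewrite mulrAC !poly_opMX IH poly_op_commute.
Qed.

Lemma poly_op_equivariant f : equivariant A -> equivariant (poly_op A f).
Proof.
move=> eA h x; elim/poly_ind: f x => [|f c IH] x.
  rewrite -[0](scale0r (0 : {poly C})) !poly_opZ !scale0r.
  exact: Hn_ext.
rewrite !poly_opD !poly_opMX eA IH !poly_opC.
exact: Hn_ext.
Qed.

Definition poly_dim f : R := ker_dim (poly_op A f).

(** With [u * f + v * g = 1], the operator [v * g] restricted to the kernel of
    [f * g] is an idempotent with range the kernel of [f]; precomposed with the
    orthogonal projection [P], its trace is the dimension of its range, and the
    two complementary idempotents add up to [P]. *)
Lemma poly_dimM f g : equivariant A -> coprimep f g ->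
  poly_dim (f * g) = poly_dim f + poly_dim g.
Proof.
move=> eA /Bezout_eq1_coprimepP[[u v] /= uv].
have adj q := poly_op_adjoint q; have eqv q := poly_op_equivariant q eA.
have PV q := orthoproj_ker (adj q); have VD q := op_kerD (adj q).
have Vrt q := op_ker_rtranslate (eqv q).
pose P := orthoproj (op_ker (poly_op A (f * g))).
have kill (p q : {poly C}) x : poly_op A p (poly_op A q x) = poly_op A (p * q) x.
  by rewrite poly_opM.
have op0 (q : {poly C}) : poly_op A q 0 = 0 := adjoint0 (adj q).
have half (p q w : {poly C}) : p * q = f * g -> (exists w', w' * p + w * q = 1) ->
    op_trace (poly_op A (w * q) \o P) = (poly_dim p)%:C%C.
  move=> pq [w' w1]; rewrite -(op_trace_ker (adj p)).
  apply: (trace_idempotent (PV p) (VD p) (Vrt p)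
      (adjoint_comp (adj _) (orthoproj_adj (PV (f * g))))).
  - apply: equivariant_comp => //.
    exact: (orthoproj_equivariant (PV _) (VD _) (Vrt _)).
  - move=> x; rewrite /op_ker /= kill mulrCA pq -kill.
    by have [-> _] := PV (f * g) x; rewrite op0.
  - move=> x; rewrite /op_ker /= => px.
    rewrite /P (orthoproj_id (PV _) (VD _)); last first.
      by rewrite /op_ker/= -pq mulrC -kill px op0.
    by rewrite -[w * q](addKr (w' * p)) w1 addrC poly_opB poly_op1 poly_opM px op0 subr0.
apply: (@complexI R); rewrite rmorphD/= -(op_trace_ker (adj (f * g))).
rewrite -(half f g v)//; last by exists u.
rewrite -(half g f u); [|by rewrite mulrC|by exists v; rewrite addrC].
rewrite -big_split; apply: eq_bigr => i _ /=; rewrite -/P.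
rewrite -[LHS]/(P (basis_vec i 1%g) i 1%g) -{1}[P _](poly_op1 A) -uv poly_opD addrC.
by [].
Qed.

End Adjointable.

End PolynomialOperators.

(** * Almost actions on finite sets *)

Section AlmostEverywhere.
Variables (R : realType) (G : groupType).
Implicit Types (eps eta : R) (F : {fset G}).

Definition almost_action eps F m (psi : G -> 'S_m) :=
  [/\ (0 < m)%N,
      forall g h, g \in F -> h \in F ->
        #|[pred w | psi (g * h)%g w != psi g (psi h w)]|%:R <= eps * m%:R,
      psi 1%g = 1%g
    & forall g, g \in F -> g != 1%g ->
        #|[pred w | psi g w == w]|%:R <= eps * m%:R].

(** The action on the left that [phi] nearly defines is that of the inverses
    [(phi g)^-1], as the product of permutations composes from left to right.
    *)
Lemma sofic_almost_action : sofic R G -> forall eps F, 0 < eps < 1 ->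
  exists m (psi : G -> 'S_m), almost_action eps F psi.
Proof.
move=> soficG eps F /(soficG _ F)[m [phi [m0 phiM phi1 phiF]]].
exists m, (fun g => (phi g)^-1)%g; split => // [g h gF hF||g gF g1].
- have := phiM _ _ gF hF; rewrite mulrBl mul1r lerBlDl addrC -lerBlDl; apply: le_trans.
  rewrite -natrB; last by rewrite -[leqRHS]card_ord max_card.
  rewrite ler_nat leq_subRL; last by rewrite -[leqRHS]card_ord max_card.
  set t := (phi g * phi h)%g.
  have -> : fixpoints (t * (phi (g * h))^-1)%g =
      #|[pred w | (phi (g * h))^-1 w == t^-1 w]%g|.
    rewrite /fixpoints -[RHS](fintype.card_image (@perm_inj _ t^-1)%g).
    apply: eq_card => x; rewrite inE permM.
    apply/idP/fintype.imageP => [/eqP xt|[w]]; last first.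
      by rewrite inE => /eqP wt ->; rewrite permKV wt.
    by exists (t x); rewrite ?permK// inE permK xt.
  rewrite -[leqRHS]card_ord -[leqRHS](cardID [pred w | (phi (g * h))^-1 w == t^-1 w]%g).
  apply: leq_add; apply: subset_leq_card; apply/fintype.subsetP => w;
    by rewrite !inE ?andbT// invMg permM.
- by rewrite phi1 invg1.
- apply: le_trans (phiF _ gF g1); rewrite ler_nat subset_leq_card//.
  by apply/fintype.subsetP => w; rewrite !inE => /eqP ew; rewrite -{1}ew permKV.
Qed.

(** The filter of all sufficiently good almost actions; it replaces a sequence
    of almost actions, which need not exist when the group is uncountable. *)
Definition eventually (Q : forall m, (G -> 'S_m) -> Prop) :=
  exists eps F, 0 < eps < 1 /\ forall m psi, almost_action eps F psi -> Q m psi.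

Lemma eventually_mono (P Q : forall m, (G -> 'S_m) -> Prop) :
  (forall m psi, (0 < m)%N -> P m psi -> Q m psi) -> eventually P -> eventually Q.
Proof.
move=> PQ [eps [F [e01 FP]]]; exists eps, F; split => // m psi a.
by apply: PQ (FP _ _ a); case: a.
Qed.

Lemma eventually_and (P Q : forall m, (G -> 'S_m) -> Prop) :
  eventually P -> eventually Q -> eventually (fun m psi => P m psi /\ Q m psi).
Proof.
move=> [e1 [F1 [/andP[e10 e11] P1]]] [e2 [F2 [/andP[e20 e21] P2]]].
exists (Num.min e1 e2), (F1 `|` F2)%fset; split.
  by rewrite lt_min e10 e20 gt_min e11.
have le_e e e' m : e <= e' -> e * m%:R <= e' * m%:R :> R.
  by move=> ?; rewrite ler_wpM2r.
move=> m psi [m0 M1 psi1 F0]; split; [apply: P1 | apply: P2].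
  split => // [g h gF hF|g gF g1].
    apply: le_trans (M1 _ _ _ _) _; rewrite ?inE ?gF ?hF//.
    by rewrite le_e// ge_min lexx.
  by apply: le_trans (F0 _ _ g1) _; rewrite ?inE ?gF// le_e// ge_min lexx.
split => // [g h gF hF|g gF g1].
  apply: le_trans (M1 _ _ _ _) _; rewrite ?inE ?gF ?hF ?orbT//.
  by rewrite le_e// ge_min lexx orbT.
by apply: le_trans (F0 _ _ g1) _; rewrite ?inE ?gF ?orbT// le_e// ge_min lexx orbT.
Qed.

Lemma eventually_true (Q : forall m, (G -> 'S_m) -> Prop) :
  (forall m psi, Q m psi) -> eventually Q.
Proof.
move=> QT; exists (1/2), fset0; split => //.
by rewrite divr_gt0//= ltr_pdivrMr// mul1r ltr1n.
Qed.

Lemma sofic_eventually Q : sofic R G -> eventually Q ->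
  exists m (psi : G -> 'S_m), (0 < m)%N /\ Q m psi.
Proof.
move=> soficG [eps [F [e01 FQ]]].
have [m [psi a]] := sofic_almost_action soficG F e01.
by exists m, psi; split; [case: a | exact: FQ].
Qed.

Definition bad m (P : 'I_m -> Prop) := [pred w | ~~ `[< P w >]].

(** Holds outside a set of points of arbitrarily small density. *)
Definition ae (P : forall m, (G -> 'S_m) -> 'I_m -> Prop) :=
  forall eta, 0 < eta ->
    eventually (fun m psi => #|bad (P m psi)|%:R <= eta * m%:R).

Implicit Types P Q : forall m, (G -> 'S_m) -> 'I_m -> Prop.

Lemma ae_mono P Q :
  (forall m psi w, P m psi w -> Q m psi w) -> ae P -> ae Q.
Proof.
move=> PQ aeP eta /aeP; apply: eventually_mono => m psi _; apply: le_trans.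
rewrite ler_nat subset_leq_card//; apply/fintype.subsetP => w; rewrite !inE.
by apply: contra => /asboolP/PQ/asboolP.
Qed.

Lemma ae_and P Q : ae P -> ae Q -> ae (fun m psi w => P m psi w /\ Q m psi w).
Proof.
move=> aeP aeQ eta eta0; have e2 : 0 < eta / 2 by rewrite divr_gt0.
apply: eventually_mono (eventually_and (aeP _ e2) (aeQ _ e2)) => m psi _ [le1 le2].
rewrite [eta]splitr mulrDl; apply: le_trans (lerD le1 le2).
rewrite -natrD ler_nat -cardUI (leq_trans _ (leq_addr _ _))//.
rewrite subset_leq_card//; apply/fintype.subsetP => w; rewrite !inE.
by rewrite -negb_and -asbool_and.
Qed.

Lemma ae_true P : (forall m psi w, P m psi w) -> ae P.
Proof.
move=> PT eta eta0; apply: eventually_true => m psi.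
rewrite eq_card0 ?mulr_ge0 ?(ltW eta0)// => w; rewrite !inE.
by apply/negbTE; rewrite negbK; apply/asboolP.
Qed.

Lemma ae_all (I : eqType) (r : seq I) (P : I -> forall m, (G -> 'S_m) -> 'I_m -> Prop) :
  (forall i, i \in r -> ae (P i)) ->
  ae (fun m psi w => forall i, i \in r -> P i m psi w).
Proof.
elim: r => [|i r IH] aeP; first exact: ae_true.
have aei := aeP i (mem_head _ _).
have {}IH := IH (fun j jr => aeP j (mem_behead (s := i :: r) jr)).
apply: ae_mono (ae_and aei IH) => m psi w [Pi Pr] j.
by rewrite inE => /predU1P[->|/Pr].
Qed.

Lemma ae_shift P h : ae P -> ae (fun m psi w => P m psi (psi h w)).
Proof.
move=> aeP eta /aeP; apply: eventually_mono => m psi _; apply: le_trans.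
rewrite ler_nat -(fintype.card_image (@perm_inj _ (psi h))) subset_leq_card//.
by apply/fintype.subsetP => _ /fintype.imageP[w wP ->].
Qed.

Lemma small_eps eta : 0 < eta -> exists eps, 0 < eps < 1 /\ eps <= eta.
Proof.
move=> eta0; exists (Num.min eta (1/2)).
have [h0 h1] : 0 < 1/2 :> R /\ 1/2 < 1 :> R by split; lra.
by rewrite lt_min gt_min ge_min eta0 h0 h1 lexx orbT.
Qed.

Lemma ae_mul g h : ae (fun m psi w => psi (g * h)%g w = psi g (psi h w)).
Proof.
move=> eta /small_eps[eps [e01 le_e]]; exists eps, [fset g; h]%fset; split => //.
move=> m psi [_ M _ _]; apply: (@le_trans _ _ (eps * m%:R)); last first.
  by rewrite ler_wpM2r.
apply: le_trans (M g h _ _); rewrite ?inE ?eqxx ?orbT//.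
rewrite ler_nat subset_leq_card//; apply/fintype.subsetP => w; rewrite !inE.
by apply: contra => /eqP ?; apply/asboolP.
Qed.

Lemma ae_one : ae (fun m psi w => psi 1%g w = w).
Proof.
move=> eta eta0; exists (1/2), fset0; split.
  by rewrite divr_gt0//= ltr_pdivrMr// mul1r ltr1n.
move=> m psi [_ _ psi1 _]; rewrite eq_card0 ?mulr_ge0 ?(ltW eta0)// => w; rewrite !inE.
by apply/negbTE; rewrite negbK; apply/asboolP; rewrite psi1 perm1.
Qed.

Lemma ae_free g : g != 1%g -> ae (fun m psi w => psi g w != w).
Proof.
move=> g1 eta /small_eps[eps [e01 le_e]]; exists eps, [fset g]%fset; split => //.
move=> m psi [_ _ _ M]; apply: (@le_trans _ _ (eps * m%:R)); last first.
  by rewrite ler_wpM2r.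
apply: le_trans (M g _ g1); rewrite ?inE ?eqxx//.
rewrite ler_nat subset_leq_card//; apply/fintype.subsetP => w; rewrite !inE.
by case: eqP => // /eqP ne /negP[]; apply/asboolP.
Qed.

(** If [psi g w = psi h w], then [h^-1 * g] fixes [w], provided that [psi] is
    multiplicative at [w]. *)
Lemma ae_inj F : ae (fun m psi w => {in F &, injective (fun g => psi g w)}).
Proof.
have aegh g h : ae (fun m psi w => g != h -> psi g w != psi h w).
  have [->|gh] := eqVneq g h; first exact: ae_true.
  have gh1 : (h^-1 * g)%g != 1%g 
    by apply: contraNN gh => /eqP e; rewrite -(mulKVg h g) e mulg1.
  apply: ae_mono (ae_and (ae_free gh1) (ae_mul h (h^-1 * g)%g)) => m psi w.
  by rewrite mulKVg => -[ne ->] _; rewrite (inj_eq perm_inj).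
have aeF : ae (fun m psi w => forall g, g \in enum_fset F ->
    forall h, h \in enum_fset F -> g != h -> psi g w != psi h w).
  by apply: ae_all => g _; apply: ae_all => h _; apply: aegh.
apply: ae_mono aeF => m psi w wF g h gF hF /eqP; have [//|ne] := eqVneq g h.
by rewrite (negbTE (wF _ gF _ hF ne)).
Qed.

End AlmostEverywhere.

(** * Matrices modelling an operator *)

Section ModelMatrices.
Variables (R : realType) (G : groupType) (n : nat).
Local Notation C := R[i].
Local Notation H := (ell2 R G).
Local Notation Hn := ('I_n -> H).
Implicit Types (F : {fset G}) (S T : Hn -> Hn).

(** Index set of the matrices acting on [n] copies of the [m] points. *)
Definition model_size m := #|{: 'I_n * 'I_m}|.
Definition model_index m (i : 'I_n) (v : 'I_m) : 'I_(model_size m) := enum_rank (i, v).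

Lemma sum_model_index (V : nmodType) m (f : 'I_(model_size m) -> V) :
  \sum_p f p = \sum_i \sum_v f (model_index i v).
Proof.
rewrite (reindex _ (onW_bij _ (enum_rank_bij {: 'I_n * 'I_m}))).
by rewrite pair_bigA; apply: eq_bigr => -[].
Qed.

Lemma model_indexP m (p : 'I_(model_size m)) : exists i v, p = model_index i v.
Proof.
by exists (enum_val p).1, (enum_val p).2; rewrite /model_index -surjective_pairing enum_valK.
Qed.

Definition mfamily := forall m, (G -> 'S_m) -> 'M[C]_(model_size m).

(** A bound on the column sums is submultiplicative, and bounds the norm of
    each column on the exceptional points that [ae] leaves out. *)
Definition col_bounded K N (M : 'M[C]_N) := forall q, \sum_p `|M p q| <= K.

Lemma col_bounded_mul K L N (M M' : 'M[C]_N) : 0 <= K ->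
  col_bounded K M -> col_bounded L M' -> col_bounded (K * L) (M *m M').
Proof.
move=> K0 MK ML q; apply: (@le_trans _ _ (\sum_p \sum_r `|M p r| * `|M' r q|)).
  apply: ler_sum => p _; rewrite mxE (le_trans (ler_norm_sum _ _ _))//.
  by apply: ler_sum => r _; rewrite normrM.
rewrite exchange_big/=; apply: le_trans (_ : \sum_r K * `|M' r q| <= _).
  by apply: ler_sum => r _; rewrite -mulr_suml ler_wpM2r.
by rewrite -mulr_sumr ler_wpM2l.
Qed.

Lemma col_bounded_lin a K L N (M M' : 'M[C]_N) :
  col_bounded K M -> col_bounded L M' -> col_bounded (`|a| * K + L) (a *: M + M').
Proof.
move=> MK ML q; apply: (@le_trans _ _ (\sum_p (`|a| * `|M p q| + `|M' p q|))).
  by apply: ler_sum => p _; rewrite !mxE (le_trans (ler_normD _ _))// normrM.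
by rewrite big_split/= -mulr_sumr lerD// ler_wpM2l.
Qed.

Lemma col_bounded1 N : col_bounded 1 (1%:M : 'M[C]_N).
Proof.
move=> q; rewrite (bigD1 q)//= mxE eqxx normr1 big1 ?addr0// => p /negPf pq.
by rewrite mxE pq normr0.
Qed.

(** Almost every point [w] has an orbit map [g |-> psi g w] along which column
    [(j, w)] of the matrix is the transported value of the operator at the
    [j]-th coordinate vector. *)
Definition models F T (M : mfamily) m (psi : G -> 'S_m) (w : 'I_m) :=
  forall i v j, M m psi (model_index i v) (model_index j w) =
    \sum_(g <- F) T (basis_vec j 1%g) i g * (psi g w == v)%:R.

Definition approximates T (M : mfamily) :=
  [/\ exists T', adjoint T T', equivariant T,
      exists2 F, (forall i j g, g \notin F -> T (basis_vec j 1%g) i g = 0) & ae R (models F T M)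
    & exists2 K, 0 <= K & forall m psi, col_bounded K (M m psi)].

Lemma sum_fset_extend F F' (u f : G -> C) : (F `<=` F')%fset ->
  (forall g, g \notin F -> u g = 0) ->
  \sum_(g <- F) u g * f g = \sum_(g <- F') u g * f g.
Proof. by move=> sF u0; apply: big_fset_incl => // g _ /u0 ->; rewrite mul0r. Qed.

Lemma approximates_lin a S T M M' : approximates S M -> approximates T M' ->
  approximates (fun x => a *: S x + T x) (fun m psi => a *: M m psi + M' m psi).
Proof.
move=> [[S' SS'] eS [F F0 aeS] [K K0 SK]] [[T' TT'] eT [F' F'0 aeT] [L L0 TL]].
split.
- exists (fun x => a^* *: S' x + T' x) => x y.
  by rewrite innernDl innernZl SS' TT' innernDr innernZr conjCK.
- by move=> h x; rewrite eS eT; apply: Hn_ext.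
- exists (F `|` F')%fset => [i j g|].
    rewrite inE negb_or => /andP[gF gF'].
    by rewrite -[LHS]/(a * S _ i g + T _ i g) F0// F'0// mulr0 addr0.
  apply: ae_mono (ae_and aeS aeT) => m psi w [Sw Tw] i v j.
  rewrite !mxE Sw Tw (sum_fset_extend _ (fsubsetUl F F') (F0 i j)).
  rewrite (sum_fset_extend _ (fsubsetUr F F') (F'0 i j)) mulr_sumr -big_split.
  by apply: eq_bigr => g _ /=; rewrite mulrA -mulrDl.
- exists (`|a| * K + L); first by rewrite addr_ge0// mulr_ge0.
  by move=> m psi; apply: col_bounded_lin.
Qed.

Lemma approximates_id : approximates id (fun m psi => 1%:M).
Proof.
split; [by exists id | by [] | | by exists 1 => // m psi; apply: col_bounded1].
exists [fset 1%g]%fset => [i j g|]; first by rewrite inE basis_vecE => /negPf ->; rewrite andbF.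
apply: ae_mono (@ae_one R G) => m psi w w1 i v j.
rewrite big_seq_fset1 basis_vecE w1 eqxx andbT mxE -natrM mulnb /model_index (inj_eq enum_rank_inj).
by rewrite xpair_eqE (eq_sym w).
Qed.

Lemma Hn_sumE (I : Type) (r : seq I) (f : I -> Hn) i g :
  (\sum_(k <- r) f k) i g = \sum_(k <- r) f k i g.
Proof.
by elim: r => [|k r IH]; rewrite ?big_nil// !big_cons -IH.
Qed.

Lemma adjoint_sum T T' : adjoint T T' -> forall (I : Type) (r : seq I) (a : I -> C)
  (f : I -> Hn), T (\sum_(k <- r) a k *: f k) = \sum_(k <- r) a k *: T (f k).
Proof.
move=> TT' I r a f; elim: r => [|k r IH]; first by rewrite !big_nil (adjoint0 TT').
by rewrite !big_cons (adjoint_linear TT') IH.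
Qed.

Lemma finite_decomposition F (x : Hn) : (forall i g, g \notin F -> x i g = 0) ->
  x = \sum_l \sum_(h <- F) x l h *: rtranslate h (basis_vec l 1%g).
Proof.
move=> xF; apply: Hn_ext => i g; rewrite Hn_sumE.
have term l h : (x l h *: rtranslate h (basis_vec l 1%g)) i g =
    x l h * ((i == l) && (g == h))%:R by rewrite -basis_rtranslate -basis_vecE.
under eq_bigr do (rewrite Hn_sumE; under eq_bigr do rewrite term).
rewrite (bigD1 i)//= [X in _ + X]big1 ?addr0; last first.
  by move=> l /negPf li; rewrite big1// => h _; rewrite eq_sym li mulr0.
have [gF|gF] := boolP (g \in F); last first.
  rewrite xF// big1_fset// => h hF _; rewrite eqxx.
  by case: eqP => [gh|]; rewrite ?mulr0//; rewrite gh hF in gF.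
rewrite (big_fsetD1 g)//= !eqxx mulr1 big1_fset ?addr0// => h.
by rewrite !inE eq_sym => /andP[/negPf -> _] _; rewrite mulr0.
Qed.

(** At almost every [w] the almost action is multiplicative on the supports,
    and the points [psi h w] reached from [w] are themselves good for [S]. *)
Lemma approximates_comp S T M M' : approximates S M -> approximates T M' ->
  approximates (S \o T) (fun m psi => M m psi *m M' m psi).
Proof.
move=> [[S' SS'] eS [F F0 aeS] [K K0 SK]] [[T' TT'] eT [F' F'0 aeT] [L L0 TL]].
pose F2 := [fset (g * h)%g | g in F, h in F']%fset.
have ST i j k : S (T (basis_vec j 1%g)) i k =
    \sum_l \sum_(h <- F') T (basis_vec j 1%g) l h * S (basis_vec l 1%g) i (k * h^-1)%g.
  have S_sum (r : seq 'I_n) (f : 'I_n -> Hn) : S (\sum_(l <- r) f l) = \sum_(l <- r) S (f l).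
    have := adjoint_sum SS' r (fun=> 1) f.
    by under eq_bigr do rewrite scale1r; under [RHS]eq_bigr do rewrite scale1r.
  rewrite {1}(finite_decomposition (F'0^~ j)) S_sum Hn_sumE; apply: eq_bigr => l _.
  by rewrite (adjoint_sum SS') Hn_sumE; apply: eq_bigr => h _; rewrite eS.
split.
- by exists (T' \o S'); apply: adjoint_comp.
- exact: equivariant_comp.
- exists F2 => [i j k kF2|].
    rewrite ST big1// => l _; rewrite big1_fset// => h hF' _.
    rewrite F0 ?mulr0//; apply: contra kF2 => kF.
    by apply/imfset2P; exists (k * h^-1)%g => //; exists h => //; rewrite mulgVK.
  have aeMul : ae R (fun m psi w => forall g, g \in enum_fset F ->
      forall h, h \in enum_fset F' -> psi (g * h)%g w = psi g (psi h w)).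
    by apply: ae_all => g _; apply: ae_all => h _; apply: ae_mul.
  have aeS' : ae R (fun m psi w => forall h, h \in enum_fset F' ->
      models F S M psi (psi h w)).
    by apply: ae_all => h _; apply: ae_shift aeS.
  apply: ae_mono (ae_and aeMul (ae_and aeS' aeT)) => m psi w [Mw [Sw Tw]] i v j.
  rewrite mxE sum_model_index.
  transitivity (\sum_l \sum_(h <- F') T (basis_vec j 1%g) l h *
      (\sum_(g <- F) S (basis_vec l 1%g) i g * (psi (g * h)%g w == v)%:R)).
    apply: eq_bigr => l _; under eq_bigr => u _ do rewrite Tw mulr_sumr.
    rewrite exchange_big/= !big_seq; apply: eq_bigr => h hF'.
    rewrite (bigD1 (psi h w))//= eqxx mulr1 [X in _ + X]big1 ?addr0; last first.
      by move=> u /negPf; rewrite eq_sym => ->; rewrite !mulr0.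
    rewrite mulrC (Sw _ hF') big_seq; congr (_ * _).
    by rewrite [RHS]big_seq; apply: eq_bigr => g gF; rewrite Mw.
  under [RHS]eq_bigr do rewrite ST mulr_suml.
  rewrite [RHS]exchange_big/=; apply: eq_bigr => l _.
  under [RHS]eq_bigr do rewrite mulr_suml.
  rewrite [RHS]exchange_big/= !big_seq; apply: eq_bigr => h hF'.
  under [RHS]eq_bigr do rewrite -mulrA.
  rewrite -mulr_sumr; congr (_ * _).
  pose f g := S (basis_vec l 1%g) i (g * h^-1)%g * (psi g w == v)%:R.
  transitivity (\sum_(g <- [fset (g * h)%g | g in F]%fset) f g).
    rewrite big_imfset/=; last by move=> ? ? _ _ /mulIg.
    by apply: eq_bigr => g _; rewrite /f mulgK.
  apply: big_fset_incl.
    apply/fsubsetP => _ /imfsetP[g gF ->]; apply/imfset2P.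
    by exists g => //; exists h.
  move=> k _ kF; rewrite /f F0 ?mul0r//; apply: contra kF => kF.
  by apply/imfsetP; exists (k * h^-1)%g => //; rewrite mulgVK.
- exists (K * L); first exact: mulr_ge0.
  by move=> m psi; apply: col_bounded_mul.
Qed.

End ModelMatrices.

(** * Convolution operators *)

Section Convolution.
Variables (R : realType) (G : groupType) (n : nat).
Local Notation C := R[i].
Local Notation H := (ell2 R G).
Local Notation Hn := ('I_n -> H).
Implicit Types (F : {fset G}) (c : 'I_n -> 'I_n -> G -> C).

Definition op_conv F c (x : Hn) : Hn :=
  fun i => \sum_j \sum_(g <- F) c i j g *: ltranslate g (x j).

Lemma op_convE F c x i k :
  op_conv F c x i k = \sum_j \sum_(g <- F) c i j g * x j (g^-1 * k)%g.
Proof.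
have sumE (I : Type) (r : seq I) (f : I -> H) g :
    (\sum_(l <- r) f l) g = \sum_(l <- r) f l g.
  by elim: r => [|l r IH]; rewrite ?big_nil// !big_cons -IH.
by rewrite sumE; apply: eq_bigr => j _; rewrite sumE.
Qed.

Definition invF F := [fset g^-1%g | g in F]%fset.
Definition adj_coef c : 'I_n -> 'I_n -> G -> C := fun i j g => (c j i g^-1%g)^*.

Lemma sum_invF F (V : nmodType) (f : G -> V) :
  \sum_(g <- invF F) f g = \sum_(g <- F) f g^-1%g.
Proof. by rewrite big_imfset//= => ? ? _ _ /invg_inj. Qed.

Lemma inner_ltranslate g (u v : H) :
  inner (ltranslate g u) v = inner u (ltranslate g^-1 v).
Proof.
apply: (hsum_unique (inner_hsum _ _)).
have := hsum_bij (mulKVg g) (mulKg g) (inner_hsum u (ltranslate g^-1 v)).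
by apply: hsum_ext => k /=; rewrite invgK mulKVg.
Qed.

Lemma op_conv_adjoint F c : adjoint (op_conv F c) (op_conv (invF F) (adj_coef c)).
Proof.
have sumL (I : Type) (r : seq I) (f : I -> H) v :
    inner (\sum_(k <- r) f k) v = \sum_(k <- r) inner (f k) v.
  elim: r => [|k r IH]; last by rewrite !big_cons innerDl IH.
  by rewrite !big_nil -(scale0r (0 : H)) innerZl mul0r.
have sumR (I : Type) (r : seq I) (f : I -> H) v :
    inner v (\sum_(k <- r) f k) = \sum_(k <- r) inner v (f k).
  by rewrite innerC sumL rmorph_sum; apply: eq_bigr => k _ /=; rewrite -innerC.
move=> x y; rewrite /innern.
under eq_bigr do rewrite sumL.
under [RHS]eq_bigr do rewrite sumR.
rewrite exchange_big/=; apply: eq_bigr => j _; apply: eq_bigr => i _.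
rewrite sumL sumR sum_invF; apply: eq_bigr => g _.
rewrite innerZl inner_ltranslate [RHS]innerC innerZl rmorphM/= -innerC.
by rewrite /adj_coef conjCK invgK.
Qed.

Lemma op_conv_equivariant F c : equivariant (op_conv F c).
Proof.
move=> h x; apply: Hn_ext => i k; rewrite /= !op_convE.
by apply: eq_bigr => j _; apply: eq_bigr => g _; rewrite /= mulgA.
Qed.

Lemma op_conv_basis F c i j k :
  op_conv F c (basis_vec j 1%g) i k = if k \in F then c i j k else 0.
Proof.
rewrite op_convE (bigD1 j)//= [X in _ + X]big1 ?addr0; last first.
  by move=> l /negPf lj; rewrite big1// => g _; rewrite basis_vecE lj mulr0.
under eq_bigr do rewrite basis_vecE eqxx mulg_eq1 (inj_eq (@invg_inj G)).
case: ifPn => kF; last first.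
  rewrite big1_fset// => g gF _; case: eqP => [e|]; rewrite ?mulr0//.
  by rewrite -e gF in kF.
rewrite (big_fsetD1 k)//= eqxx mulr1 big1_fset ?addr0// => g.
by rewrite !inE => /andP[/negPf -> _] _; rewrite mulr0.
Qed.

Definition mx_conv (K : pzSemiRingType) F (c : 'I_n -> 'I_n -> G -> K) m
    (psi : G -> 'S_m) : 'M[K]_(model_size n m) :=
  \matrix_(p, q) \sum_(g <- F) c (enum_val p).1 (enum_val q).1 g
                   * (psi g (enum_val q).2 == (enum_val p).2)%:R.

Lemma mx_convE (K : pzSemiRingType) F (c : 'I_n -> 'I_n -> G -> K) m
    (psi : G -> 'S_m) i v j w : mx_conv F c psi (model_index i v) (model_index j w) =
  \sum_(g <- F) c i j g * (psi g w == v)%:R.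
Proof. by rewrite mxE !enum_rankK. Qed.

Definition coef_norm F c := \sum_i \sum_j \sum_(g <- F) `|c i j g|.

Lemma coef_norm_ge0 F c : 0 <= coef_norm F c.
Proof. by do 3!(rewrite sumr_ge0// => ? _). Qed.

Lemma mx_conv_bounded F c m (psi : G -> 'S_m) :
  col_bounded (coef_norm F c) (mx_conv F c psi).
Proof.
move=> q; have [j [w ->]] := model_indexP q; rewrite sum_model_index ler_sum// => i _.
rewrite (bigD1 j)//= -[leLHS]addr0 lerD//; last first.
  by do 2!(rewrite sumr_ge0// => ? _).
apply: (@le_trans _ _ (\sum_v \sum_(g <- F) `|c i j g| * (psi g w == v)%:R)).
  apply: ler_sum => v _; rewrite mx_convE (le_trans (ler_norm_sum _ _ _))//.
  by apply: ler_sum => g _; rewrite normrM normr_nat.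
rewrite exchange_big/= ler_sum// => g _.
rewrite (bigD1 (psi g w))//= eqxx mulr1 big1 ?addr0// => v /negPf.
by rewrite eq_sym => ->; rewrite mulr0.
Qed.

Definition mx_adj N (M : 'M[C]_N) : 'M[C]_N := map_mx Num.conj M^T.

Lemma mx_adjE N (M : 'M[C]_N) p q : mx_adj M p q = (M q p)^*.
Proof. by rewrite !mxE. Qed.

Lemma mx_conv_adj_bounded F c m (psi : G -> 'S_m) :
  col_bounded (coef_norm F c) (mx_adj (mx_conv F c psi)).
Proof.
move=> q; have [i [v ->]] := model_indexP q; rewrite sum_model_index exchange_big/=.
rewrite [leRHS]exchange_big/= [leLHS]exchange_big/= ler_sum// => j _.
rewrite (bigD1 i)//= -[leLHS]addr0 lerD//; last first.
  by do 2!(rewrite sumr_ge0// => ? _).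
apply: (@le_trans _ _ (\sum_w \sum_(g <- F) `|c i j g| * (psi g w == v)%:R)).
  apply: ler_sum => w _; rewrite mx_adjE mx_convE norm_conjC.
  rewrite (le_trans (ler_norm_sum _ _ _))//.
  by apply: ler_sum => g _; rewrite normrM normr_nat.
rewrite exchange_big/= ler_sum// => g _.
rewrite (bigD1 ((psi g)^-1%g v))//= permKV eqxx mulr1 big1 ?addr0// => w /negPf.
by rewrite (canF_eq (permK _)) => ->; rewrite mulr0.
Qed.

Lemma approximates_conv F c : approximates (op_conv F c) (@mx_conv C F c).
Proof.
split.
- by exists (op_conv (invF F) (adj_coef c)); apply: op_conv_adjoint.
- exact: op_conv_equivariant.
- exists F => [i j g /negPf gF|]; first by rewrite op_conv_basis gF.
  apply: ae_true => m psi w i v j; rewrite mx_convE !big_seq.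
  by apply: eq_bigr => g gF; rewrite op_conv_basis gF.
- exists (coef_norm F c); first exact: coef_norm_ge0.
  by move=> m psi; apply: mx_conv_bounded.
Qed.

(** The adjoint matrix involves the inverses of the permutations [psi g],
    which agree almost everywhere with [psi g^-1]. *)
Lemma approximates_conv_adj F c : approximates
  (op_conv (invF F) (adj_coef c)) (fun m psi => mx_adj (mx_conv F c psi)).
Proof.
split.
- by exists (op_conv F c); apply: adjointC; apply: op_conv_adjoint.
- exact: op_conv_equivariant.
- exists (invF F) => [i j g /negPf gF|]; first by rewrite op_conv_basis gF.
  have aeV : ae R (fun m psi w => forall g, g \in enum_fset F ->
      psi g (psi g^-1%g w) = w :> 'I_m).
    apply: ae_all => g _; apply: ae_mono (ae_and (@ae_mul R G g g^-1%g) (@ae_one R G)).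
    by move=> m psi w [<-]; rewrite mulgV.
  apply: ae_mono aeV => m psi w wV i v j.
  rewrite mx_adjE mx_convE sum_invF rmorph_sum/= !big_seq.
  apply: eq_bigr => g gF; rewrite op_conv_basis ifT; last by apply/imfsetP; exists g.
  rewrite /adj_coef invgK rmorphM/= rmorph_nat.
  by rewrite -{1}(wV g gF) (inj_eq perm_inj) eq_sym.
- exists (coef_norm F c); first exact: coef_norm_ge0.
  by move=> m psi; apply: mx_conv_adj_bounded.
Qed.

End Convolution.

Section Frobenius.
Variables (R : realType) (G : groupType) (n : nat).
Local Notation C := R[i].
Local Notation H := (ell2 R G).
Local Notation Hn := ('I_n -> H).

Definition sqfrob N (M : 'M[C]_N) : R := \sum_p \sum_q sqmod (M p q).

Lemma sqnorm_fin (F : {fset G}) (x : Hn) : (forall i g, g \notin F -> x i g = 0) ->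
  sqnorm x = \sum_i \sum_(g <- F) sqmod (x i g).
Proof.
move=> xF; apply: (@complexI R); rewrite -sqnormE rmorph_sum; apply: eq_bigr => i _.
rewrite rmorph_sum; apply: (hsum_unique (inner_hsum _ _)).
apply: hsum_ext (hsum_fin (F0 := F) (f := fun g => (sqmod (x i g))%:C%C) _) => g.
  by rewrite sqmodE normCK.
by move=> gF; rewrite xF// sqmod0.
Qed.

Lemma sum_sqmod_injective (F : {fset G}) m (h : G -> 'I_m) (t : G -> C) :
  {in F &, injective h} ->
  \sum_v sqmod (\sum_(g <- F) t g * (h g == v)%:R) = \sum_(g <- F) sqmod (t g).
Proof.
move=> hI.
have point v : sqmod (\sum_(g <- F) t g * (h g == v)%:R) =
    \sum_(g <- F) sqmod (t g) * (h g == v)%:R.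
  have [[g gF hg]|nex] := pselect (exists2 g, g \in F & h g = v).
    have z g' : g' \in (F `\ g)%fset -> (h g' == v) = false.
      rewrite !inE => /andP[gg' g'F]; apply: contraNF gg' => /eqP hg'.
      by apply/eqP/hI; rewrite // hg hg'.
    rewrite !(big_fsetD1 g gF)/=.
    rewrite big1_fset ?addr0; last by move=> g' /z -> _; rewrite mulr0.
    rewrite [X in _ + X]big1_fset ?addr0; last by move=> g' /z -> _; rewrite mulr0.
    by rewrite hg eqxx !mulr1.
  have z g : g \in F -> (h g == v) = false.
    by move=> gF; apply/negbTE/eqP => hg; apply: nex; exists g.
  rewrite big1_fset ?sqmod0 ?big1_fset// => g /z -> _; exact: mulr0.
under eq_bigr do rewrite point.
rewrite exchange_big/=; apply: eq_bigr => g _.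
rewrite (bigD1 (h g))//= eqxx mulr1 big1 ?addr0// => v /negPf.
by rewrite eq_sym => ->; rewrite mulr0.
Qed.

(** Almost every column has the same norm as the corresponding vector, because
    the points [psi g w] are distinct for [g] in the support; the other
    columns are bounded. *)
Lemma approximates_sqfrob (T : Hn -> Hn) M : approximates T M ->
  forall eta : R, 0 < eta -> eventually R (fun m psi =>
    `|sqfrob (M m psi) - m%:R * \sum_j sqnorm (T (basis_vec j 1%g))| <= eta * m%:R).
Proof.
move=> [_ _ [F TF aeT] [K K0 MK]] eta eta0.
pose A := \sum_j sqnorm (T (basis_vec j 1%g)); pose k := complex.Re K.
have A0 : 0 <= A by rewrite sumr_ge0// => j _; apply: sqnorm_ge0.
pose col m (psi : G -> 'S_m) (w : 'I_m) := \sum_j \sum_p sqmod (M m psi p (model_index j w)).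
have sqfrobE m psi : sqfrob (M m psi) = \sum_w col m psi w.
  rewrite /sqfrob exchange_big/= sum_model_index exchange_big/=; exact: eq_bigr.
have colB m psi w : 0 <= col m psi w <= n%:R * k ^+ 2.
  rewrite /col !sumr_ge0/=; last by move=> ? _; rewrite sumr_ge0// => ? _; exact: sqmod_ge0.
  rewrite mulr_natl -[X in _ *+ X]card_ord -sumr_const ler_sum// => j _.
  rewrite -lecR rmorphXn/= /k RRe_real ?ger0_real// rmorph_sum/=.
  apply: (@le_trans _ _ ((\sum_p `|M m psi p (model_index j w)|) ^+ 2)).
    rewrite expr2 mulr_suml ler_sum// => p _; rewrite sqmodE expr2 ler_wpM2l//.
    by rewrite (bigD1 p)//= lerDl sumr_ge0.
  by rewrite lerXn2r ?nnegrE ?sumr_ge0// MK.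
pose B := n%:R * k ^+ 2 + A.
have B0 : 0 <= B by rewrite addr_ge0// mulr_ge0// sqr_ge0.
have B1 : 0 < B + 1 by rewrite ltr_wpDl.
have e1 : 0 < eta / (B + 1) by rewrite divr_gt0.
have aeC : ae R (fun m psi w => col m psi w = A).
  apply: ae_mono (ae_and aeT (@ae_inj R G F)) => m psi w [Tw Iw].
  apply: eq_bigr => j _; rewrite sum_model_index (sqnorm_fin (TF^~ j)).
  apply: eq_bigr => i _; rewrite -(sum_sqmod_injective _ Iw).
  by apply: eq_bigr => v _; rewrite Tw.
apply: eventually_mono (aeC _ e1) => m psi _ le_bad.
have -> : sqfrob (M m psi) - m%:R * A = \sum_w (col m psi w - A).
  by rewrite sqfrobE sumrB sumr_const card_ord mulr_natl.
apply: le_trans (ler_norm_sum _ _ _) _.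
apply: (@le_trans _ _ (\sum_(w in bad (fun w => col m psi w = A)) B)).
  rewrite [leRHS]big_mkcond ler_sum// => w _; rewrite inE.
  case: asboolP => [->|_] /=; first by rewrite subrr normr0.
  have /andP[c0 cB] := colB m psi w; rewrite (le_trans (ler_normB _ _))//.
  by rewrite !ger0_norm// lerD2r.
have -> : \sum_(w in bad (fun w => col m psi w = A)) B =
    #|bad (fun w => col m psi w = A)|%:R * B.
  by rewrite sumr_const mulr_natl; congr (_ *+ _); apply: eq_card.
have := ler_wpM2r B0 le_bad; move/le_trans; apply.
by rewrite mulrAC ler_wpM2r// mulrAC -mulrA ger_pMr// ler_pdivrMr// mul1r lerDl.
Qed.

End Frobenius.

(** * The spectrum of Gram matrices *)

Section GramMatrix.
Variables (R : realType).
Local Notation C := R[i].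
Variables (N : nat).
Implicit Types (M X P : 'M[C]_N).

Lemma mx_adjM M X : mx_adj (M *m X) = mx_adj X *m mx_adj M.
Proof. by rewrite /mx_adj trmx_mul map_mxM. Qed.

Lemma mx_adjK M : mx_adj (mx_adj M) = M.
Proof. by apply/matrixP => p q; rewrite !mx_adjE conjCK. Qed.

Lemma sqfrobE X : (sqfrob X)%:C%C = \tr (X *m mx_adj X).
Proof.
rewrite /sqfrob /mxtrace rmorph_sum/=; apply: eq_bigr => p _.
rewrite rmorph_sum mxE; apply: eq_bigr => q _ /=.
by rewrite mx_adjE -normCK sqmodE.
Qed.

Lemma sqfrob_unitary P X : mx_adj P *m P = 1%:M -> sqfrob (P *m X) = sqfrob X.
Proof.
move=> PP; apply: (@complexI R); rewrite !sqfrobE mx_adjM mxtrace_mulC.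
by rewrite -mulmxA (mulmxA (mx_adj P)) PP mul1mx mxtrace_mulC.
Qed.

Lemma sqfrob_unitary_r P X : P *m mx_adj P = 1%:M -> sqfrob (X *m P) = sqfrob X.
Proof.
move=> PP; apply: (@complexI R); rewrite !sqfrobE mx_adjM.
by rewrite -mulmxA (mulmxA P) PP mul1mx.
Qed.

Definition rdiag (e : 'I_N -> R) : 'M[C]_N := diag_mx (\row_i (e i)%:C%C).

Lemma rdiag_mul e X p q : (rdiag e *m X) p q = (e p)%:C%C * X p q.
Proof. by rewrite mul_diag_mx !mxE. Qed.

Lemma mul_rdiag e f : rdiag e *m rdiag f = rdiag (fun i => e i * f i).
Proof.
apply/matrixP => p q; rewrite rdiag_mul !mxE rmorphM/=.
by case: eqP => [->|]; rewrite ?mulr0.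
Qed.

Lemma sqfrob_rdiag e : sqfrob (rdiag e) = \sum_i e i ^+ 2.
Proof.
apply: eq_bigr => i _; rewrite (bigD1 i)//= big1 ?addr0 => [|j /negPf ji].
  by rewrite !mxE eqxx mulr1n /sqmod /= expr0n addr0.
by rewrite !mxE eq_sym ji mulr0n sqmod0.
Qed.

Lemma rank_rdiag e : \rank (rdiag e) = #|[pred i | e i != 0%R]|.
Proof.
have le_rank f : (\rank (rdiag f) <= #|[pred i | f i != 0%R]|)%N.
  have -> : rdiag f = \sum_(i | f i != 0) (f i)%:C%C *: delta_mx i i.
    rewrite /rdiag diag_mx_sum_delta [RHS]big_mkcond; apply: eq_bigr => i _.
    by rewrite mxE; case: eqP => // ->; rewrite scale0r.
  rewrite -sum1_card; elim/big_rec2: _ => [|i r Y _ le_r]; first by rewrite mxrank0.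
  rewrite (leq_trans (mxrank_add _ _))// leq_add//.
  by rewrite (leq_trans (mxrank_scale _ _))// mxrank_delta.
apply/eqP; rewrite eqn_leq le_rank/=.
have := mxrank_add (rdiag e *m rdiag (fun i => (e i)^-1)) (rdiag (fun i => (e i == 0%R)%:R)).
have -> : rdiag e *m rdiag (fun i => (e i)^-1) + rdiag (fun i => (e i == 0%R)%:R) = 1%:M.
  rewrite mul_rdiag; apply/matrixP => p q; rewrite !mxE -mulrnDl -rmorphD/=.
  congr (_ *+ _); rewrite -[RHS]/((1 : R)%:C%C); congr (_%:C%C).
  by have [->|e0] := eqVneq (e p) 0; rewrite ?mul0r ?add0r// divff// addr0.
rewrite mxrank1 => /leq_trans le_N.
have := le_N _ (leq_add (mxrankM_maxl _ _) (le_rank _)).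
rewrite -[X in (X <= _)%N]card_ord -(cardC [pred i | e i == 0%R]) addnC.
rewrite (@eq_card _ [pred i | ((e i == 0)%:R : R) != 0] [pred i | e i == 0%R]).
  by rewrite leq_add2r.
by move=> i; rewrite !inE pnatr_eq0 eqb0 negbK.
Qed.

(** The eigenvalues of [mx_adj M *m M] when the rows of [P] are an orthonormal
    basis of eigenvectors: written as squared norms they are nonnegative real
    numbers. *)
Definition gram_eig M P (i : 'I_N) : R := \sum_k sqmod ((P *m mx_adj M) i k).

(** The spectral theorem for the Hermitian matrix [mx_adj M *m M]. *)
Lemma gram_spectral M : exists P, [/\ P *m mx_adj P = 1%:M, mx_adj P *m P = 1%:M
  & mx_adj M *m M = mx_adj P *m rdiag (gram_eig M P) *m P].
Proof.
set B := mx_adj M *m M.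
have Bn : B \is normalmx.
  apply/normalmxP; change (B *m mx_adj B = mx_adj B *m B).
  by rewrite mx_adjM mx_adjK.
have /orthomx_spectralP BE := Bn.
set P := spectralmx B in BE; set d := spectral_diag B in BE.
have Pu : P \is unitarymx := spectral_unitarymx B.
have PP : P *m mx_adj P = 1%:M by apply/unitarymxP.
have PP' : mx_adj P *m P = 1%:M by apply: mulmx1C.
rewrite (invmx_unitary Pu) -/(mx_adj P) in BE.
exists P; split; [exact: PP | exact: PP' |].
suff -> : rdiag (gram_eig M P) = diag_mx d by exact: BE.
congr diag_mx; apply/rowP => i; rewrite mxE; symmetry.
have dE : diag_mx d = P *m mx_adj M *m mx_adj (P *m mx_adj M).
  rewrite mx_adjM mx_adjK -!mulmxA (mulmxA (mx_adj M)) -/B BE.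
  by rewrite !mulmxA PP mul1mx -mulmxA PP mulmx1.
have := congr1 (fun X : 'M[C]_N => X i i) dE; rewrite mxE eqxx mulr1n => ->.
rewrite mxE rmorph_sum; apply: eq_bigr => k _ /=.
by rewrite mx_adjE -normCK sqmodE.
Qed.

Lemma gram_eig_ge0 M P i : 0 <= gram_eig M P i.
Proof. by rewrite sumr_ge0// => k _; apply: sqmod_ge0. Qed.

Lemma gram_eig0 M P i : gram_eig M P i = 0 -> forall k, (P *m mx_adj M) i k = 0.
Proof.
move=> /eqP; rewrite psumr_eq0 => [/allP e0 k|k _]; last exact: sqmod_ge0.
by apply/eqP; rewrite -sqmod_eq0; apply: e0; rewrite mem_index_enum.
Qed.

Definition gram_null M P := #|[pred i | gram_eig M P i == 0%R]|.

Section Spectral.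
Variables (M P : 'M[C]_N).
Hypotheses (PP : P *m mx_adj P = 1%:M) (PP' : mx_adj P *m P = 1%:M).
Hypothesis ME : mx_adj M *m M = mx_adj P *m rdiag (gram_eig M P) *m P.
Local Notation e := (gram_eig M P).

(** The matrices [M] and [mx_adj M *m M] have the same kernel. *)
Lemma gram_null_rank : (gram_null M P = N - \rank M)%N.
Proof.
have rk1 : (\rank (rdiag e) <= \rank M)%N.
  have -> : rdiag e = P *m mx_adj M *m (M *m mx_adj P).
    rewrite -mulmxA (mulmxA (mx_adj M)) ME !mulmxA PP mul1mx.
    by rewrite -mulmxA PP mulmx1.
  by rewrite (leq_trans (mxrankM_maxr _ _))// mxrankM_maxl.
have rk2 : (\rank M <= \rank (rdiag e))%N.
  have -> : \rank M = \rank (mx_adj M).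
    by rewrite /mx_adj mxrank_map mxrank_tr.
  have -> : mx_adj M = mx_adj P *m (rdiag (fun i => (e i != 0)%:R) *m (P *m mx_adj M)).
    rewrite -[LHS]mul1mx -PP' -mulmxA; congr (_ *m _).
    apply/matrixP => i k; rewrite rdiag_mul.
    have [/gram_eig0 ->|_] := eqVneq (e i) 0; first by rewrite mulr0.
    by rewrite mul1r.
  rewrite (leq_trans (mxrankM_maxr _ _))// (leq_trans (mxrankM_maxl _ _))//.
  rewrite !rank_rdiag subset_leq_card//; apply/fintype.subsetP => i; rewrite !inE.
  by rewrite pnatr_eq0 eqb0 negbK.
have -> : \rank M = \rank (rdiag e) by apply/eqP; rewrite eqn_leq rk1 rk2.
by rewrite rank_rdiag -[X in (X - _)%N]card_ord -(cardC [pred i | e i == 0%R]) addnK.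
Qed.

(** An eigenvector [u] with eigenvalue [0] satisfies [u *m mx_adj M = 0], hence is
    fixed by [1%:M - mx_adj M *m Z]; these vectors are orthonormal. *)
Lemma gram_null_le_sqfrob Z : (gram_null M P)%:R <= sqfrob (1%:M - mx_adj M *m Z).
Proof.
rewrite -(sqfrob_unitary _ PP') mulmxBr mulmx1 mulmxA.
rewrite /gram_null -sum1_card natr_sum/= big_mkcond/=; apply: ler_sum => i _.
rewrite inE; have [e0|_] := eqVneq (e i) 0; last by rewrite sumr_ge0// => k _; apply: sqmod_ge0.
have -> : \sum_q sqmod ((P - P *m mx_adj M *m Z) i q) = \sum_q sqmod (P i q).
  apply: eq_bigr => q _; rewrite !mxE big1 ?subr0// => k _.
  by rewrite gram_eig0// mul0r.
have := congr1 (fun X : 'M[C]_N => X i i) PP; rewrite !mxE eqxx.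
under eq_bigr do rewrite mx_adjE -normCK -sqmodE.
rewrite -rmorph_sum/= -(rmorph1 (real_complex R)) => /complexI ->.
exact: lexx.
Qed.

(** The sum of the moduli of the coordinates of an eigenvector is multiplied
    by the eigenvalue, and increased at most by the factor [K]; the rows of a
    Hermitian matrix are bounded like its columns. *)
Lemma gram_eig_le (K : R) : col_bounded K%:C%C (mx_adj M *m M) -> forall i, e i <= K.
Proof.
set B := mx_adj M *m M => BK i.
have BH : mx_adj B = B by rewrite mx_adjM mx_adjK.
have uB q : (e i)%:C%C * P i q = \sum_p P i p * B p q.
  have : P *m B = rdiag e *m P by rewrite /B ME !mulmxA PP mul1mx.
  by move=> /(congr1 (fun X : 'M[C]_N => X i q)); rewrite rdiag_mul mxE => <-.
pose s := \sum_q `|P i q|.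
have s0 : 0 <= s by rewrite sumr_ge0.
have sn0 : s != 0.
  apply/eqP => s0'; have P0 q : P i q = 0.
    apply/eqP; rewrite -normr_eq0; move/eqP: s0'; rewrite psumr_eq0//.
    by move=> /allP/(_ q (mem_index_enum _)).
  have := congr1 (fun X : 'M[C]_N => X i i) PP; rewrite !mxE eqxx big1.
    by move/eqP; rewrite eq_sym oner_eq0.
  by move=> q _; rewrite P0 mul0r.
have sp : 0 < s by rewrite lt_def sn0.
rewrite -lecR -(ler_pM2r sp) mulr_sumr.
apply: (@le_trans _ _ (\sum_q \sum_p `|P i p| * `|B p q|)).
  apply: ler_sum => q _.
  rewrite -[X in X * _ <= _](ger0_norm (_ : 0 <= (e i)%:C%C)); last by rewrite ler0c gram_eig_ge0.
  rewrite -normrM uB (le_trans (ler_norm_sum _ _ _))//.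
  by apply: ler_sum => p _; rewrite normrM.
rewrite exchange_big mulr_sumr ler_sum//= => p _.
rewrite -mulr_sumr mulrC ler_wpM2r//; apply: le_trans (BK p).
by apply: ler_sum => q _; rewrite -{1}BH mx_adjE norm_conjC.
Qed.

Lemma sqfrob_gram X : sqfrob (M *m X) = \sum_i e i * \sum_q sqmod ((P *m X) i q).
Proof.
apply: (@complexI R); rewrite sqfrobE mxtrace_mulC mx_adjM -mulmxA (mulmxA (mx_adj M)) ME.
rewrite -!mulmxA (mulmxA (mx_adj X)) -mx_adjM mxtrace_mulC -mulmxA.
rewrite /mxtrace rmorph_sum; apply: eq_bigr => i _ /=.
rewrite rdiag_mul rmorphM/=; congr (_ * _).
by rewrite mxE rmorph_sum; apply: eq_bigr => q _ /=; rewrite mx_adjE -normCK sqmodE.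
Qed.

Lemma sqfrob_mul_le (K : R) X :
  col_bounded K%:C%C (mx_adj M *m M) -> sqfrob (M *m X) <= K * sqfrob X.
Proof.
move=> MK; rewrite sqfrob_gram -(sqfrob_unitary X PP') mulr_sumr ler_sum// => i _.
rewrite ler_wpM2r ?gram_eig_le//.
by rewrite sumr_ge0// => q _; apply: sqmod_ge0.
Qed.

(** The product is up to sign the lowest nonzero coefficient of the characteristic
    polynomial of an integer matrix. *)
Lemma prod_gram_eig_ge1 (M0 : 'M[int]_N) : M = map_mx intr M0 ->
  1 <= \prod_(i | e i != 0) e i.
Proof.
move=> MM0; pose B0 := M0^T *m M0.
have BE : mx_adj M *m M = map_mx intr B0.
  rewrite map_mxM MM0; congr (_ *m _); apply/matrixP => p q.
  by rewrite !mxE rmorph_int.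
have charE : char_poly (mx_adj M *m M) = \prod_i ('X - (e i)%:C%C%:P).
  transitivity (char_poly (rdiag e)).
    rewrite ME /char_poly.
    have -> : char_poly_mx (mx_adj P *m rdiag e *m P) =
        map_mx polyC (mx_adj P) *m char_poly_mx (rdiag e) *m map_mx polyC P.
      rewrite /char_poly_mx mulmxBr mulmxBl -!map_mxM; congr (_ - _).
      by rewrite scalar_mxC -mulmxA -map_mxM PP' map_mx1 mulmx1.
    rewrite !det_mulmx mulrAC -det_mulmx -map_mxM PP' map_mx1 det1 mul1r//.
  rewrite char_poly_trig ?diag_mx_is_trig//.
  by apply: eq_bigr => i _; rewrite !mxE eqxx mulr1n.
have pmap : map_poly intr (char_poly B0) = char_poly (mx_adj M *m M).
  by rewrite BE map_char_poly.
pose z := #|[pred i | e i == 0%R]|.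
pose r : C := \prod_(i | e i != 0) - (e i)%:C%C.
have coefz : (char_poly (mx_adj M *m M))`_z = r.
  rewrite charE (bigID [pred i | e i == 0%R])/=.
  rewrite (eq_bigr (fun=> 'X)) => [|i /eqP ->]; last by rewrite subr0.
  rewrite prodr_const -/z mulrC coefMXn ltnn subnn -horner_coef0 horner_prod.
  by apply: eq_bigr => i _; rewrite hornerXsubC sub0r.
have rint : r = ((char_poly B0)`_z)%:~R by rewrite -coefz -pmap coef_map.
have normr : `|r| = (\prod_(i | e i != 0) e i)%:C%C.
  rewrite normr_prod rmorph_prod; apply: eq_bigr => i _.
  by rewrite normrN ger0_norm// ler0c gram_eig_ge0.
rewrite -lecR -normr rint -intr_norm ler1z.
rewrite -gtz0_ge1 normr_gt0; apply/eqP => r0.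
have : r = 0 by rewrite rint r0.
move=> /eqP; rewrite prodf_seq_eq0 => /hasP[i _ /andP[ei]].
by rewrite oppr_eq0 -[0]/((0 : R)%:C%C) (inj_eq (@complexI R)) (negPf ei).
Qed.

End Spectral.

End GramMatrix.

(** * Small eigenvalues of integer Gram matrices *)

Section SmallEigenvalues.
Variables (R : realType).
Local Notation C := R[i].
Variables (N : nat) (M P : 'M[C]_N).
Hypotheses (PP : P *m mx_adj P = 1%:M) (PP' : mx_adj P *m P = 1%:M).
Hypothesis ME : mx_adj M *m M = mx_adj P *m rdiag (gram_eig M P) *m P.
Local Notation e := (gram_eig M P).

(** The nonzero eigenvalues have product at least [1] and are bounded by [L], so
    only few of them can be small. *)
Lemma card_small_eig (M0 : 'M[int]_N) (L d : R) (T : nat) : M = map_mx intr M0 ->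
  1 < L -> (forall i, e i <= L) -> 0 <= d -> d * L ^+ T <= 1 ->
  (#|[pred i | (0 < e i <= d)%R]| * T <= N)%N.
Proof.
move=> MM0 L1 eL d0 dL; set k := #|_|.
have L0 : 0 < L := lt_trans ltr01 L1.
have := prod_gram_eig_ge1 PP' ME MM0.
have : \prod_(i | e i != 0) e i <= \prod_i ((if 0 < e i <= d then d else 1) * L).
  rewrite big_mkcond ler_prod// => i _; have e0 := gram_eig_ge0 M P i.
  case: (eqVneq (e i) 0) => [->|en0] /=; first by rewrite ltxx/= mul1r ler01 ltW.
  rewrite e0; case: ifPn => [/andP[_ le_d]|_]; last by rewrite mul1r eL.
  by rewrite (le_trans le_d)// ler_peMr// ltW.
rewrite big_split/= prodr_const card_ord -big_mkcond/= prodr_const -/k.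
move=> /(le_trans _) h /h {h} le1.
rewrite -(ler_eXn2l L1) mulnC exprM.
rewrite -[leLHS]mulr1; apply: le_trans (ler_wpM2l (_ : 0 <= (L ^+ T) ^+ k) le1) _.
  by rewrite !exprn_ge0// ltW.
rewrite mulrA -exprMn mulrC ger_pMr ?exprn_gt0//.
have Ld0 : 0 <= L ^+ T * d by rewrite mulr_ge0// exprn_ge0// ltW.
by rewrite exprn_ile1// mulrC.
Qed.

(** The function [f] of the Gram matrix in the sense of the functional
    calculus. *)
Definition fun_mx (f : R -> R) : 'M[C]_N := mx_adj P *m rdiag (fun i => f (e i)) *m P.

Lemma fun_mx_ext f g : f =1 g -> fun_mx f = fun_mx g.
Proof. by move=> fg; rewrite /fun_mx; congr (_ *m diag_mx _ *m _); apply/rowP => i; rewrite !mxE fg. Qed.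

Lemma fun_mx1 : fun_mx (fun=> 1) = 1%:M.
Proof.
rewrite /fun_mx (_ : rdiag _ = 1%:M) ?mulmx1//.
by apply/matrixP => i j; rewrite !mxE rmorph1.
Qed.

Lemma fun_mxM f g : fun_mx f *m fun_mx g = fun_mx (fun x => f x * g x).
Proof.
rewrite /fun_mx -!mulmxA (mulmxA P) PP mul1mx; congr (_ *m _).
by rewrite mulmxA mul_rdiag.
Qed.

Lemma fun_mxZD a f g :
  fun_mx (fun x => a * f x + g x) = a%:C%C *: fun_mx f + fun_mx g.
Proof.
rewrite /fun_mx scalemxAl scalemxAr -mulmxDl -mulmxDr.
congr (_ *m _ *m _); apply/matrixP => i j; rewrite !mxE rmorphD rmorphM/=.
by rewrite mulrnDl mulrnAr.
Qed.

Lemma sqfrob_fun_mx f : sqfrob (fun_mx f) = \sum_i f (e i) ^+ 2.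
Proof.
rewrite /fun_mx -mulmxA sqfrob_unitary ?mx_adjK// sqfrob_unitary_r//.
exact: sqfrob_rdiag.
Qed.

Lemma sqfrob_mul_fun_mx f : sqfrob (M *m fun_mx f) = \sum_i e i * f (e i) ^+ 2.
Proof.
rewrite (sqfrob_gram ME); apply: eq_bigr => i _; congr (_ * _).
rewrite /fun_mx -!mulmxA (mulmxA P) PP mul1mx; apply: (@complexI R).
have := congr1 (fun X : 'M[C]_N => X i i) PP; rewrite !mxE eqxx /= => PPi.
rewrite rmorph_sum/= rmorphXn/= -[RHS]mulr1 -[X in _ = _ * X]PPi mulr_sumr; apply: eq_bigr => q _.
by rewrite rdiag_mul sqmodM rmorphM/= !sqmodE mx_adjE -normCK real_normK ?complex_real.
Qed.

(** Partial sums of the Neumann series of the inverse of the Gram matrix: the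
    product with the Gram matrix is [1 - (1 - x / L) ^+ k]. *)
Definition neumann_mx (B : 'M[C]_N) (L : R) k : 'M[C]_N :=
  iter k (fun Y => (- L^-1)%:C%C *: (B *m Y) + ((L^-1)%:C%C *: 1%:M + Y)) 0.

Definition neumann (L : R) k (x : R) : R :=
  iter k (fun y => - L^-1 * (x * y) + (L^-1 * 1 + y)) 0.

Lemma neumann_mxE L k : neumann_mx (mx_adj M *m M) L k = fun_mx (neumann L k).
Proof.
have BE : mx_adj M *m M = fun_mx id by rewrite ME.
elim: k => [|k IH].
  rewrite /neumann /= /fun_mx (_ : rdiag _ = 0) ?mulmx0 ?mul0mx//.
  by apply/matrixP => i j; rewrite !mxE rmorph0 mul0rn.
rewrite /neumann_mx iterS -/(neumann_mx _ L k) IH BE fun_mxM -fun_mx1 -!fun_mxZD.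
by apply: fun_mx_ext => x.
Qed.

Lemma neumannP L k x : L != 0 -> 1 - x * neumann L k x = (1 - x / L) ^+ k.
Proof.
move=> L0; elim: k => [|k IH]; first by rewrite mulr0 subr0.
rewrite /neumann iterS -/(neumann L k x) exprS -IH; by field.
Qed.

Lemma neumann_ge0_le L k x : 0 < L -> 0 <= x <= L ->
  0 <= neumann L k x <= k%:R / L.
Proof.
move=> L0 /andP[x0 xL]; elim: k => [|k /andP[y0 yk]]; first by rewrite mul0r lexx.
rewrite /neumann iterS -/(neumann L k x).
have -> : - L^-1 * (x * neumann L k x) + (L^-1 * 1 + neumann L k x) =
  L^-1 + (1 - x / L) * neumann L k x by ring.
have xL0 : 0 <= 1 - x / L by rewrite subr_ge0 ler_pdivrMr// mul1r.
have xL1 : 1 - x / L <= 1 by rewrite gerBl divr_ge0// ltW.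
rewrite addr_ge0 ?invr_ge0 ?(ltW L0)//=; last exact: mulr_ge0.
have -> : k.+1%:R / L = L^-1 + k%:R / L by rewrite -natr1 mulrDl mul1r addrC.
rewrite lerD2l; apply: le_trans yk.
by rewrite ler_piMl.
Qed.

Lemma sqmodD_weighted (t : R) (a b : C) : 0 < t ->
  sqmod (a + b) <= (1 + t) * sqmod a + (1 + t^-1) * sqmod b.
Proof.
move=> t0; case: a b => [a b] [c d]; rewrite /sqmod /= -subr_ge0.
have -> : (1 + t) * (a ^+ 2 + b ^+ 2) + (1 + t^-1) * (c ^+ 2 + d ^+ 2)
    - ((a + c) ^+ 2 + (b + d) ^+ 2) =
    t^-1 * ((t * a - c) ^+ 2 + (t * b - d) ^+ 2) by field; rewrite gt_eqF.
by rewrite mulr_ge0 ?invr_ge0 ?(ltW t0)// addr_ge0 ?sqr_ge0.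
Qed.

Lemma sqfrobD_weighted (t : R) (X Y : 'M[C]_N) : 0 < t ->
  sqfrob (X + Y) <= (1 + t) * sqfrob X + (1 + t^-1) * sqfrob Y.
Proof.
move=> t0; rewrite /sqfrob !mulr_sumr -big_split ler_sum// => p _.
rewrite !mulr_sumr -big_split ler_sum// => q _.
by rewrite mxE sqmodD_weighted.
Qed.

Lemma sqfrobZ (a : C) (X : 'M[C]_N) : sqfrob (a *: X) = sqmod a * sqfrob X.
Proof.
rewrite /sqfrob mulr_sumr; apply: eq_bigr => p _; rewrite mulr_sumr.
by apply: eq_bigr => q _; rewrite mxE sqmodM.
Qed.

(** The eigenvalues of the matrix are the [(1 - x / L) ^+ k]: they are [1] for
    the zero eigenvalues [x], at most [1] for the few small ones, and at most
    [r] for [x >= d]. *)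
Lemma sqfrob_neumann_le (M0 : 'M[int]_N) (L d r : R) (T k : nat) : M = map_mx intr M0 ->
  1 < L -> (forall i, e i <= L) -> 0 <= d -> d * L ^+ T <= 1 -> (0 < T)%N ->
  (1 - d / L) ^+ k <= r -> r <= 1 ->
  sqfrob (1%:M - mx_adj M *m M *m neumann_mx (mx_adj M *m M) L k) <=
    (gram_null M P)%:R + N%:R / T%:R + N%:R * r.
Proof.
move=> MM0 L1 eL d0 dL T0 dr r1.
have L0 : 0 < L := lt_trans ltr01 L1.
have -> : 1%:M - mx_adj M *m M *m neumann_mx (mx_adj M *m M) L k =
    fun_mx (fun x => (1 - x / L) ^+ k).
  rewrite neumann_mxE {1}ME -[mx_adj P *m _ *m P]/(fun_mx id) fun_mxM -fun_mx1.
  rewrite addrC -scaleN1r.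
  rewrite -(rmorphN1 (real_complex R)) -fun_mxZD; apply: fun_mx_ext => x.
  by rewrite -neumannP ?gt_eqF// mulN1r addrC.
rewrite sqfrob_fun_mx.
have small : #|[pred i | 0 < e i <= d]|%:R <= N%:R / T%:R :> R.
  rewrite ler_pdivlMr ?ltr0n// -natrM ler_nat.
  exact: card_small_eig MM0 L1 eL d0 dL.
apply: (@le_trans _ _ ((gram_null M P)%:R + #|[pred i | 0 < e i <= d]|%:R + N%:R * r)).
  have cardE (p : pred 'I_N) : #|p|%:R = \sum_i (p i)%:R :> R.
    rewrite -sum1_card natr_sum/= big_mkcond; apply: eq_bigr => i _.
    by rewrite unfold_in; case: (p i).
  rewrite /gram_null !cardE mulr_natl -[X in r *+ X]card_ord -sumr_const -!big_split/= ler_sum// => i _.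
  have e0 := gram_eig_ge0 M P i.
  have x0 : 0 <= 1 - e i / L by rewrite subr_ge0 ler_pdivrMr// mul1r.
  have x1 : 1 - e i / L <= 1 by rewrite gerBl divr_ge0// ltW.
  have r0 : 0 <= r.
    by apply: le_trans dr; rewrite exprn_ge0// subr_ge0 ler_pdivrMr// mul1r;
      apply: le_trans (ltW L1); apply: le_trans dL; rewrite ler_peMr// exprn_ege1// ltW.
  have xk1 : ((1 - e i / L) ^+ k) ^+ 2 <= 1 by rewrite !exprn_ile1// exprn_ge0.
  rewrite /=; case: eqVneq => [ei|ei] /=.
    by rewrite ei ltxx/= mul0r subr0 !expr1n addr0 lerDl.
  have -> : 0 < e i by rewrite lt_def ei.
  case: (leP (e i) d) => de /=; first by rewrite add0r (le_trans xk1)// lerDl.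
  rewrite !add0r expr2 (le_trans (ler_piMl _ _)) ?exprn_ge0 ?exprn_ile1//.
  apply: le_trans dr; rewrite lerXn2r ?nnegrE// ?(le_trans x0)//.
    by rewrite lerB// ler_pM2r ?invr_gt0// ltW.
  by rewrite lerB// ler_pM2r ?invr_gt0// ltW.
by rewrite lerD2r lerD2l.
Qed.

(** As [neumann L k x <= k / L], an eigenvalue [x <= L] contributes [x *
    neumann L k x ^+ 2 <= k ^+ 2 / L]. *)
Lemma sqfrob_mul_neumann_le (L : R) (k : nat) : 1 < L -> (forall i, e i <= L) ->
  sqfrob (M *m neumann_mx (mx_adj M *m M) L k) <= N%:R * k%:R ^+ 2.
Proof.
move=> L1 eL; have L0 : 0 < L := lt_trans ltr01 L1.
rewrite neumann_mxE sqfrob_mul_fun_mx mulr_natl -[X in _ *+ X]card_ord -sumr_const.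
rewrite ler_sum// => i _; have e0 := gram_eig_ge0 M P i.
have /andP[y0 yk] : 0 <= neumann L k (e i) <= k%:R / L.
  by apply: neumann_ge0_le => //; rewrite e0 eL.
apply: le_trans (_ : L * (k%:R / L) ^+ 2 <= _).
  by rewrite ler_pM ?sqr_ge0// lerXn2r ?nnegrE// (le_trans y0).
have -> : L * (k%:R / L) ^+ 2 = k%:R ^+ 2 * L^-1 by field; rewrite gt_eqF.
by rewrite ler_piMr ?sqr_ge0// invf_le1// ltW.
Qed.

(** If [mx_adj M = F *m H] exactly, the matrix is that of [sqfrob_neumann_le];
    the perturbation [c *: Q] contributes the second term. The weight [t]
    keeps the coefficient of [gram_null M P] arbitrarily close to [1]. *)
Lemma sqfrob_perturbed_le (M0 : 'M[int]_N) (L d r t K : R) (T k : nat)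
    (F H Q : 'M[C]_N) (c : C) : M = map_mx intr M0 ->
  1 < L -> (forall i, e i <= L) -> 0 <= d -> d * L ^+ T <= 1 -> (0 < T)%N ->
  (1 - d / L) ^+ k <= r -> r <= 1 -> 0 < t -> 0 <= K ->
  mx_adj M = F *m H + c *: Q -> (forall X, sqfrob (Q *m X) <= K * sqfrob X) ->
  sqfrob (1%:M - F *m (H *m (M *m neumann_mx (mx_adj M *m M) L k))) <=
    (1 + t) * ((gram_null M P)%:R + N%:R / T%:R + N%:R * r)
    + (1 + t^-1) * (sqmod c * (K * (N%:R * k%:R ^+ 2))).
Proof.
move=> MM0 L1 eL d0 dL T0 dr r1 t0 K0 MFQ QK; set S := neumann_mx _ _ _.
have -> : 1%:M - F *m (H *m (M *m S)) =
    (1%:M - mx_adj M *m M *m S) + c *: (Q *m (M *m S)).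
  rewrite mulmxA; have -> : F *m H = mx_adj M - c *: Q by rewrite MFQ addrK.
  by rewrite mulmxBl -scalemxAl opprB -(mulmxA (mx_adj M)) addrA addrAC.
apply: le_trans (sqfrobD_weighted _ _ t0) _; rewrite lerD//.
  rewrite ler_wpM2l ?addr_ge0 ?(ltW t0)//.
  exact: sqfrob_neumann_le MM0 L1 eL d0 dL T0 dr r1.
rewrite ler_wpM2l ?addr_ge0 ?invr_ge0 ?(ltW t0)// sqfrobZ ler_wpM2l ?sqmod_ge0//.
by apply: le_trans (QK _) _; rewrite ler_wpM2l// sqfrob_mul_neumann_le.
Qed.

End SmallEigenvalues.

(** * Kernel dimensions and finite models *)

Section PolynomialMatrices.
Variables (K : comNzRingType).

(** [horner_mx] for matrices whose size is not syntactically a successor. *)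
Definition poly_mx N : 'M[K]_N -> {poly K} -> 'M[K]_N :=
  if N is N'.+1 then fun M p => horner_mx M p else fun M _ => M.

Variable N : nat.
Implicit Types (M : 'M[K]_N) (p q : {poly K}).

Lemma poly_mxD M p q : poly_mx M (p + q) = poly_mx M p + poly_mx M q.
Proof.
case: N M => [|N'] M; first by rewrite [LHS]flatmx0 [RHS]flatmx0.
exact: rmorphD.
Qed.

Lemma poly_mxM M p q : poly_mx M (p * q) = poly_mx M p *m poly_mx M q.
Proof.
case: N M => [|N'] M; first by rewrite [LHS]flatmx0 [RHS]flatmx0.
exact: rmorphM.
Qed.

Lemma poly_mxC M a : poly_mx M a%:P = a%:M.
Proof.
case: N M => [|N'] M; first by rewrite [LHS]flatmx0 [RHS]flatmx0.
exact: horner_mx_C.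
Qed.

Lemma poly_mxX M : poly_mx M 'X = M.
Proof.
case: N M => [|N'] M; first by rewrite [LHS]flatmx0 [RHS]flatmx0.
exact: horner_mx_X.
Qed.

Lemma poly_mx1 M : poly_mx M 1 = 1%:M.
Proof. exact: poly_mxC. Qed.

Lemma poly_mx0 M : poly_mx M 0 = 0.
Proof. by rewrite poly_mxC; apply/matrixP => i j; rewrite !mxE mul0rn. Qed.

Lemma poly_mxZ M a p : poly_mx M (a *: p) = a *: poly_mx M p.
Proof. by rewrite -mul_polyC poly_mxM poly_mxC mul_scalar_mx. Qed.

Lemma poly_mx_coef M p : poly_mx M p = \sum_(i < size p) p`_i *: M ^+ i.
Proof.
rewrite -{1}[p]coefK poly_def.
elim/big_ind2: _ => [|f X g Y fX gY|i _]; first exact: poly_mx0.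
  by rewrite poly_mxD fX gY.
rewrite poly_mxZ; congr (_ *: _); elim: (i : nat) => [|k IH].
  by rewrite !expr0 poly_mx1.
by rewrite !exprSr poly_mxM IH poly_mxX.
Qed.

End PolynomialMatrices.

Lemma map_poly_mx (K L : comNzRingType) (f : {rmorphism K -> L}) N (M : 'M[K]_N) p :
  map_mx f (poly_mx M p) = poly_mx (map_mx f M) (map_poly f p).
Proof.
case: N M => [|N'] M; first by rewrite [LHS]flatmx0 [RHS]flatmx0.
exact: map_horner_mx.
Qed.

Section ApproximatePolynomials.
Variables (R : realType) (G : groupType) (n : nat).
Local Notation C := R[i].
Local Notation H := (ell2 R G).
Local Notation Hn := ('I_n -> H).
Implicit Types (S T : Hn -> Hn) (M : mfamily R G n).

Lemma mx_adjD N (M M' : 'M[C]_N) : mx_adj (M + M') = mx_adj M + mx_adj M'.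
Proof. by apply/matrixP => i j; rewrite !mxE rmorphD. Qed.

Lemma mx_adjZ N a (M : 'M[C]_N) : mx_adj (a *: M) = a^* *: mx_adj M.
Proof. by apply/matrixP => i j; rewrite !mxE rmorphM. Qed.

Lemma mx_adj_poly N (M : 'M[C]_N) f :
  mx_adj (poly_mx M f) = poly_mx (mx_adj M) (map_poly Num.conj f).
Proof.
elim/poly_ind: f => [|f c IH].
  by rewrite rmorph0 !poly_mx0; apply/matrixP => i j; rewrite !mxE rmorph0.
rewrite rmorphD rmorphM/= map_polyX map_polyC/= !poly_mxD !poly_mxC mx_adjD.
congr (_ + _); last first.
  by apply/matrixP => i j; rewrite !mxE rmorphMn/= eq_sym.
by rewrite [in LHS]mulrC !poly_mxM !poly_mxX mx_adjM IH.
Qed.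

Lemma approximates_eq S T M M' : S =1 T -> (forall m psi, M m psi = M' m psi) ->
  approximates S M -> approximates T M'.
Proof.
move=> /funext -> MM'; suff -> : M = M' by [].
by apply: functional_extensionality_dep => m; apply/funext => psi.
Qed.

Lemma approximates0 : approximates (fun=> 0 : Hn) (fun m psi => 0 : 'M[C]_(model_size n m)).
Proof.
have := approximates_lin (-1) (approximates_id R G n) (approximates_id R G n).
apply: approximates_eq => [x|m psi]; first by rewrite scaleN1r addNr.
by rewrite scaleN1r addNr.
Qed.

Lemma approximates_poly T M f : approximates T M ->
  approximates (poly_op T f) (fun m psi => poly_mx (M m psi) f).
Proof.
move=> TM; elim/poly_ind: f => [|f c IH].
  apply: approximates_eq approximates0 => [x|m psi]; last by rewrite poly_mx0.
  by rewrite /poly_op size_poly0 big_ord0.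
have := approximates_lin c (approximates_id R G n) (approximates_comp IH TM).
apply: approximates_eq => [x|m psi].
  by rewrite poly_opD poly_opMX poly_opC addrC.
by rewrite poly_mxD poly_mxM poly_mxX poly_mxC addrC scalemx1.
Qed.

Definition neumann_op (B : Hn -> Hn) (L : R) k (x : Hn) : Hn :=
  iter k (fun Y x => (- L^-1)%:C%C *: B (Y x) + ((L^-1)%:C%C *: x + Y x)) (fun=> 0) x.

Lemma approximates_neumann T M L k : approximates T M ->
  approximates (neumann_op T L k) (fun m psi => neumann_mx (M m psi) L k).
Proof.
move=> TM; elim: k => [|k IH]; first exact: approximates0.
apply: approximates_eq (approximates_lin (- L^-1)%:C%C (approximates_comp TM IH)
  (approximates_lin (L^-1)%:C%C (approximates_id R G n) IH)) => //.
Qed.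

End ApproximatePolynomials.

Section KernelDimension.
Variables (R : realType) (G : groupType) (n : nat).
Local Notation C := R[i].
Local Notation H := (ell2 R G).
Local Notation Hn := ('I_n -> H).
Implicit Types (T : Hn -> Hn) (M : mfamily R G n).

Lemma card_model_size m : model_size n m = (n * m)%N.
Proof. by rewrite /model_size card_prod !card_ord. Qed.

Lemma rank_null_le_sqfrob N (M Z : 'M[C]_N) :
  (N - \rank M)%:R <= sqfrob (1%:M - mx_adj M *m Z).
Proof.
have [P [PP PP' ME]] := gram_spectral M.
by rewrite -(gram_null_rank PP PP' ME) gram_null_le_sqfrob.
Qed.

(** Choose finitely supported [y] for which the sum of the [sqnorm (basis - T' y)] is
    close to [ker_dim T]. The corresponding matrices [Z] satisfy [rank_null_le_sqfrob],
    so that kernels can only be smaller in the finite models. *)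
Lemma ker_dim_upper T T' M : adjoint T T' ->
    approximates T' (fun m psi => mx_adj (M m psi)) ->
  forall eta : R, 0 < eta -> eventually R (fun m psi =>
    (model_size n m - \rank (M m psi))%:R <= (ker_dim T + eta) * m%:R).
Proof.
move=> TT' TM eta eta0; pose e := eta / (2 * n.+1%:R).
have e0 : 0 < e by rewrite divr_gt0// mulr_gt0.
have /choice[y yP] j : exists y : Hn, finitely_supported y /\
    sqnorm (basis_vec j 1%g - T' y) <= sqnorm (orthoproj (op_ker T) (basis_vec j 1%g)) + e.
  by have [y fy le_y] := sqnorm_orthoproj_ker_approx TT' (basis_vec j 1%g) e0; exists y.
have /choice[F yF] j := (yP j).1.
pose F0 := (\bigcup_(j <- enum 'I_n) F j)%fset.
pose c i j g := y j i g.
have Yy j : op_conv F0 c (basis_vec j 1%g) = y j.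
  apply: Hn_ext => i g; rewrite op_conv_basis; case: ifPn => // gF; rewrite yF//.
  apply: contra gF; apply: (fsubsetP (bigfcup_sup _ (mem_enum _ _) isT)).
have := approximates_lin (-1) (approximates_comp TM (approximates_conv F0 c))
  (approximates_id R G n).
have e20 : 0 < eta / 2 by rewrite divr_gt0.
move=> /approximates_sqfrob /(_ _ e20); apply: eventually_mono => m psi _.
rewrite scaleN1r [- _ + 1%:M]addrC.
have le_sum : \sum_j sqnorm (-1 *: (T' \o op_conv F0 c) (basis_vec j 1%g) + id (basis_vec j 1%g))
    <= ker_dim T + eta / 2.
  apply: le_trans (_ : \sum_j (sqnorm (orthoproj (op_ker T) (basis_vec j 1%g)) + e) <= _).
    by apply: ler_sum => j _; rewrite /= Yy scaleN1r addrC; case: (yP j).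
  rewrite big_split/= lerD2l sumr_const card_ord -[leLHS]mulr_natl /e.
  have -> : n%:R * (eta / (2 * n.+1%:R)) = (eta / 2) * (n%:R / n.+1%:R).
    by field; rewrite nat1r pnatr_eq0.
  by rewrite ger_pMr// ler_pdivrMr// mul1r ler_nat.
rewrite ler_distl => /andP[_ le_sqfrob].
apply: le_trans (rank_null_le_sqfrob _ _) (le_trans le_sqfrob _).
rewrite -lerBrDr (le_trans (ler_wpM2l _ le_sum))//.
by rewrite le_eqVlt; apply/orP; left; apply/eqP; field.
Qed.

(** Every convolution operator [Y] gives an upper bound of [ker_dim T], which
    the finite models compute. *)
Lemma ker_dim_le_sqfrob T T' M Y Z : adjoint T T' ->
    approximates T' M -> approximates Y Z ->
  forall eta : R, 0 < eta -> eventually R (fun m psi =>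
    ker_dim T * m%:R <= sqfrob (1%:M - M m psi *m Z m psi) + eta * m%:R).
Proof.
move=> TT' TM YZ eta eta0.
have := approximates_lin (-1) (approximates_comp TM YZ) (approximates_id R G n).
move=> /approximates_sqfrob /(_ _ eta0); apply: eventually_mono => m psi _.
rewrite scaleN1r [- _ + 1%:M]addrC ler_distl => /andP[+ _]; rewrite lerBlDr; apply: le_trans.
rewrite mulrC ler_wpM2l// ler_sum// => j _ /=.
by rewrite scaleN1r addrC; apply: sqnorm_orthoproj_ker_le.
Qed.

End KernelDimension.

(** * Integer operators *)

Section IntegerOperators.
Variables (R : realType) (G : groupType) (n : nat).
Local Notation C := R[i].
Local Notation H := (ell2 R G).
Local Notation Hn := ('I_n -> H).
Variables (F : {fset G}) (c0 : 'I_n -> 'I_n -> G -> int).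
Local Notation c := (fun i j g => (c0 i j g)%:~R : C).
Local Notation A := (op_conv F c).
Local Notation A' := (op_conv (invF F) (adj_coef c)).
Local Notation MA psi := (mx_conv F c psi).
Local Notation "p ^Z" := (map_poly (intr : int -> C) p) (at level 2, format "p ^Z").

Lemma mx_conv_int m (psi : G -> 'S_m) : MA psi = map_mx intr (mx_conv F c0 psi).
Proof.
apply/matrixP => p q; rewrite !mxE rmorph_sum; apply: eq_bigr => g _.
by rewrite rmorphM/= rmorph_nat.
Qed.

Lemma poly_mx_int m (psi : G -> 'S_m) (q : {poly int}) :
  poly_mx (MA psi) q^Z = map_mx intr (poly_mx (mx_conv F c0 psi) q).
Proof. by rewrite mx_conv_int -map_poly_mx. Qed.

Lemma int_op_adjoint : adjoint A A'. Proof. exact: op_conv_adjoint. Qed.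

Lemma approximates_polyA f :
  approximates (poly_op A f) (fun m psi => poly_mx (MA psi) f).
Proof. exact: approximates_poly (approximates_conv F c). Qed.

Lemma approximates_polyA' f : approximates (poly_op A' (map_poly Num.conj f))
  (fun m psi => mx_adj (poly_mx (MA psi) f)).
Proof.
apply: approximates_eq (approximates_poly _ (approximates_conv_adj F c)) => // m psi.
by rewrite mx_adj_poly.
Qed.

Local Notation null m psi f := (model_size n m - \rank (poly_mx (MA psi) f))%N.

Lemma null_le f (eta : R) : 0 < eta -> eventually R (fun m psi =>
  (null m psi f)%:R <= (poly_dim A f + eta) * m%:R).
Proof. exact: ker_dim_upper (poly_op_adjoint int_op_adjoint f) (approximates_polyA' f) eta. Qed.

(** In [ker_dim_le_sqfrob] for [f(A)] take the operator [h^* q S], with [S] the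
    truncated Neumann series of [q^* q]. In the finite models [q] is an
    integer matrix, to which [sqfrob_perturbed_le] applies. *)
Lemma poly_dim_le_perturbed (q : {poly int}) (f h Q : {poly C}) (a : C)
    (L d r t K : R) (T k : nat) : q^Z = h * f + a *: Q ->
  (forall m (psi : G -> 'S_m), col_bounded L%:C%C
     (mx_adj (poly_mx (MA psi) q^Z) *m poly_mx (MA psi) q^Z)) ->
  (forall m (psi : G -> 'S_m), col_bounded K%:C%C
     (poly_mx (MA psi) Q *m mx_adj (poly_mx (MA psi) Q))) ->
  1 < L -> 0 <= d -> d * L ^+ T <= 1 -> (0 < T)%N ->
  (1 - d / L) ^+ k <= r -> r <= 1 -> 0 < t -> 0 <= K ->
  forall eta : R, 0 < eta -> eventually R (fun m psi =>
    poly_dim A f * m%:R <=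
      (1 + t) * ((null m psi q^Z)%:R + (n * m)%:R / T%:R + (n * m)%:R * r)
      + (1 + t^-1) * (sqmod a * (K * ((n * m)%:R * k%:R ^+ 2))) + eta * m%:R).
Proof.
move=> qE qL QK L1 d0 dL T0 dr r1 t0 K0 eta eta0.
have appq := approximates_polyA q^Z.
have appY := approximates_comp (approximates_polyA' h) (approximates_comp appq
  (approximates_neumann L k (approximates_comp (approximates_polyA' q^Z) appq))).
have := ker_dim_le_sqfrob (poly_op_adjoint int_op_adjoint f) (approximates_polyA' f) appY eta0.
apply: eventually_mono => m psi _ /le_trans; apply; rewrite lerD2r -!card_model_size.
set M := poly_mx (MA psi) q^Z.
have [P [PP PP' ME]] := gram_spectral M.
have eL := gram_eig_le PP ME (qL m psi).
have [P2 [PP2 PP2' ME2]] := gram_spectral (mx_adj (poly_mx (MA psi) Q)).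
have := @sqfrob_perturbed_le _ _ M P PP PP' ME _ L d r t K T k
  (mx_adj (poly_mx (MA psi) f)) (mx_adj (poly_mx (MA psi) h))
  (mx_adj (poly_mx (MA psi) Q)) a^* (poly_mx_int psi q) L1 eL d0 dL T0 dr r1 t0 K0.
rewrite (gram_null_rank PP PP' ME).
have -> : sqmod a^* = sqmod a.
  by case: (a) => x y; rewrite /sqmod /= sqrrN.
apply.
- by rewrite /M qE poly_mxD mx_adjD poly_mxM mx_adjM poly_mxZ mx_adjZ.
- move=> X; apply: (sqfrob_mul_le PP2 PP2' ME2); rewrite mx_adjK; exact: QK.
Qed.

Lemma Bernoulli_le (a : R) k : 0 <= a <= 1 -> (1 - a) ^+ k * (1 + k%:R * a) <= 1.
Proof.
move=> /andP[a0 a1]; elim: k => [|k IH]; first by rewrite mul0r addr0 mulr1.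
have a1' : 0 <= 1 - a by rewrite subr_ge0.
apply: le_trans IH; rewrite exprS -mulrA mulrCA ler_wpM2l ?exprn_ge0//.
have -> : (1 - a) * (1 + k.+1%:R * a) = (1 + k%:R * a) - k.+1%:R * a ^+ 2.
  by rewrite -natr1; ring.
by rewrite gerBl mulr_ge0// sqr_ge0.
Qed.

Lemma archi_inv (e : R) : 0 < e -> exists2 T : nat, (0 < T)%N & T%:R^-1 <= e.
Proof.
move=> e0; exists (Num.bound e^-1).+1 => //.
rewrite invf_ple ?posrE//; have := archi_boundP (_ : 0 <= e^-1).
rewrite invr_ge0 ltW// => /(_ isT)/ltW/le_trans; apply.
by rewrite ler_nat.
Qed.

(** The parameters of [poly_dim_le_perturbed] are fixed so that the error only
    depends on the product of [sqmod a], [K] and a power of [L]: take [d = L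
    ^- T], for which at most [N / T] nonzero eigenvalues are smaller than [d],
    and [k = k0 * L ^+ T.+1], for which [(1 - d / L) ^+ k <= k0^-1] by
    Bernoulli's inequality. *)
Lemma poly_dim_le_null (eta : R) : 0 < eta -> exists T k0 : nat, exists2 B : R, 0 < B &
  forall (q : {poly int}) (f h Q : {poly C}) (a : C) (L : nat) (K : R),
  q^Z = h * f + a *: Q ->
  (forall m (psi : G -> 'S_m), col_bounded L%:R
     (mx_adj (poly_mx (MA psi) q^Z) *m poly_mx (MA psi) q^Z)) ->
  (forall m (psi : G -> 'S_m), col_bounded K%:C%C
     (poly_mx (MA psi) Q *m mx_adj (poly_mx (MA psi) Q))) ->
  (1 < L)%N -> 0 <= K -> sqmod a * K * ((k0 * L ^ T)%:R ^+ 2) <= B ->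
  eventually R (fun m psi =>
    poly_dim A f * m%:R <= (null m psi q^Z)%:R + eta * m%:R).
Proof.
move=> eta0; (* The five error terms add up to at most [e * (6 * n + 1) * m]. *)
pose e := eta / (8 * n.+1%:R).
have n0 : 0 < n.+1%:R :> R by rewrite ltr0n.
have e0 : 0 < e by rewrite divr_gt0// mulr_gt0.
pose t := Num.min 1 e.
have t0 : 0 < t by rewrite lt_min ltr01 e0.
have t1 : t <= 1 by rewrite ge_min lexx.
have te : t <= e by rewrite ge_min lexx orbT.
have [T T0 Te] := archi_inv e0; have [k0 k00 ke] := archi_inv e0.
pose B := e / (1 + t^-1).
have t'0 : 0 < 1 + t^-1 by rewrite addr_gt0// invr_gt0.
exists T.+1, k0, B; first by rewrite divr_gt0.
move=> q f h Q a L K qE qL QK L1 K0 aB.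
have L0 : 0 < L%:R :> R by rewrite ltr0n ltnW.
pose d : R := (L%:R ^+ T)^-1; pose k := (k0 * L ^ T.+1)%N.
pose r : R := k0%:R^-1.
have d0 : 0 <= d by rewrite invr_ge0 exprn_ge0// ltW.
have a01 : 0 <= d / L%:R <= 1.
  rewrite divr_ge0 ?(ltW L0)//= /d -invfM -exprSr invf_le1 ?exprn_gt0//.
  by rewrite exprn_ege1// ler1n ltnW.
have kd : k%:R * (d / L%:R) = k0%:R.
  rewrite /k /d natrM natrX -invfM -exprSr mulfK//.
  by rewrite expf_neq0// gt_eqF.
have dr : (1 - d / L%:R) ^+ k <= r.
  have := Bernoulli_le k a01; rewrite kd => le1.
  have k0p : 0 < k0%:R :> R by rewrite ltr0n.
  rewrite /r -[leRHS]mul1r ler_pdivlMr//; apply: le_trans le1.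
  rewrite ler_wpM2l ?exprn_ge0 ?subr_ge0 ?(andP a01).2//.
  by rewrite lerDr.
have r1 : r <= 1 by rewrite invf_le1 ?ler1n// ltr0n.
have e1 : 0 < e by [].
have := @poly_dim_le_perturbed q f h Q a L%:R d r t K T k qE _ QK _ d0 _ T0 dr r1 t0 K0 e e0.
have qL' : forall m (psi : G -> 'S_m), col_bounded (L%:R : R)%:C%C
     (mx_adj (poly_mx (MA psi) q^Z) *m poly_mx (MA psi) q^Z).
  by move=> m psi; rewrite rmorph_nat.
have L1' : 1 < L%:R :> R by rewrite ltr1n.
have dL : d * L%:R ^+ T <= 1 by rewrite mulVf// expf_neq0// gt_eqF.
move=> /(_ qL' L1' dL); apply: eventually_mono => m psi _ /le_trans; apply.
have nullN : (null m psi q^Z)%:R <= n%:R * m%:R :> R.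
  by rewrite -natrM -card_model_size ler_nat leq_subr.
set x := (_ - _)%:R in nullN *; have x0 : 0 <= x := ler0n _ _.
set y : R := m%:R; have y0 : 0 <= y := ler0n _ _.
rewrite natrM -/y.
have aB' : (1 + t^-1) * (sqmod a * (K * (n%:R * y * k%:R ^+ 2))) <= e * n%:R * y.
  rewrite -/k in aB.
  have -> : (1 + t^-1) * (sqmod a * (K * (n%:R * y * k%:R ^+ 2))) =
    (1 + t^-1) * (sqmod a * K * k%:R ^+ 2) * (n%:R * y) by ring.
  rewrite -[leRHS]mulrA ler_wpM2r ?mulr_ge0//; apply: le_trans (ler_wpM2l (ltW t'0) aB) _.
  by rewrite /B mulrC divfK// gt_eqF.
have ny0 : 0 <= n%:R * y by rewrite mulr_ge0.
have h1 : t * x <= e * (n%:R * y) by rewrite ler_pM// ltW.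
have h2 : (1 + t) * (n%:R * y / T%:R) <= 2 * (n%:R * y * e).
  by rewrite ler_pM ?addr_ge0 ?mulr_ge0 ?(ltW t0) ?invr_ge0// ?ler_wpM2l//; lra.
have h3 : (1 + t) * (n%:R * y * r) <= 2 * (n%:R * y * e).
  by rewrite ler_pM ?addr_ge0 ?mulr_ge0 ?(ltW t0) ?invr_ge0// ?ler_wpM2l//; lra.
have h4 : e * y + 6 * e * (n%:R * y) <= eta * y.
  have -> : eta = e * (8 * n.+1%:R) by rewrite /e divfK// gt_eqF// mulr_gt0.
  rewrite -subr_ge0 -[n.+1%:R]natr1.
  have -> : e * (8 * (n%:R + 1)) * y - (e * y + 6 * e * (n%:R * y)) =
    e * y * 7 + 2 * e * (n%:R * y) by ring.
  by rewrite addr_ge0 ?mulr_ge0// ltW.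
move: h1 h2 h3 h4 aB'; set z := n%:R * y; set u := (1 + t^-1) * _; move=> h1 h2 h3 h4 h5.
have h5' : u <= e * z by rewrite /z mulrA.
rewrite !mulrDr mulrDl mul1r; lra.
Qed.

End IntegerOperators.

(** * Bounds, minors and minimal polynomials *)

Section Bounds.
Variables (R : realType).
Local Notation C := R[i].
Variables (N : nat).
Implicit Types (M : 'M[C]_N) (f : {poly C}) (K : C).

Lemma col_bounded_le K L M : K <= L -> col_bounded K M -> col_bounded L M.
Proof. by move=> KL MK q; apply: le_trans (MK q) KL. Qed.

Definition poly_bound K f : C := \sum_(i < size f) `|f`_i| * K ^+ i.

Lemma poly_bound_ge0 K f : 0 <= K -> 0 <= poly_bound K f.
Proof. by move=> K0; rewrite sumr_ge0// => i _; rewrite mulr_ge0// exprn_ge0. Qed.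

Lemma poly_bound_conj K f : poly_bound K (map_poly Num.conj f) = poly_bound K f.
Proof.
rewrite /poly_bound size_map_poly; apply: eq_bigr => i _.
by rewrite coef_map norm_conjC.
Qed.

Lemma col_bounded_poly K M f : 0 <= K -> col_bounded K M ->
  col_bounded (poly_bound K f) (poly_mx M f).
Proof.
move=> K0 MK; rewrite poly_mx_coef /poly_bound.
have exps i : col_bounded (K ^+ i) (M ^+ i).
  elim: i => [|i IH]; first exact: col_bounded1.
  by rewrite !exprS; apply: col_bounded_mul.
elim/big_ind2: _ => [q|X a Y b aX bY|i _ q].
- by rewrite big1// => p _; rewrite mxE normr0.
- have := col_bounded_lin 1 aX bY; rewrite normr1 mul1r scale1r; exact.
- under eq_bigr do rewrite mxE normrM.
  by rewrite -mulr_sumr ler_wpM2l// exps.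
Qed.

End Bounds.

Section RationalRank.
Variable (K L : fieldType) (phi : {rmorphism K -> L}).

Lemma exists_minor (p q : nat) (B : 'M[L]_(p, q)) :
  exists (f : 'I_(\rank B) -> 'I_p) (h : 'I_(\rank B) -> 'I_q),
    \det (mxsub f h B) != 0.
Proof.
have free : row_free (rowsub (maxrankfun B) B) by exact: maxrowsub_free.
have full : row_full (rowsub (maxrankfun B) B)^T.
  by rewrite /row_full mxrank_tr; move: free; rewrite /row_free.
have := fullrowsub_unit full; rewrite unitmxE unitfE => det0.
exists (maxrankfun B), (fullrankfun full); rewrite -det_tr.
by apply: contra det0 => /eqP d; apply/eqP; rewrite -d; congr (\det _);
  apply/matrixP => i j; rewrite !mxE.
Qed.

Lemma rank_ge_minor (p q r : nat) (B : 'M[L]_(p, q)) (f : 'I_r -> 'I_p) (h : 'I_r -> 'I_q) :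
  \det (mxsub f h B) != 0 -> (r <= \rank B)%N.
Proof.
move=> d0; have u : mxsub f h B \in unitmx by rewrite unitmxE unitfE.
rewrite -[X in (X <= _)%N](mxrank_unit u).
have -> : mxsub f h B = rowsub f 1%:M *m B *m (rowsub h 1%:M)^T.
  rewrite mul_rowsub_mx mul1mx -[RHS]trmxK trmx_mul trmxK mul_rowsub_mx mul1mx.
  by apply/matrixP => i j; rewrite !mxE.
by rewrite (leq_trans (mxrankM_maxl _ _))// mxrankM_maxr.
Qed.

(** The minors of [a - M] are polynomials in [a] with coefficients in [K]. *)
Lemma rank_specialize N (M : 'M[K]_N) (a b : L) :
  (forall g : {poly K}, root (map_poly phi g) a -> root (map_poly phi g) b) ->
  (\rank (b%:M - map_mx phi M)%R <= \rank (a%:M - map_mx phi M)%R)%N.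
Proof.
move=> ab; have [f [h minor]] := exists_minor (b%:M - map_mx phi M).
apply: (rank_ge_minor (f := f) (h := h)); apply: contra minor.
pose g := \det (mxsub f h (char_poly_mx M)).
have gE c : (map_poly phi g).[c] = \det (mxsub f h (c%:M - map_mx phi M)).
  rewrite -[LHS]/(horner_eval c (map_poly phi g)) -!det_map_mx; congr (\det _).
  apply/matrixP => i j; rewrite !mxE /horner_eval /=.
  rewrite -[LHS]/((map_poly phi _).[c]) rmorphB /= rmorphMn /= map_polyX map_polyC.
  by rewrite hornerD hornerN hornerC hornerMn hornerX.
by rewrite -!gE; apply: ab.
Qed.

End RationalRank.

Section Minpoly.
Variable (L : numFieldType).
Implicit Types (a b : L) (p g : {poly rat}).

Lemma root_map_ratr_dvd p g b : p %| g ->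
  root (map_poly ratr p) b -> root (map_poly ratr g) b.
Proof.
by move=> /dvdpP[h ->] pb; rewrite rmorphM rootM pb orbT.
Qed.

(** Of the factors [gcdp p g] and its cofactor, one has the root [a] and
    therefore is divisible by [p]. *)
Lemma minpoly_coprime a p g : is_minpoly a p -> ~~ (p %| g) -> coprimep p g.
Proof.
move=> [pm pa pmin] png; have p0 : p != 0 := monic_neq0 pm.
have /dvdpP[e' E'] := dvdp_gcdl p g.
move: (pa); rewrite {1}E' rmorphM rootM => /orP[ea|da]; last first.
  by case/negP: png; apply: dvdp_trans (pmin _ da) _; apply: dvdp_gcdr.
have e0 : e' != 0 by apply: contraNneq p0 => e0; rewrite E' e0 mul0r.
have d0 : gcdp p g != 0 by rewrite gcdp_eq0 negb_and p0.
have : (size p <= size e')%N by apply: dvdp_leq (pmin _ ea).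
rewrite {1}E' size_mul// -subn1 leq_subLR addnC leq_add2r => sd.
by rewrite /coprimep eqn_leq sd size_poly_gt0.
Qed.

Lemma coprimep_root_ratr p g b : coprimep p g ->
  root (map_poly ratr p) b -> root (map_poly ratr g) b -> False.
Proof.
move=> /Bezout_eq1_coprimepP[[u v] /= uv] pb gb.
have := congr1 (fun h => (map_poly (ratr : rat -> L) h).[b]) uv.
rewrite rmorphD !rmorphM/= hornerD !hornerM (rootP pb) (rootP gb) !mulr0 addr0.
by rewrite rmorph1 hornerC => /eqP; rewrite eq_sym oner_eq0.
Qed.

Lemma minpoly_conj a b p : is_minpoly a p -> root (map_poly ratr p) b ->
  is_minpoly b p.
Proof.
move=> amin pb; have [pm _ _] := amin; split => // g gb.
by apply: contraT => /(minpoly_coprime amin)/coprimep_root_ratr/(_ pb gb).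
Qed.

Lemma minpoly_root_iff a b p g : is_minpoly a p -> root (map_poly ratr p) b ->
  root (map_poly ratr g) a -> root (map_poly ratr g) b.
Proof. by move=> [_ _ pmin] pb /pmin pg; apply: root_map_ratr_dvd pb. Qed.

(** A monic polynomial of least degree among those vanishing at [a]. *)
Lemma minpoly_exists a g : g != 0 -> root (map_poly ratr g) a ->
  exists p, is_minpoly a p.
Proof.
move=> g0 ga; pose S k := `[< exists h : {poly rat},
  [/\ h != 0, root (map_poly (ratr : rat -> L) h) a & size h = k] >].
have Sex : exists k, S k by exists (size g); apply/asboolP; exists g.
case: (ex_minnP Sex) => k /asboolP[h [h0 ha hk]] kmin.
have lc0 : lead_coef h != 0 by rewrite lead_coef_eq0.
exists ((lead_coef h)^-1 *: h); split.
- by rewrite monicE lead_coefZ mulVf.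
- by rewrite linearZ/= rootZ// fmorph_eq0 invr_eq0.
move=> q qa; rewrite dvdpZl ?invr_eq0//; apply/modp_eq0P/eqP.
apply: contraT => r0.
have ra : root (map_poly ratr (q %% h)) a.
  move: qa; rewrite {1}(divp_eq q h) rmorphD rmorphM /root hornerD hornerM/=.
  by rewrite (rootP ha) mulr0 add0r.
have := ltn_modpN0 q h0; rewrite hk ltnNge kmin//.
by apply/asboolP; exists (q %% h).
Qed.

Lemma minpoly_separable a p : is_minpoly a p -> separable_poly p.
Proof.
move=> amin; have [pm pa _] := amin; have p0 : p != 0 := monic_neq0 pm.
have p1 : (1 < size p)%N.
  rewrite ltnNge; apply/negP => /size1_polyC pc; move: pa.
  rewrite pc map_polyC rootC fmorph_eq0 => /eqP c0.
  by rewrite pc c0 eqxx in p0.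
have dp0 : p^`() != 0.
  apply: contraNneq p0 => dp; have := congr1 (fun h : {poly rat} => h`_(size p).-2) dp.
  rewrite coef_deriv coef0 prednK -?subn1 ?subn_gt0// subn1 => /eqP.
  rewrite -mulr_natr mulf_eq0 pnatr_eq0 -lead_coef_eq0 => /orP[//|].
  by rewrite -subn1 subn_eq0 leqNgt p1.
rewrite unlock; apply: (minpoly_coprime amin); apply/negP => /(dvdp_leq dp0).
by rewrite leqNgt lt_size_deriv.
Qed.

End Minpoly.

(** * Algebraic eigenvalues *)

Section AlgebraicEigenvalues.
Variables (R : realType) (G : groupType) (n : nat).
Local Notation C := R[i].
Local Notation H := (ell2 R G).
Local Notation Hn := ('I_n -> H).
Variables (F : {fset G}) (c0 : 'I_n -> 'I_n -> G -> int).
Local Notation c := (fun i j g => (c0 i j g)%:~R : C).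
Local Notation A := (op_conv F c).
Local Notation MA psi := (mx_conv F c psi).
Local Notation "p ^Z" := (map_poly (intr : int -> C) p) (at level 2, format "p ^Z").
Local Notation null m psi f := (model_size n m - \rank (poly_mx (MA psi) f))%N.

Implicit Types (f : {poly C}).

Hypothesis soficG : sofic R G.

Local Notation AA := (op_conv_adjoint F c).
Local Notation eA := (op_conv_equivariant F c).

Definition coef_size : nat := \sum_i \sum_j \sum_(g <- F) `|c0 i j g|%N.

Lemma coef_sizeE : coef_norm F c = coef_size%:R.
Proof.
rewrite /coef_norm /coef_size natr_sum; apply: eq_bigr => i _.
rewrite natr_sum; apply: eq_bigr => j _; rewrite natr_sum; apply: eq_bigr => g _.
by rewrite -intr_norm -abszE.
Qed.

Lemma poly_mx_bounded f m (psi : G -> 'S_m) :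
  col_bounded (poly_bound coef_size%:R f) (poly_mx (MA psi) f) /\
  col_bounded (poly_bound coef_size%:R f) (mx_adj (poly_mx (MA psi) f)).
Proof.
have k0 : 0 <= coef_size%:R :> C by [].
split; first by apply: col_bounded_poly => //; rewrite -coef_sizeE; apply: mx_conv_bounded.
rewrite mx_adj_poly -(poly_bound_conj _ f); apply: col_bounded_poly => //.
by rewrite -coef_sizeE; apply: mx_conv_adj_bounded.
Qed.

Lemma poly_bound_nat f : exists K : nat, poly_bound coef_size%:R f <= K%:R.
Proof.
set b := poly_bound _ f; exists (Num.bound (complex.Re b)).
have b0 : 0 <= b by apply: poly_bound_ge0.
have bE : (complex.Re b)%:C%C = b by rewrite RRe_real ?ger0_real.
have -> : (Num.bound (complex.Re b))%:R = (Num.bound (complex.Re b))%:R%:C%C :> C.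
  by rewrite rmorph_nat.
by rewrite -[X in X <= _]bE lecR; apply/ltW/archi_boundP; rewrite -ler0c bE.
Qed.

Lemma gram_bounded f K m (psi : G -> 'S_m) : poly_bound coef_size%:R f <= K ->
  col_bounded (K * K) (mx_adj (poly_mx (MA psi) f) *m poly_mx (MA psi) f) /\
  col_bounded (K * K) (poly_mx (MA psi) f *m mx_adj (poly_mx (MA psi) f)).
Proof.
move=> fK; have [b1 b2] := poly_mx_bounded f psi.
have K0 : 0 <= K by apply: le_trans fK; apply: poly_bound_ge0.
by split; apply: col_bounded_mul => //; apply: col_bounded_le fK _.
Qed.

Lemma poly_dimZ a f : a != 0 -> poly_dim A (a *: f) = poly_dim A f.
Proof.
move=> a0; suff kerE : op_ker (poly_op A (a *: f)) = op_ker (poly_op A f).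
  by rewrite /poly_dim /ker_dim kerE.
apply/seteqP; split=> x; rewrite /op_ker /= poly_opZ.
  by move/eqP; rewrite scaler_eq0 (negPf a0) => /eqP.
by move=> ->; exact: scaler0.
Qed.

Lemma poly_dim_ge0 f : 0 <= poly_dim A f.
Proof. exact: (ker_dim_ge0 (poly_op A f)). Qed.

Lemma poly_dim1 : poly_dim A 1 = 0.
Proof.
apply: big1 => j _; have [+ _] := orthoproj_ker (poly_op_adjoint AA 1) (basis_vec j 1%g).
by rewrite /op_ker /= poly_op1 => ->; rewrite /sqnorm innern0l.
Qed.

Lemma poly_dim_le_n f : poly_dim A f <= n%:R.
Proof.
rewrite -[X in X%:R]card_ord -sum1_card natr_sum ler_sum// => j _.
apply: le_trans (sqnorm_orthoproj_ker_le (poly_op_adjoint AA f) _ 0) _.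
rewrite (adjoint0 (adjointC (poly_op_adjoint AA f))) subr0.
by rewrite /sqnorm innern_basis basis_vecE !eqxx.
Qed.

Lemma poly_dim_prod (rs : seq C) : uniq rs ->
  poly_dim A (\prod_(z <- rs) ('X - z%:P)) = \sum_(z <- rs) poly_dim A ('X - z%:P).
Proof.
elim: rs => [|z rs IH] /=; first by rewrite !big_nil poly_dim1.
move=> /andP[zrs urs]; rewrite !big_cons (poly_dimM AA eA) ?IH//.
by rewrite coprimep_sym coprimep_XsubC root_prod_XsubC.
Qed.

Lemma null_prod (rs : seq C) m (psi : G -> 'S_m) :
  (null m psi (\prod_(z <- rs) ('X - z%:P)) <= \sum_(z <- rs) null m psi ('X - z%:P))%N.
Proof.
elim: rs => [|z rs IH].
  by rewrite !big_nil poly_mx1 mxrank1 subnn.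
rewrite !big_cons poly_mxM; apply: leq_trans (leq_add (leqnn _) IH).
set X := poly_mx _ _; set Y := poly_mx _ _.
move: (mxrank_mul_min X Y) (rank_leq_row X) (rank_leq_row Y).
move: (\rank X) (\rank Y) (\rank (X *m Y)) => a b d; lia.
Qed.

(** Together with [null_le] this is the approximation theorem for integer
    operators. *)
Lemma poly_dim_le_int (q : {poly int}) (eta : R) : 0 < eta ->
  eventually R (fun m psi =>
    poly_dim A q^Z * m%:R <= (null m psi q^Z)%:R + eta * m%:R).
Proof.
move=> eta0; have [T [k0 [B B0 +]]] := poly_dim_le_null F c0 eta0.
have [K qK] := poly_bound_nat q^Z.
move=> /(_ q q^Z 1 0 0 (K * K).+2 0); apply=> //.
- by rewrite mul1r scale0r addr0.
- move=> m psi; have [+ _] := gram_bounded psi qK; apply: col_bounded_le.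
  by rewrite -natrM ler_nat; lia.
- move=> m psi p; rewrite poly_mx0 mul0mx big1// => p' _.
  by rewrite mxE normr0.
- by rewrite mulr0 mul0r ltW.
Qed.

Lemma null_scale a f m (psi : G -> 'S_m) : a != 0 ->
  null m psi (a *: f) = null m psi f.
Proof. by move=> a0; rewrite poly_mxZ mxrank_scale_nz. Qed.

(** For integer matrices conjugate eigenvalues have the same multiplicity. *)
Lemma null_conj (z z' : C) m (psi : G -> 'S_m) :
  (forall g : {poly rat}, root (map_poly ratr g) z -> root (map_poly ratr g) z') ->
  (null m psi ('X - z%:P) <= null m psi ('X - z'%:P))%N.
Proof.
move=> zz'.
have E (w : C) : \rank (poly_mx (MA psi) ('X - w%:P)) =
    \rank (w%:M - map_mx ratr (map_mx intr (mx_conv F c0 psi) : 'M[rat]_(model_size n m)))%R.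
  rewrite -[RHS]mxrank_opp opprB poly_mxD poly_mxX -polyCN poly_mxC.
  have -> : (- w)%:M = - w%:M :> 'M[C]_(model_size n m) by exact: raddfN.
  suff -> : MA psi = map_mx ratr (map_mx intr (mx_conv F c0 psi) : 'M[rat]_(model_size n m)) by [].
  by rewrite mx_conv_int; apply/matrixP => i j; rewrite !mxE ratr_int.
by rewrite !E leq_sub2l// rank_specialize.
Qed.

Lemma minpoly_split (a : C) (p : {poly rat}) : is_minpoly a p ->
  exists (rs : seq C) (q : {poly int}) (d : C),
    [/\ uniq rs, forall z, (z \in rs) = root (map_poly ratr p) z, d != 0
      & q^Z = d *: \prod_(z <- rs) ('X - z%:P)].
Proof.
move=> amin; have [pm pa _] := amin.
have [rs rsE] := closed_field_poly_normal (map_poly (ratr : rat -> C) p).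
rewrite lead_coef_map (monicP pm) rmorph1 scale1r in rsE.
have [q [d d0 pq]] := rat_poly_scale p.
exists rs, q, d%:~R; split.
- by rewrite -separable_prod_XsubC -rsE separable_map (minpoly_separable amin).
- by move=> z; rewrite rsE root_prod_XsubC.
- by rewrite intr_eq0.
rewrite -rsE pq linearZ/= -map_poly_comp/= scalerA.
rewrite fmorphV /= ratr_int divff ?intr_eq0// scale1r.
by apply: eq_map_poly => z /=; rewrite ratr_int.
Qed.

(** The mean of the dimensions of the eigenspaces of all conjugates is the limit
    of their common value in the finite models, which bounds each from below. *)
Lemma poly_dim_conj (a b : C) (p : {poly rat}) : is_minpoly a p ->
  root (map_poly ratr p) b ->
  poly_dim A ('X - b%:P) = poly_dim A ('X - a%:P).
Proof.
move=> amin pb; have [pm pa _] := amin.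
have [rs [q [d [urs rsP dC0 qE]]]] := minpoly_split amin.
pose S := \sum_(z <- rs) poly_dim A ('X - z%:P); pose k := size rs.
have qdim : poly_dim A q^Z = S by rewrite qE poly_dimZ// poly_dim_prod.
have le_S z : z \in rs -> S <= k%:R * poly_dim A ('X - z%:P).
  move=> zrs; apply/ler_addgt0Pr => e e0; pose eta := e / k.+1%:R.
  have eta0 : 0 < eta by rewrite divr_gt0.
  have [m [psi [m0 [lower upper]]]] := sofic_eventually soficG (eventually_and
    (poly_dim_le_int q eta0) (null_le F c0 ('X - z%:P) eta0)).
  have mR : 0 < m%:R :> R by rewrite ltr0n.
  rewrite -(ler_pM2r mR) -qdim; apply: le_trans lower _.
  have : (null m psi q^Z <= k * null m psi ('X - z%:P))%N.
    rewrite qE null_scale// (leq_trans (null_prod _ _))//.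
    apply: (@leq_trans (\sum_(w <- rs) null m psi ('X - z%:P))); last first.
      by rewrite big_const_seq count_predT iter_addn addn0 mulnC.
    rewrite big_seq [leqRHS]big_seq leq_sum// => w wrs.
    apply: null_conj => g; rewrite !rsP in zrs wrs.
    exact: minpoly_root_iff (minpoly_conj amin wrs) zrs.
  rewrite -(ler_nat R) natrM => /le_trans h.
  have {h} := h _ (ler_wpM2l (ler0n _ k) upper).
  rewrite -(lerD2r (eta * m%:R)) => /le_trans; apply.
  rewrite mulrA -mulrDl ler_wpM2r// mulrDr -addrA lerD2l.
  have -> : k%:R * eta + eta = e by rewrite /eta; field; rewrite nat1r pnatr_eq0.
  by [].
have k0 : 0 < k%:R :> R.
  by rewrite ltr0n /k; case: (rs) (rsP a) => //; rewrite pa.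
have allE z : z \in rs -> poly_dim A ('X - z%:P) = S / k%:R.
  have : \sum_(w <- rs) (poly_dim A ('X - w%:P) - S / k%:R) == 0.
    rewrite sumrB -/S big_const_seq count_predT iter_addr addr0 -/k.
    by rewrite -[X in _ - X]mulr_natr divfK ?subrr// gt_eqF.
  rewrite big_seq psumr_eq0 => [/allP h zrs|w wrs]; last first.
    by rewrite subr_ge0 ler_pdivrMr// mulrC le_S.
  by have := h z zrs; rewrite zrs subr_eq0 => /eqP.
by rewrite !allE ?rsP.
Qed.

(** Some conjugate of [a], hence [a] itself, is an eigenvalue of an integer
    matrix among the finite models, hence a root of its characteristic
    polynomial. *)
Lemma integral_of_minpoly (a : C) (p : {poly rat}) : is_minpoly a p ->
  0 < poly_dim A ('X - a%:P) -> integralOver (intr : int -> C) a.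
Proof.
move=> amin D0; have [pm pa _] := amin.
have [rs [q [d [urs rsP d0 qE]]]] := minpoly_split amin.
have ars : a \in rs by rewrite rsP.
pose D := poly_dim A ('X - a%:P); have eta0 : 0 < D / 2 by rewrite divr_gt0.
have [m [psi [m0 lower]]] := sofic_eventually soficG (poly_dim_le_int q eta0).
have : (0 < null m psi q^Z)%N.
  rewrite -(ltr_nat R); have mR : 0 < m%:R :> R by rewrite ltr0n.
  have : D * m%:R <= (null m psi q^Z)%:R + D / 2 * m%:R.
    apply: le_trans lower; rewrite ler_pM2r// qE poly_dimZ// poly_dim_prod//.
    rewrite (big_rem a ars) -/D lerDl.
    by apply: sumr_ge0 => z _; apply: poly_dim_ge0.
  have : 0 < D / 2 * m%:R by rewrite mulr_gt0.
  have -> : D * m%:R = D / 2 * m%:R + D / 2 * m%:R by field.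
  by move=> ?; rewrite lerD2r; apply: lt_le_trans.
rewrite qE null_scale// => /leq_trans/(_ (null_prod rs psi)) sum0.
have null0 : (0 < null m psi ('X - a%:P))%N.
  rewrite lt0n; apply/negP => /eqP na; move: sum0; rewrite big_seq big1// => z zrs.
  apply/eqP; rewrite -leqn0 -na; apply: null_conj => g.
  by rewrite rsP in zrs; exact: minpoly_root_iff (minpoly_conj amin zrs) pa.
exists (char_poly (mx_conv F c0 psi)); first exact: char_poly_monic.
rewrite map_char_poly -mx_conv_int -eigenvalue_root_char /eigenvalue /eigenspace.
rewrite -mxrank_eq0 mxrank_ker -lt0n; move: null0.
by rewrite poly_mxD poly_mxX -polyCN poly_mxC raddfN.
Qed.

End AlgebraicEigenvalues.

(** * Small values of integer polynomials *)

Section SmallValues.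
Variable (R : realType).
Local Notation C := R[i].
Local Notation "p ^Z" := (map_poly (intr : int -> C) p) (at level 2, format "p ^Z").

Lemma truncn_eq_dist (x y : R) : 0 <= x -> 0 <= y ->
  Num.truncn x = Num.truncn y -> `|x - y| <= 1.
Proof.
move=> x0 y0 xy; have /andP[x1 x2] := truncn_itv x0; have /andP[y1 y2] := truncn_itv y0.
rewrite ler_distl; rewrite xy -natr1 in x1 x2; rewrite -natr1 in y2.
by apply/andP; split; lra.
Qed.

(** Dirichlet's box principle: among the values at [alpha] of the polynomials with
    coefficients in [[0, H]], two lie in the same of about [H ^ (2 s + 2)] small
    squares. *)
Lemma small_integer_poly (alpha : C) (s : nat) : exists (D : nat) (B : R),
  0 <= B /\ forall H : nat, (0 < H)%N -> exists r : {poly int},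
    [/\ r != 0, (size r <= D)%N, forall i : nat, (absz (r`_i)%R <= H)%N
      & sqmod (r^Z).[alpha] * H%:R ^+ (2 * s) <= B].
Proof.
(* There are [(H + 1) ^ D] polynomials and [(H ^ s.+1 + 1) ^ 2] squares. *)
pose D := (2 * s).+3.
pose S : R := 1 + complex.Re (\sum_(i < D) `|alpha ^+ i|).
have sum0 : 0 <= \sum_(i < D) `|alpha ^+ i| by rewrite sumr_ge0.
have SE : (S - 1)%:C%C = \sum_(i < D) `|alpha ^+ i|.
  by rewrite /S addrAC subrr add0r RRe_real ?ger0_real.
have S0 : 0 < S by rewrite ltr_pwDl// -ler0c RRe_real ?ger0_real.
exists D, (8 * S ^+ 2); split; first by rewrite mulr_ge0// sqr_ge0.
move=> H H0; pose M := (H ^ s.+1)%N.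
have HR : 0 < H%:R :> R by rewrite ltr0n.
have MR : 0 < M%:R :> R by rewrite ltr0n expn_gt0 H0.
pose V (a : {ffun 'I_D -> 'I_H.+1}) : C := \sum_i (a i)%:R * alpha ^+ i.
pose box (p : C -> R) a := Num.truncn ((p (V a) + H%:R * S) * (M%:R / (2 * (H%:R * S)))).
have HS0 : 0 < H%:R * S by rewrite mulr_gt0.
have VS a : `|V a| <= (H%:R * S)%:C%C.
  apply: le_trans (ler_norm_sum _ _ _) _.
  apply: (@le_trans _ _ (H%:R%:C%C * (S - 1)%:C%C)); last first.
    by rewrite -rmorphM lecR ler_wpM2l// lerBlDr lerDl.
  rewrite SE mulr_sumr ler_sum// => i _; rewrite normrM normr_nat rmorph_nat.
  by rewrite ler_wpM2r// ler_nat -ltnS.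
have boxP (p : C -> R) : (forall z, `|p z|%:C%C <= `|z|) -> forall a,
    0 <= (p (V a) + H%:R * S) * (M%:R / (2 * (H%:R * S))) /\ (box p a < M.+1)%N.
  move=> pz a; have : `|p (V a)| <= H%:R * S by rewrite -lecR (le_trans (pz _)).
  rewrite ler_norml => /andP[p1 p2].
  have x0 : 0 <= (p (V a) + H%:R * S) * (M%:R / (2 * (H%:R * S))).
    rewrite mulr_ge0//; first by rewrite -lerBlDr sub0r.
    by rewrite divr_ge0// mulr_ge0// ltW.
  split => //; rewrite ltnS -(ler_nat R).
  have /andP[h _] := truncn_itv x0; apply: le_trans h _.
  rewrite mulrCA ger_pMr// ler_pdivrMr ?mulr_gt0// mul1r; lra.
have ReN (z : C) : `|complex.Re z|%:C%C <= `|z| by exact: normc_ge_Re.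
have ImN (z : C) : `|complex.Im z|%:C%C <= `|z|.
  by case: z => x y; rewrite normc_def lecR /= -sqrtr_sqr ler_wsqrtr// lerDr sqr_ge0.
pose f a := (inord (box (@complex.Re R) a) : 'I_M.+1, inord (box (@complex.Im R) a) : 'I_M.+1).
have [a [b [ab fab]]] : exists a b, a <> b /\ f a = f b.
  apply: contrapT => nex.
  have fI : injective f by move=> a b fab; apply: contrapT => ab; apply: nex; exists a, b.
  have := leq_card f fI; rewrite card_prod !card_ord card_ffun !card_ord leqNgt => /negP[].
  have le1 : (M.+1 <= H.+1 ^ s.+1)%N by rewrite ltn_exp2r.
  apply: (@leq_ltn_trans (H.+1 ^ (s.+1 + s.+1))%N); first by rewrite expnD leq_mul.
  by rewrite ltn_exp2l// addnn -mul2n mulnS.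
have diff (p : C -> R) : (forall z, `|p z|%:C%C <= `|z|) -> box p a = box p b ->
    (p (V a) - p (V b)) ^+ 2 <= 4 * S ^+ 2 / H%:R ^+ (2 * s).
  move=> pz eq_box; have [xa _] := boxP p pz a; have [xb _] := boxP p pz b.
  have := truncn_eq_dist xa xb eq_box.
  rewrite -mulrBl opprD addrACA subrr addr0 normrM [X in _ * X]ger0_norm; last first.
    by rewrite divr_ge0// ltW// mulr_gt0.
  rewrite -ler_pdivlMr ?divr_gt0 ?mulr_gt0// div1r invf_div => le1.
  have -> : 4 * S ^+ 2 / H%:R ^+ (2 * s) = (2 * (H%:R * S) / M%:R) ^+ 2.
    rewrite /M natrX (exprS H%:R) (mulnC 2) exprM.
    have : H%:R ^+ s != 0 :> R by rewrite expf_neq0 ?gt_eqF.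
    by move: (H%:R ^+ s) => h h0; field; rewrite h0 gt_eqF.
  by rewrite -real_normK ?num_real// lerXn2r ?nnegrE// (le_trans _ le1).
have boxeq : box (@complex.Re R) a = box (@complex.Re R) b /\
             box (@complex.Im R) a = box (@complex.Im R) b.
  have : (f a).1 = (f b).1 /\ (f a).2 = (f b).2 by rewrite fab.
  case=> /(congr1 (@nat_of_ord _)) + /(congr1 (@nat_of_ord _)); rewrite /f /=.
  by rewrite !inordK ?(boxP _ ReN _).2 ?(boxP _ ImN _).2// => -> ->.
pose r : {poly int} := \poly_(i < D) ((a (inord i))%:Z - (b (inord i))%:Z).
exists r; split.
- apply: contra_notN ab => /eqP r0; apply/ffunP => i; apply/val_inj => /=.
  have := congr1 (fun h : {poly int} => h`_i) r0.
  by rewrite coef_poly ltn_ord inord_val coef0 => /eqP; rewrite subr_eq0 => /eqP[].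
- exact: size_poly.
- move=> i; rewrite coef_poly; case: ifP => // _.
  have := ltn_ord (a (inord i)); have := ltn_ord (b (inord i)); lia.
have -> : (r^Z).[alpha] = V a - V b.
  rewrite (horner_coef_wide _ (leq_trans (size_poly _ _) (size_poly _ _))).
  rewrite /V -sumrB; apply: eq_bigr => i _.
  by rewrite coef_map coef_poly ltn_ord inord_val /= intrB mulrBl.
have /(diff _ ReN) d1 := boxeq.1; have /(diff _ ImN) d2 := boxeq.2.
rewrite -ler_pdivlMr ?exprn_gt0//.
have -> : sqmod (V a - V b) = (complex.Re (V a) - complex.Re (V b)) ^+ 2 +
    (complex.Im (V a) - complex.Im (V b)) ^+ 2.
  by case: (V a) (V b) => ? ? [].
by apply: le_trans (lerD d1 d2) _; rewrite -!mulrDl ler_wpM2r ?invr_ge0 ?exprn_ge0//;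
  rewrite le_eqVlt; apply/orP; left; apply/eqP; ring.
Qed.

End SmallValues.

(** * Transcendental eigenvalues *)

Section TranscendentalEigenvalues.
Variables (R : realType) (G : groupType) (n : nat).
Local Notation C := R[i].
Variables (F : {fset G}) (c0 : 'I_n -> 'I_n -> G -> int).
Local Notation c := (fun i j g => (c0 i j g)%:~R : C).
Local Notation A := (op_conv F c).
Local Notation MA psi := (mx_conv F c psi).
Local Notation "p ^Z" := (map_poly (intr : int -> C) p) (at level 2, format "p ^Z").
Local Notation null m psi f := (model_size n m - \rank (poly_mx (MA psi) f))%N.

Hypothesis soficG : sofic R G.

Lemma poly_bound_int (k : nat) (r : {poly int}) (D H : nat) : (size r <= D)%N ->
  (forall i : nat, (absz (r`_i)%R <= H)%N) ->
  poly_bound (k%:R : C) r^Z <= (H * \sum_(i < D) k ^ i)%:R.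
Proof.
move=> rD rH; rewrite /poly_bound natrM natr_sum mulr_sumr.
rewrite (big_ord_widen D (fun i => `|(r^Z)`_i| * k%:R ^+ i)); last first.
  exact: leq_trans (size_poly _ _) rD.
rewrite big_mkcond ler_sum// => i _; case: ifP => _; last by rewrite mulr_ge0.
by rewrite natrX ler_wpM2r// coef_map /= -intr_norm -abszE ler_nat.
Qed.

Lemma square_height (K H W T : nat) : ((K * (H * W)) * (K * (H * W)))%:R ^+ T =
  (K * W)%:R ^+ (2 * T) * H%:R ^+ (2 * T) :> R.
Proof.
rewrite (_ : _ * _ = (K * W) * (K * W) * (H * H))%N; last by lia.
by rewrite !exprM !expr2 -exprMn -!natrM.
Qed.

Lemma collect_height (x K k KW H : R) (T : nat) :
  x * (K * K) * (k * (KW ^+ (2 * T) * H ^+ (2 * T))) ^+ 2 * H ^+ 2 =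
  x * H ^+ (2 * (2 * T).+1) * (K ^+ 2 * k ^+ 2 * KW ^+ (4 * T)).
Proof.
rewrite (_ : 2 * (2 * T).+1 = 2 * T + 2 * T + 2)%N; last by lia.
rewrite (_ : 4 * T = 2 * T + 2 * T)%N; last by lia.
by rewrite !exprD; ring.
Qed.

(** On the kernel of [f = Q * ('X - alpha)] the operator given by [Q * r] has norm
    at most [|r.[alpha]|] times that of [Q]. As [r.[alpha]] is smaller than a
    prescribed negative power of the height of [r], most of the corresponding small
    singular values of the integer matrices must vanish. *)
Lemma transcendental_step (alpha : C) (Q : {poly int}) :
    (forall g : {poly int}, g != 0 -> ~~ root g^Z alpha) -> Q != 0 ->
    0 < poly_dim A ('X - alpha%:P) ->
  exists2 Q' : {poly int}, Q' != 0 &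
    poly_dim A Q^Z + poly_dim A ('X - alpha%:P) / 2 <= poly_dim A Q'^Z.
Proof.
move=> trans Q0; set delta := poly_dim A _ => delta0.
pose eta := delta / 4; have eta0 : 0 < eta by rewrite divr_gt0.
have [T [k0 [B B0 key]]] := poly_dim_le_null F c0 eta0.
(* Enlarging the bound of [Q] ensures [1 < L] below. *)
have [K0 QK0] := poly_bound_nat F c0 Q^Z; pose K := K0.+2.
have QK : poly_bound (coef_size F c0)%:R Q^Z <= K%:R :> C.
  by apply: le_trans QK0 _; rewrite ler_nat /K; lia.
pose s := (2 * T).+1; have [D [B' [B'0 small]]] := small_integer_poly alpha s.
pose W := (\sum_(i < D) coef_size F c0 ^ i).+1.
pose P : R := K%:R ^+ 2 * k0%:R ^+ 2 * (K * W)%:R ^+ (4 * T).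
have P0 : 0 <= P by rewrite !mulr_ge0// exprn_ge0.
(* As [s = 2 T + 1], the error is [O(H ^- 2)]. *)
pose H := (Num.bound (B' * P / B)).+1.
have HB : B' * P <= B * H%:R.
  rewrite (mulrC B) -ler_pdivrMr//.
  have /archi_boundP/ltW/le_trans : 0 <= B' * P / B by rewrite divr_ge0 ?mulr_ge0// ltW.
  by apply; rewrite ler_nat.
have H1 : 1 <= H%:R :> R by rewrite ler1n.
have [r [r0 rD rH ra]] := small H isT.
have rW : poly_bound (coef_size F c0)%:R r^Z <= (H * W)%:R :> C.
  by apply: le_trans (poly_bound_int _ rD rH) _; rewrite ler_nat leq_mul2l leqnSn orbT.
pose a := (r^Z).[alpha]; pose q := Q * r.
exists q; first by rewrite mulf_neq0.
have qZ : q^Z = Q^Z * r^Z by rewrite rmorphM.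
have /factor_theorem[h hE] : root (r^Z - a%:P) alpha.
  by rewrite /root hornerD hornerN hornerC subrr.
pose f := Q^Z * ('X - alpha%:P).
have qE : q^Z = h * f + a *: Q^Z.
  rewrite qZ -[r^Z](subrK a%:P) hE mulrDr -mul_polyC /f; ring.
pose L := ((K * (H * W)) * (K * (H * W)))%N.
have colq m (psi : G -> 'S_m) : col_bounded (K%:R * (H * W)%:R) (poly_mx (MA psi) q^Z) /\
    col_bounded (K%:R * (H * W)%:R) (mx_adj (poly_mx (MA psi) q^Z)).
  have [Q1 Q2] := poly_mx_bounded F c0 Q^Z psi.
  have [r1 r2] := poly_mx_bounded F c0 r^Z psi.
  split; first by rewrite qZ poly_mxM; apply: col_bounded_mul => //;
    [apply: col_bounded_le QK _ | apply: col_bounded_le rW _].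
  rewrite qZ poly_mxM mx_adjM mulrC; apply: col_bounded_mul => //;
    [exact: col_bounded_le rW _ | exact: col_bounded_le QK _].
have L1 : (1 < L)%N.
  have K1 : (1 < K * (H * W))%N by rewrite (@leq_trans K)// leq_pmulr// muln_gt0.
  by rewrite (leq_trans K1)// leq_pmulr// ltnW.
have colL m (psi : G -> 'S_m) : col_bounded L%:R
    (mx_adj (poly_mx (MA psi) q^Z) *m poly_mx (MA psi) q^Z).
  have [q1 q2] := colq m psi.
  by rewrite /L !natrM -natrM; apply: col_bounded_mul => //; rewrite mulr_ge0.
have colK m (psi : G -> 'S_m) : col_bounded (K%:R * K%:R : R)%:C%C
    (poly_mx (MA psi) Q^Z *m mx_adj (poly_mx (MA psi) Q^Z)).
  by rewrite rmorphM/= rmorph_nat; have [_] := gram_bounded psi QK.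
have aB : sqmod a * (K%:R * K%:R) * ((k0 * L ^ T)%:R ^+ 2) <= B.
  have HR : 0 < H%:R ^+ 2 :> R by rewrite exprn_gt0.
  rewrite -(ler_pM2r HR).
  have -> : sqmod a * (K%:R * K%:R) * (k0 * L ^ T)%:R ^+ 2 * H%:R ^+ 2 =
      sqmod a * H%:R ^+ (2 * s) * P.
    by rewrite natrM natrX square_height collect_height.
  apply: le_trans (ler_wpM2r P0 ra) _; apply: le_trans HB _.
  by rewrite ler_pM2l// ler_eXnr.
have ev := key q f h Q^Z a L (K%:R * K%:R) qE colL colK L1 (mulr_ge0 (ler0n _ _) (ler0n _ _)) aB.
have [m [psi [m0 [lower upper]]]] :=
  sofic_eventually soficG (eventually_and ev (null_le F c0 q^Z eta0)).
have mR : 0 < m%:R :> R by rewrite ltr0n.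
have fdim : poly_dim A f = poly_dim A Q^Z + delta.
  rewrite (poly_dimM (op_conv_adjoint F c) (op_conv_equivariant F c))//.
  by rewrite coprimep_XsubC trans.
have : poly_dim A f * m%:R <= (poly_dim A q^Z + eta + eta) * m%:R.
  by apply: le_trans lower _; rewrite [leRHS]mulrDl lerD2r.
rewrite ler_pM2r// fdim /eta => h1.
suff : poly_dim A Q^Z + delta <= poly_dim A q^Z + delta / 4 + delta / 4 by lra.
exact: h1.
Qed.

(** Iterating [transcendental_step] would give polynomials of unbounded
    dimension. *)
Lemma transcendental_dim0 (alpha : C) :
    (forall g : {poly int}, g != 0 -> ~~ root g^Z alpha) ->
  poly_dim A ('X - alpha%:P) = 0.
Proof.
move=> trans; set delta := poly_dim A _; apply/eqP; apply: contraT => d0.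
have delta0 : 0 < delta by rewrite lt_def d0 poly_dim_ge0.
have grow (j : nat) : exists2 Q : {poly int}, Q != 0 & j%:R * (delta / 2) <= poly_dim A Q^Z.
  elim: j => [|j [Q Q0 IH]].
    by exists 1; rewrite ?oner_neq0// mul0r poly_dim_ge0.
  have [Q' Q'0 le_Q'] := transcendental_step trans Q0 delta0.
  exists Q' => //; apply: le_trans le_Q'.
  by rewrite -natr1 mulrDl mul1r lerD2r.
have [Q _] := grow (Num.bound (n%:R / (delta / 2))).
move=> /le_trans/(_ (poly_dim_le_n _ _ _)); rewrite leNgt => /negP[].
rewrite -ltr_pdivrMr ?divr_gt0//; apply: archi_boundP.
by rewrite divr_ge0// ltW// divr_gt0.
Qed.

End TranscendentalEigenvalues.

(** * Matrices over the integral group ring *)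

Section GroupRingMatrices.
Variables (R : realType) (G : groupType) (n : nat) (A : 'M[group_ring G]_n).
Local Notation C := R[i].

Definition supports : {fset G} :=
  (\bigcup_(p <- enum {: 'I_n * 'I_n}) finsupp (A p.1 p.2))%fset.

Lemma lambda_op_conv :
  lambda (R := R) A = op_conv supports (fun i j g => (A i j g)%:~R).
Proof.
apply/funext => x; apply/funext => i; apply: eq_bigr => j _.
have sub : (finsupp (A i j) `<=` supports)%fset.
  exact: (bigfcup_sup (j := (i, j)) (fun p => finsupp (A p.1 p.2)) (mem_enum _ _) isT).
by apply: big_fset_incl => // g _ /fsfun_dflt ->; rewrite scale0r.
Qed.

Lemma eigenker_poly (alpha : C) :
  eigenker A alpha = op_ker (poly_op (lambda A) ('X - alpha%:P)).
Proof.
apply/seteqP; split=> x; rewrite /eigenker /op_ker /= poly_opB poly_opX poly_opC.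
  by move=> /eqP; rewrite subr_eq0 => /eqP ->; rewrite subrr.
by move=> /eqP; rewrite subr_eq0 => /eqP ->; rewrite subrr.
Qed.

Local Notation op := (op_conv supports (fun i j g => (A i j g)%:~R : C)).

Lemma vn_dim_eigenker (alpha : C) :
  vn_dim (eigenker A alpha) = (poly_dim op ('X - alpha%:P))%:C%C.
Proof.
rewrite eigenker_poly lambda_op_conv.
exact: vn_dim_ker (poly_op_adjoint (op_conv_adjoint _ _) _).
Qed.

Lemma is_eigenvalueP (alpha : C) :
  is_eigenvalue A alpha <-> 0 < poly_dim op ('X - alpha%:P).
Proof.
rewrite /is_eigenvalue eigenker_poly lambda_op_conv.
apply: ker_dim_gt0; first exact: poly_op_adjoint (op_conv_adjoint _ _) _.
exact: poly_op_equivariant (op_conv_equivariant _ _).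
Qed.

Lemma eigenvalue_algebraic (alpha : C) : sofic R G -> is_eigenvalue A alpha ->
  exists p, is_minpoly alpha p.
Proof.
move=> soficG /is_eigenvalueP d0; apply: contrapT => nomin.
suff dim0 : poly_dim op ('X - alpha%:P) = 0 by rewrite dim0 ltxx in d0.
apply: transcendental_dim0 => // g g0; apply/negP => groot; apply: nomin.
apply: (@minpoly_exists _ _ (map_poly intr g)).
  by rewrite map_poly_eq0_id0 ?intr_eq0 ?lead_coef_eq0.
by rewrite -map_poly_comp/= (eq_map_poly (g := intr)) // => z /=; rewrite ratr_int.
Qed.

End GroupRingMatrices.

Theorem theorem1p1 (R : realType) (G : groupType) (n : nat)
    (A : 'M[group_ring G]_n) (soficG : sofic R G) (n_gt0 : (0 < n)%N) :
  (forall alpha : R[i], is_eigenvalue A alpha ->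
     integralOver (intr : int -> R[i]) alpha) /\
  (forall alpha : R[i], is_eigenvalue A alpha ->
     forall beta : R[i], galois_conjugate alpha beta ->
       is_eigenvalue A beta /\
       vn_dim (eigenker A beta) = vn_dim (eigenker A alpha)).
Proof.
split=> [alpha eig|alpha eig beta [p pmin pb]].
  have [p pmin] := eigenvalue_algebraic soficG eig.
  apply: (@integral_of_minpoly R G n (supports A) (fun i j g => A i j g) soficG _ _ pmin).
  exact: (proj1 (is_eigenvalueP A alpha) eig).
have dimE := poly_dim_conj (supports A) (fun i j g => A i j g) soficG pmin pb.
split; last by rewrite !vn_dim_eigenker dimE.
by apply/is_eigenvalueP; rewrite dimE; exact: (proj1 (is_eigenvalueP A alpha) eig).
Qed.
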